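(* Let $g:\mathbb{R}\to\mathbb{R}$ be Lipschitz continuous, $\mathbb{Z}$-periodic and such that $g(y)>0$ for every $y$, let $0<\alpha<1$, and let $u_0:\mathbb{R}^n\to\mathbb{R}$ be a Lipschitz function bounded from above. For $\varepsilon>0$ let $u^\varepsilon_\alpha$ be the solution to $$u^\varepsilon_t-\varepsilon^\alpha\Delta u^\varepsilon-g\left(\frac{u^\varepsilon}{\varepsilon}\right)=0\ \text{ in }\mathbb{R}^n\times(0,+\infty),\qquad u^\varepsilon(x,0)=u_0(x)\ \text{ in }\mathbb{R}^n,$$ and let $u$ be a limit of $u^\varepsilon_\alpha$. Then $$\lim_{t\to+\infty}\left[u(x,t)-\sup_{\mathbb{R}^n}u_0-t\left(\int_0^1\frac1{g(s)}\,ds\right)^{-1}\right]=0\qquad\text{locally uniformly.}$$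
   Context: $\Delta$ is the Laplacian in $x$. The solution $u^\varepsilon_\alpha$ is the unique solution, of class $C^{2+\gamma,1+\gamma/2}$ for all $\gamma\in(0,1)$. A limit of $u^\varepsilon_\alpha$ is a function $u$ such that $u^{\varepsilon_k}_\alpha\to u$ locally uniformly in $\mathbb{R}^n\times[0,+\infty)$ for some sequence $\varepsilon_k\to0^+$. The final limit is locally uniform in $x\in\mathbb{R}^n$.
   Formalization: The function g is additionally assumed non-constant: for g = 1 and u_0(x) = -|x| one gets u(x,t) = u_0(x) + t, so the bracket equals -|x| for every t and does not tend to 0; for constant g the claim holds only when u_0 is constant. *)

(* Defs.v *)
From HB Require Import structures.
From mathcomp Require Import all_boot all_order all_algebra.
From mathcomp Require Import all_classical all_reals all_analysis.

Set Implicit Arguments.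
Unset Strict Implicit.
Unset Printing Implicit Defensive.

Import Order.TTheory GRing.Theory Num.Theory.
Import numFieldNormedType.Exports.

Local Open Scope classical_set_scope.
Local Open Scope ring_scope.

(* Space-time functions on R^n x [0, +oo) are functions v : 'rV[R]_n -> R -> R
   (space first, then time); values at negative times are never used. The norm
   of 'rV[R]_n is the sup norm, which is equivalent to the Euclidean one. *)

Definition unit_vec (R : realType) (n : nat) (i : 'I_n) : 'rV[R]_n :=
  delta_mx 0 i.

Definition dx (R : realType) (n : nat) (i : 'I_n) (v : 'rV[R]_n -> R -> R)
    (x : 'rV[R]_n) (t : R) : R :=
  'D_(unit_vec R i) (fun y => v y t) x.

Definition dt (R : realType) (n : nat) (v : 'rV[R]_n -> R -> R)
    (x : 'rV[R]_n) (t : R) : R :=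
  derive1 (v x) t.

Definition laplacian (R : realType) (n : nat) (v : 'rV[R]_n -> R -> R)
    (x : 'rV[R]_n) (t : R) : R :=
  \sum_(i < n) dx i (dx i v) x t.

Definition has_dx (R : realType) (n : nat) (v : 'rV[R]_n -> R -> R) : Prop :=
  forall (i : 'I_n) (x : 'rV[R]_n) (t : R), 0 < t ->
    derivable (fun y => v y t) x (unit_vec R i).

Definition has_dt (R : realType) (n : nat) (v : 'rV[R]_n -> R -> R) : Prop :=
  forall (x : 'rV[R]_n) (t : R), 0 < t -> derivable (v x) t 1.

(* C^{gamma, gamma/2}, locally in the open set R^n x (0, +oo). *)
Definition parabolic_holder (R : realType) (n : nat) (gamma : R)
    (v : 'rV[R]_n -> R -> R) : Prop :=
  forall K : set ('rV[R]_n * R),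
    compact K -> K `<=` [set z | 0 < z.2] ->
    exists C : R, forall z w : 'rV[R]_n * R, K z -> K w ->
      `|v z.1 z.2 - v w.1 w.2|
        <= C * (`|z.1 - w.1| `^ gamma + `|z.2 - w.2| `^ (gamma / 2)).

(* C^{2+gamma, 1+gamma/2}. With merely Lipschitz initial data this regularity
   cannot hold up to t = 0, so it is local in R^n x (0, +oo). *)
Definition parabolic_C2holder (R : realType) (n : nat) (gamma : R)
    (v : 'rV[R]_n -> R -> R) : Prop :=
  [/\ has_dt v,
      has_dx v,
      (forall i : 'I_n, has_dx (dx i v)),
      parabolic_holder gamma v /\ parabolic_holder gamma (dt v) &
      (forall i : 'I_n, parabolic_holder gamma (dx i v)) /\
      (forall i j : 'I_n, parabolic_holder gamma (dx i (dx j v)))].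

(* Solutions of a heat-type equation on the whole space are unique only under
   a restriction at infinity (Tychonoff); since the initial datum is Lipschitz
   and g is bounded, the solution grows at most linearly in x. *)
Definition linear_growth (R : realType) (n : nat) (v : 'rV[R]_n -> R -> R) :
    Prop :=
  forall T : R, exists C : R, forall (x : 'rV[R]_n) (t : R),
    0 <= t <= T -> `|v x t| <= C * (1 + `|x|).

Definition is_solution (R : realType) (n : nat) (g : R -> R) (alpha : R)
    (u0 : 'rV[R]_n -> R) (e : R) (v : 'rV[R]_n -> R -> R) : Prop :=
  [/\ (forall gamma : R, 0 < gamma < 1 -> parabolic_C2holder gamma v),
      {within [set z : 'rV[R]_n * R | 0 <= z.2],
        continuous (fun z => v z.1 z.2)},
      linear_growth v,
      (forall (x : 'rV[R]_n) (t : R), 0 < t ->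
        dt v x t - e `^ alpha * laplacian v x t - g (v x t / e) = 0) &
      (forall x : 'rV[R]_n, v x 0 = u0 x)].

(* As R^n x [0, +oo) is locally compact, locally uniform convergence is
   uniform convergence on compact subsets. *)
Definition is_limit (R : realType) (n : nat) (ue : R -> 'rV[R]_n -> R -> R)
    (u : 'rV[R]_n -> R -> R) : Prop :=
  exists eps_ : nat -> R,
    [/\ (forall k, 0 < eps_ k),
        eps_ @ \oo --> (0 : R) &
        forall K : set ('rV[R]_n * R),
          compact K -> K `<=` [set z | 0 <= z.2] ->
          {uniform K, (fun k (z : 'rV[R]_n * R) => ue (eps_ k) z.1 z.2) @ \oo
             --> (fun z : 'rV[R]_n * R => u z.1 z.2)}].

(* Main.v *)
Require Import Defs.
From HB Require Import structures.
From mathcomp Require Import all_boot all_order all_algebra.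
From mathcomp Require Import all_classical all_reals all_analysis.
From mathcomp Require Import ring lra.

Set Implicit Arguments.
Unset Strict Implicit.
Unset Printing Implicit Defensive.

Import Order.TTheory GRing.Theory Num.Theory.
Import numFieldNormedType.Exports.

Local Open Scope classical_set_scope.
Local Open Scope ring_scope.

(** Write [v] for the solution at scale [e], [hmean] for the inverse of the mean
    of [1 / g], and [amean] for the mean of [g]; [hmean < amean] because [g] is
    not constant. Where [v] is flat it follows [v' = g (v / e)] and rises at speed
    [hmean]. Where it has a slope, the diffusion, of coefficient [e^alpha], is
    strong compared with the microscopic scale [e]: the rate is averaged
    arithmetically and [v] rises at speed [amean]. So nothing overtakes the
    supremum of the datum, which rises at speed [hmean], while all other parts are
    steep until they have caught up with it; on a compact set the limit therefore
    becomes a plateau of height [sup u0 + hmean t].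

    Both bounds are proved at scale [e] by means of correctors. A corrector is an
    increasing function [Psi (y, M)] of [y = v / e] and of the squared slope [M] in
    microscopic units, such that [Psi (y, M) - y] is bounded; the phase
    [e Psi (v / e, M)] then moves at least at speed [c] as soon as
    [c psi^2 + M psi_y <= g psi^3], where [psi = Psi_y] (this is [corrector_at]).
    The heart of the proof is that this can be solved for every [M] with [c] as
    close as desired to [hmean]. For [M = m] let [h] be the periodic solution of
    the linear equation [h - (m / hmean^2) g h' = g^2] and [psi = mu / sqrt h],
    where [mu] makes the mean of [psi] equal to 1. The inequality of arithmetic and
    geometric means gives [mu >= hmean] ([fA1_le_travel]), and then the inequality
    for [psi] says that a sum of squares is nonnegative ([fpsi_sub]). For large [M]
    the explicit corrector [y + Z / (1 + M)] even has speed [(hmean + amean) / 2]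
    ([steep_sub]). Since convex combinations of close correctors are correctors
    ([interpolate]), those of a geometric grid of slopes are glued into a single
    one that depends smoothly on [M] ([modulated_corrector]).

    The upper bound compares the phase given by the corrector of a small slope
    with an affine function of time ([solution_le_flat]). For the lower bound
    ([solution_ge_plateau]) one fixes a point [x0] where the datum is nearly
    maximal and uses a barrier made of a plateau that rises at a speed slightly
    below [hmean], surrounded by a cone steeper than the datum; the cone recedes,
    that is rises, at a speed between [hmean] and [amean]. Every part of the
    barrier is slower than the corrector for its slope, so that it cannot touch
    the solution from below ([barrier_comparison]), up to errors of order
    [e^alpha]. Once the cone has moved beyond a given compact set, the barrier is
    the plateau there; the theorem follows by letting [e] tend to 0. *)

(** * One-variable calculus *)

Section OneVariable.
Variable R : realType.
Implicit Types (f g F d : R -> R) (x y r l a b e K : R).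

(** Derivatives are computed by composing the rules below; the resulting value
    is put into shape only at the end, through this lemma. *)
Lemma dv_eq f x a b : is_derive x 1 f a -> a = b -> is_derive x 1 f b.
Proof. by move=> + <-. Qed.

Lemma dv_cst (k x : R) : is_derive x 1 (fun=> k) (0 : R).
Proof. exact: is_derive_cst. Qed.

Lemma dv_id x : is_derive x 1 (fun r => r) (1 : R).
Proof. exact: is_derive_id. Qed.

Lemma dvD f g x a b : is_derive x 1 f a -> is_derive x 1 g b ->
  is_derive x 1 (fun r => f r + g r) (a + b).
Proof. by move=> *; apply: is_deriveD. Qed.

Lemma dvN f x a : is_derive x 1 f a -> is_derive x 1 (fun r => - f r) (- a).
Proof. by move=> *; apply: is_deriveN. Qed.

Lemma dvB f g x a b : is_derive x 1 f a -> is_derive x 1 g b ->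
  is_derive x 1 (fun r => f r - g r) (a - b).
Proof. by move=> *; apply: is_deriveB. Qed.

Lemma dvM f g x a b : is_derive x 1 f a -> is_derive x 1 g b ->
  is_derive x 1 (fun r => f r * g r) (a * g x + f x * b).
Proof.
move=> df dg; apply: (@dv_eq (f * g) _ _ _ (is_deriveM df dg)).
by rewrite /GRing.scale /= addrC (mulrC (g x)).
Qed.

Lemma dvZ (k : R) f x a : is_derive x 1 f a ->
  is_derive x 1 (fun r => k * f r) (k * a).
Proof. by move=> df; apply: is_deriveZ. Qed.

Lemma dvV f x a : f x != 0 -> is_derive x 1 f a ->
  is_derive x 1 (fun r => (f r)^-1) (- a / f x ^+ 2).
Proof.
move=> f0 df; apply: (dv_eq (is_deriveV f0 df)).
by rewrite /GRing.scale /= mulNr mulrC mulNr.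
Qed.

Lemma dv_comp f g x a b : is_derive (g x) 1 f a -> is_derive x 1 g b ->
  is_derive x 1 (fun r => f (g r)) (a * b).
Proof. by move=> *; apply: is_derive1_comp. Qed.

Lemma dv_sqr f x a : is_derive x 1 f a ->
  is_derive x 1 (fun r => f r ^+ 2) (2 * f x * a).
Proof.
move=> df; have -> : (fun r => f r ^+ 2) = (fun r => f r * f r) by [].
by apply: (dv_eq (dvM df df)); ring.
Qed.

Lemma dv_sqrt f x a : 0 < f x -> is_derive x 1 f a ->
  is_derive x 1 (fun r => Num.sqrt (f r)) (a / (2 * Num.sqrt (f x))).
Proof.
move=> f0 df; apply: (dv_eq (dv_comp (is_derive1_sqrt f0) df)).
by rewrite mulrC.
Qed.

Lemma dv_continuous f x a : is_derive x 1 f a -> {for x, continuous f}.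
Proof.
by case=> df _; apply/differentiable_continuous/derivable1_diffP.
Qed.

Lemma dv_continuousT f f' : (forall x, is_derive x 1 f (f' x)) ->
  continuous f.
Proof. by move=> df x; apply: dv_continuous (df x). Qed.

Lemma dv_near f g x a e : 0 < e ->
  (forall r, `|r - x| < e -> f r = g r) -> is_derive x 1 f a ->
  is_derive x 1 g a.
Proof.
move=> e0 fg; apply: near_eq_is_derive.
apply/nbhs_ballP; exists e => //= r; rewrite /ball /= distrC; exact: fg.
Qed.

(** Increments to one side of [x] suffice: this is all that a minimum at the final
    time of a slab provides. *)
Lemma dv_le_right f x l K e : 0 < e -> is_derive x 1 f l ->
  (forall r, 0 < r -> r < e -> f (x + r) - f x <= K * r) -> l <= K.
Proof.
move=> e0 /is_derive1_caratheodory[g [fE gc <-]] H.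
rewrite leNgt; apply/negP => Kg.
have [e1 /= e10 He1] := (nbhs_ballP _ _).1 (cvgr_gt (g x) gc _ Kg).
pose r := Num.min e e1 / 2.
have m0 : 0 < Num.min e e1 by rewrite lt_min e0.
have r0 : 0 < r by rewrite /r divr_gt0.
have re : r < Num.min e e1 by rewrite /r; lra.
have := re; rewrite lt_min => /andP[ree ree1].
have := H _ r0 ree; rewrite fE.
have -> : x + r - x = r by ring.
rewrite ler_pM2r // leNgt He1 // /ball /=.
have -> : x - (x + r) = - r by ring.
by rewrite normrN gtr0_norm.
Qed.

Lemma dv_reflect f x l : is_derive x 1 f l ->
  is_derive (- x) 1 (fun r => f (- r)) (- l).
Proof.
move=> df; rewrite -[- l]mulrN1; apply: dv_comp.
by rewrite opprK.
Qed.

Lemma dv_ge_left f x l K e : 0 < e -> is_derive x 1 f l ->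
  (forall r, 0 < r -> r < e -> K * r <= f x - f (x - r)) -> K <= l.
Proof.
move=> e0 /dv_reflect df H; rewrite -lerN2.
apply: (dv_le_right e0 df) => r r0 re.
by rewrite opprD !opprK mulNr -lerN2 opprB opprK; apply: H.
Qed.

Lemma dv_min0 f x l : is_derive x 1 f l -> (forall y, f x <= f y) -> l = 0.
Proof.
move=> df fm; apply/eqP; rewrite eq_le; apply/andP; split.
  rewrite -oppr_ge0; apply: (dv_ge_left ltr01 (dvN df)) => r _ _.
  by rewrite mul0r opprK addrC subr_ge0.
rewrite -oppr_le0; apply: (dv_le_right ltr01 (dvN df)) => r _ _.
by rewrite mul0r opprK addrC subr_le0.
Qed.

Lemma dv_max0 f x l : is_derive x 1 f l -> (forall y, f y <= f x) -> l = 0.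
Proof.
move=> /dvN df fm; apply/eqP; rewrite -oppr_eq0; apply/eqP.
by apply: (dv_min0 df) => y; rewrite lerN2.
Qed.

Lemma dv_ge0_nondecreasing f f' : (forall x, is_derive x 1 f (f' x)) ->
  (forall x, 0 <= f' x) -> forall x y, x <= y -> f x <= f y.
Proof.
move=> df f0 x y xy; rewrite -subr_ge0.
have [|c _ ->] := @MVT_segment R f f' x y xy (fun z _ => df z).
- by apply: continuous_subspaceT; exact: dv_continuousT df.
- by rewrite mulr_ge0 // subr_ge0.
Qed.

(** Otherwise [d] would be negative just after [x], and by the mean value theorem
    [F] would be smaller there. *)
Lemma dv2_min F d x l : (forall r, is_derive r 1 F (d r)) ->
  is_derive x 1 d l -> (forall y, F x <= F y) -> 0 <= l.
Proof.
move=> dF dd Fm; rewrite leNgt; apply/negP => l0.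
have d0 : d x = 0 by apply: dv_min0 (dF x) Fm.
have /is_derive1_caratheodory[g [dE gc gx]] := dd.
have gx0 : g x < 0 by rewrite gx.
have [e /= e0 He] := (nbhs_ballP _ _).1 (cvgr_lt (g x) gc _ gx0).
have xe : x < x + e / 2 by rewrite ltrDl divr_gt0.
have [|c] := @MVT R F d x (x + e / 2) xe (fun z _ => dF z).
- by apply: continuous_subspaceT; exact: dv_continuousT dF.
rewrite in_itv /= => /andP[xc cx].
have -> : x + e / 2 - x = e / 2 by ring.
have /eqP := dE c; rewrite d0 subr0 => /eqP -> E.
have gc0 : g c < 0.
  by apply: He; rewrite /ball /= ltr0_norm; lra.
have := Fm (x + e / 2); rewrite -subr_ge0 E.
rewrite leNgt => /negP; apply.
by rewrite nmulr_rlt0 ?divr_gt0 // nmulr_rlt0 // subr_gt0.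
Qed.

End OneVariable.

(** * Antiderivatives and periodic functions *)

Section Antiderivative.
Variable R : realType.
Implicit Types (f F : R -> R) (x y z a b : R).

Let antiderivative_right f : continuous f ->
  exists F : R -> R, F 0 = 0 /\ forall x, -1 < x -> is_derive x 1 F (f x).
Proof.
move=> fc; pose A x := \int[lebesgue_measure]_(t in `[-1, x]) f t.
exists (fun x => A x - A 0); split; first by rewrite subrr.
move=> x x1.
suff dA : is_derive x 1 A (f x).
  by apply: dv_eq (dvB dA (dv_cst (A 0) x)) _; rewrite subr0.
have xx1 : x < x + 1 by rewrite ltrDl.
have fi : lebesgue_measure.-integrable `[-1, x + 1] (EFin \o f).
  apply: continuous_compact_integrable; first exact: segment_compact.
  exact: continuous_subspaceT.
have [dA A'] := continuous_FTC1_closed xx1 fi x1 (fc x).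
by apply: DeriveDef dA _; rewrite -derive1E.
Qed.

(** The fundamental theorem of calculus integrates from a fixed left end; a
    primitive on the whole line is glued from such an integral and the reflection
    of another one. *)
Lemma antiderivative f : continuous f ->
  exists F : R -> R, F 0 = 0 /\ forall x, is_derive x 1 F (f x).
Proof.
move=> fc; have [A [A0 dA]] := antiderivative_right fc.
have fNc : continuous (fun x => f (- x)).
  by move=> x; apply: continuous_comp; [exact: opp_continuous|exact: fc].
have [C [C0 dC]] := antiderivative_right fNc.
pose B x := - C (- x).
have dB x : x < 1 -> is_derive x 1 B (f x).
  move=> x1; rewrite -[f x]opprK; apply: dvN.
  rewrite -[x]opprK; apply: dv_reflect.
  by apply: dv_eq (dC (- x) _) _; rewrite ?opprK //; lra.
(* the two primitives, from the right and from the left, agree near 0 *)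
have AB x : -1 < x -> x < 1 -> A x = B x.
  move=> x1 x2; pose D y := A y - B y.
  have dD y : -1 < y -> y < 1 -> is_derive y 1 D 0.
    by move=> y1 y2; apply: dv_eq (dvB (dA y y1) (dB y y2)) _; rewrite subrr.
  have D0 : D 0 = 0 by rewrite /D /B A0 oppr0 C0 oppr0 subrr.
  suff : D x = 0 by move/eqP; rewrite subr_eq0 => /eqP.
  have H a b : -1 < a -> b < 1 -> a <= b -> D b = D a.
    move=> a1 b1 ab; apply/eqP; rewrite -subr_eq0; apply/eqP.
    have [||c _ ->] := @MVT_segment R D (fun=> 0) a b ab; last by rewrite mul0r.
      move=> y; rewrite in_itv /= => /andP[ay yb]; apply: dD; lra.
    apply: continuous_in_subspaceT => y.
    rewrite inE /= in_itv /= => /andP[ay yb].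
    by apply: (@dv_continuous _ _ _ 0); apply: dD; lra.
  have [x0|x0] := leP 0 x; first by rewrite (H 0 x) //; lra.
  by rewrite -(H x 0) //; lra.
exists (fun x => if 0 <= x then A x else B x); split; first by rewrite lexx.
move=> x; have [x1|x1] := ltP (-1) x.
  have [x2|x2] := ltP x 1.
    have m0 : 0 < Num.min (x + 1) (1 - x) by rewrite lt_min; lra.
    apply: dv_near m0 _ (dA x x1) => r.
    rewrite lt_min !ltr_norml => /andP[/andP[r1 r2] /andP[r3 r4]].
    by case: ifP => // _; apply: AB; lra.
  apply: dv_near ltr01 _ (dA x x1) => r.
  by rewrite ltr_norml => /andP[r1 r2]; rewrite ifT //; lra.
have x2 : x < 1 by lra.
apply: dv_near ltr01 _ (dB x x2) => r.
by rewrite ltr_norml => /andP[r1 r2]; rewrite ifF //; apply/negbTE; rewrite -ltNge; lra.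
Qed.

Lemma antiderivative_integral f F (a b : R) : continuous f ->
  (forall x, is_derive x 1 F (f x)) -> a < b ->
  \int[lebesgue_measure]_(t in `[a, b]) f t = F b - F a.
Proof.
move=> fc dF ab; rewrite /Rintegral (@continuous_FTC2 R f F a b) //.
- exact: continuous_subspaceT.
- have Fc := dv_continuousT dF; split.
  + by move=> x _; case: (dF x).
  + exact: cvg_at_right_filter (Fc a).
  + exact: cvg_at_left_filter (Fc b).
- by move=> x _; rewrite derive1E; case: (dF x).
Qed.

End Antiderivative.

Section Periodic.
Variable R : realType.
Implicit Types (f F : R -> R) (x y z : R).

Definition periodic1 f := forall y, f (y + 1) = f y.

Lemma periodic1_int f : periodic1 f -> forall y (m : int), f (y + m%:~R) = f y.
Proof.
move=> fp; have Hn y (n : nat) : f (y + n%:R) = f y.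
  elim: n => [|n IH]; first by rewrite addr0.
  by rewrite -natr1 addrA fp.
move=> y [n|n]; first exact: Hn.
by rewrite NegzE mulrNz -[in RHS](subrK n.+1%:R y) Hn.
Qed.

Lemma periodic1_reduce f : periodic1 f ->
  forall y, exists2 z, 0 <= z <= 1 & f y = f z.
Proof.
move=> fp y; exists (y - (Num.floor y)%:~R).
  have := floor_le_tmp y; have := floorD1_gt y.
  by rewrite intrD => h1 h2; apply/andP; split; lra.
by rewrite -{1}(subrK (Num.floor y)%:~R y) periodic1_int.
Qed.

Lemma periodic1_max f : continuous f -> periodic1 f ->
  exists c, forall y, f y <= f c.
Proof.
move=> fc fp.
have [c _ Hc] := EVT_max (@ler01 R) (continuous_subspaceT fc).
exists c => y; have [z z01 ->] := periodic1_reduce fp y.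
by apply: Hc; rewrite in_itv.
Qed.

Lemma periodic1_min f : continuous f -> periodic1 f ->
  exists c, forall y, f c <= f y.
Proof.
move=> fc fp.
have [c _ Hc] := EVT_min (@ler01 R) (continuous_subspaceT fc).
exists c => y; have [z z01 ->] := periodic1_reduce fp y.
by apply: Hc; rewrite in_itv.
Qed.

(** The increment of [F] over a period has derivative 0. *)
Lemma antiderivative_shift f F : periodic1 f ->
  (forall x, is_derive x 1 F (f x)) -> F 0 = 0 ->
  forall y, F (y + 1) = F y + F 1.
Proof.
move=> fp dF F0 y.
pose D z := F (z + 1) - F z.
have dD z : is_derive z 1 D 0.
  have d1 := dv_comp (g := fun z => z + 1) (dF (z + 1)) (dvD (dv_id z) (dv_cst 1 z)).
  by apply: dv_eq (dvB d1 (dF z)) _; rewrite addr0 mulr1 fp subrr.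
have := is_derive_0_is_cst y 0 dD; rewrite /D F0 add0r subr0 => <-.
by rewrite addrCA subrr addr0.
Qed.

End Periodic.

(** * A smooth step *)

Section SmoothStep.
Variable R : realType.
Implicit Types (f h P : R -> R) (x r s a : R).

Lemma dv_glue f h x a : f x = h x ->
  is_derive x 1 f a -> is_derive x 1 h a ->
  is_derive x 1 (fun r => if r <= x then f r else h r) a.
Proof.
move=> fh /is_derive1_caratheodory[k [fE kc kx]].
move=> /is_derive1_caratheodory[l [hE lc lx]].
apply/is_derive1_caratheodory.
exists (fun r => if r <= x then k r else l r); split.
- by move=> z; rewrite lexx; case: ifP => _; rewrite ?fE // fh hE.
- apply/cvgrPdist_lt => e e0; rewrite lexx.
  have kn := (@cvgrPdist_lt _ _ _ _ _ _ _).1 kc e e0.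
  have ln := (@cvgrPdist_lt _ _ _ _ _ _ _).1 lc e e0.
  near=> z; case: ifP => _; first by near: z; exact: kn.
  by rewrite kx -lx; near: z; exact: ln.
- by rewrite lexx.
Unshelve. all: by end_near. Qed.

Definition clamp01 P r := if r <= 0 then P 0 else if r <= 1 then P r else P 1.

Lemma dv_clamp01 P P' r : (forall r, is_derive r 1 P (P' r)) ->
  P' 0 = 0 -> P' 1 = 0 -> is_derive r 1 (clamp01 P) (clamp01 P' r).
Proof.
move=> dP P0 P1.
have dI (s : R) : is_derive s 1 (fun r => if r <= 1 then P r else P 1)
                          (if s <= 1 then P' s else 0).
  case: (ltgtP s 1) => [s1|s1|->].
  - apply: (@dv_near _ _ _ _ _ (1 - s) _ _ (dP s)); first lra.
    by move=> z; rewrite ltr_norml => /andP[_ z1]; rewrite ifT //; lra.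
  - apply: (@dv_near _ _ _ _ _ (s - 1) _ _ (dv_cst (P 1) s)); first lra.
    by move=> z; rewrite ltr_norml => /andP[z1 _]; rewrite ifF //; apply/negbTE; rewrite -ltNge; lra.
  - rewrite P1.
    exact: (@dv_glue P (fun=> P 1) 1 0 erefl (dv_eq (dP 1) P1) (dv_cst _ _)).
rewrite /clamp01; case: (ltgtP r 0) => [r0|r0|->].
- rewrite P0; apply: (@dv_near _ _ _ _ _ (- r) _ _ (dv_cst (P 0) r)); first lra.
  by move=> z; rewrite ltr_norml => /andP[_ z1]; rewrite ifT //; lra.
- rewrite P1; apply: dv_near r0 _ (dI r).
  by move=> z; rewrite ltr_norml => /andP[z1 _]; rewrite [RHS]ifF //; apply/negbTE; rewrite -ltNge; lra.
- rewrite P0; apply: (@dv_glue (fun=> P 0) _ 0 0 _ (dv_cst _ _)).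
    by rewrite ler01.
  by apply: dv_eq (dI 0) _; rewrite ler01 P0.
Qed.

(** A twice differentiable transition from 0 to 1: the quintic whose first two
    derivatives vanish at both ends, extended by constants. *)
Lemma smooth_step : exists (X X1 X2 : R -> R),
  [/\ (forall r, is_derive r 1 X (X1 r)) /\ (forall r, is_derive r 1 X1 (X2 r)),
      (forall r, r <= 0 -> X r = 0), (forall r, 1 <= r -> [/\ X r = 1, X1 r = 0 & X2 r = 0]),
      (forall r, 0 <= X r <= 1) &
      (forall r, `|X1 r| <= 30) /\ (forall r, `|X2 r| <= 60)].
Proof.
pose p r : R := r * r * r * (10 - 15 * r + 6 * (r * r)).
pose p1 r : R := 30 * (r * r * ((1 - r) * (1 - r))).
pose p2 r : R := 60 * (r * (1 - r) * (1 - 2 * r)).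
have dp r : is_derive r 1 p (p1 r).
  have d1 := dv_id r; have d2 := dvM d1 d1; have d3 := dvM d2 d1.
  have d := dvM d3 (dvD (dvB (dv_cst 10 r) (dvZ 15 d1)) (dvZ 6 d2)).
  by apply: dv_eq d _; rewrite /p1; ring.
have dp1 r : is_derive r 1 p1 (p2 r).
  have d1 := dv_id r; have d2 := dvM d1 d1; have d3 := dvB (dv_cst 1 r) d1.
  have d := dvZ 30 (dvM d2 (dvM d3 d3)).
  by apply: dv_eq d _; rewrite /p2; ring.
exists (clamp01 p), (clamp01 p1), (clamp01 p2); split.
- split=> r; apply: dv_clamp01 => //; rewrite /p1 /p2; ring.
- by move=> r r0; rewrite /clamp01 r0 /p; ring.
- move=> r r1; have E Q : clamp01 Q r = Q 1.
    rewrite /clamp01 ifF; last by apply/negbTE; rewrite -ltNge; lra.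
    by case: ifP => // r1'; congr Q; lra.
  by rewrite !E /p /p1 /p2; split; ring.
- move=> r; rewrite /clamp01 /p; case: (leP r 0) => r0; first by apply/andP; split; lra.
  case: (leP r 1) => r1; last by apply/andP; split; lra.
  have r3 : 0 <= r * r * r by rewrite !mulr_ge0 // ltW.
  apply/andP; split; first by rewrite mulr_ge0 //; nra.
  have -> : r * r * r * (10 - 15 * r + 6 * (r * r)) =
    1 - (1 - r) * (1 - r) * (1 - r) * (1 + 3 * r + 6 * (r * r)) by ring.
  rewrite lerBlDr lerDl mulr_ge0 //; last by nra.
  by rewrite !mulr_ge0 //; lra.
- split=> r; rewrite /clamp01 /p1 /p2.
  + case: (leP r 0) => r0; first by rewrite !mul0r mulr0 normr0.
    case: (leP r 1) => r1; last by rewrite subrr !mulr0 normr0.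
    rewrite ger0_norm; last by rewrite !mulr_ge0 //; lra.
    rewrite -[leRHS]mulr1 ler_pM2l // -[leRHS]mulr1 ler_pM ?mulr_ge0 //; nra.
  + case: (leP r 0) => r0; first by rewrite !mul0r mulr0 normr0.
    case: (leP r 1) => r1; last by rewrite subrr mulr0 mul0r mulr0 normr0.
    rewrite normrM normrM ger0_norm // -[leRHS]mulr1 ler_pM2l //.
    rewrite -[leRHS]mulr1 ler_pM // ler_norml; nra.
Qed.

End SmoothStep.

(** * The rate and its two means *)

(** The bounds are part of the data: all constants of the correctors are
    expressed in them. *)
Record reaction (R : realType) := Reaction {
  rate :> R -> R;
  rate_lip : R;
  rate_min : R;
  rate_max : R;
  rate_lip_ge0 : 0 <= rate_lip;
  rate_lipP : forall y z, `|rate y - rate z| <= rate_lip * `|y - z|;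
  rate_periodic : periodic1 rate;
  rate_min_gt0 : 0 < rate_min;
  rate_minP : forall y, rate_min <= rate y;
  rate_maxP : forall y, rate y <= rate_max }.

Section Means.
Variables (R : realType) (g : reaction R).
Implicit Types (x y z : R).

Lemma rate_gt0 y : 0 < g y.
Proof. exact: lt_le_trans (rate_min_gt0 g) (rate_minP g y). Qed.

Lemma rate_neq0 y : g y != 0.
Proof. by rewrite gt_eqF // rate_gt0. Qed.

Lemma rate_max_gt0 : 0 < rate_max g.
Proof. exact: lt_le_trans (rate_gt0 0) (rate_maxP g 0). Qed.

Lemma lipschitz_continuous (f : R -> R) L :
  (forall y z, `|f y - f z| <= L * `|y - z|) -> continuous f.
Proof.
move=> fL x; apply/cvgrPdist_lt => e e0.
have L1 : 0 < `|L| + 1 by rewrite ltr_pwDr.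
apply/nbhs_ballP; exists (e / (`|L| + 1)); first by rewrite /= divr_gt0.
move=> z /=; rewrite ltr_pdivlMr // => H.
apply: le_lt_trans (fL x z) _; apply: le_lt_trans H.
rewrite mulrC ler_wpM2l // (le_trans (ler_norm L)) // lerDl.
by [].
Qed.

Lemma rate_continuous : continuous g.
Proof. exact: lipschitz_continuous (@rate_lipP _ g). Qed.

Lemma rateV_continuous : continuous (fun y => (g y)^-1).
Proof. by move=> y; apply: cvgV; [exact: rate_neq0|exact: rate_continuous]. Qed.

(** Time that the flow [y' = g y] takes from 0 to [y]. *)
Definition travel : R -> R := sval (cid (antiderivative rateV_continuous)).

Lemma travel0 : travel 0 = 0.
Proof. by rewrite /travel; case: cid => F []. Qed.

Lemma dv_travel y : is_derive y 1 travel (g y)^-1.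
Proof. by rewrite /travel; case: cid => F []. Qed.

(** Integrals over a period are compared in this form, which only involves
    derivatives. *)
Lemma primitive_le (F f G h : R -> R) : (forall y, is_derive y 1 F (f y)) ->
  (forall y, is_derive y 1 G (h y)) -> (forall y, f y <= h y) ->
  F 1 - F 0 <= G 1 - G 0.
Proof.
move=> dF dG fh.
have H := @dv_ge0_nondecreasing R (fun y => G y - F y) (fun y => h y - f y)
  (fun y => dvB (dG y) (dF y)).
have : G 0 - F 0 <= G 1 - F 1.
  by apply: (H _ 0 1 ler01) => y; rewrite subr_ge0.
by lra.
Qed.

Lemma travel1_gt0 : 0 < travel 1.
Proof.
have H := @primitive_le (fun y => (rate_max g)^-1 * y) _ travel _
  (fun y => dvZ (rate_max g)^-1 (dv_id y)) dv_travel.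
have : (rate_max g)^-1 * 1 - (rate_max g)^-1 * 0 <= travel 1 - travel 0.
  by apply: H => y; rewrite mulr1 lef_pV2 ?posrE ?rate_gt0 ?rate_max_gt0 // rate_maxP.
rewrite travel0 subr0 mulr1 mulr0 subr0; apply: lt_le_trans.
by rewrite invr_gt0 rate_max_gt0.
Qed.

(** Harmonic mean of the rate: a flat state follows the flow [y' = g y], which
    advances by one period in time [travel 1]. *)
Definition hmean := (travel 1)^-1.

Lemma hmean_gt0 : 0 < hmean.
Proof. by rewrite invr_gt0 travel1_gt0. Qed.

Lemma hmean_integral :
  (\int[lebesgue_measure]_(s in `[0, 1]) (g s)^-1)^-1 = hmean.
Proof.
by rewrite (antiderivative_integral rateV_continuous dv_travel ltr01) travel0 subr0.
Qed.

Definition rate_primitive : R -> R := sval (cid (antiderivative rate_continuous)).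

Lemma rate_primitive0 : rate_primitive 0 = 0.
Proof. by rewrite /rate_primitive; case: cid => F []. Qed.

Lemma dv_rate_primitive y : is_derive y 1 rate_primitive (g y).
Proof. by rewrite /rate_primitive; case: cid => F []. Qed.

(** Arithmetic mean of the rate: across a steep profile diffusion averages the
    rate over the values of a period. *)
Definition amean := rate_primitive 1.

(** The gap between the two means is [\int (g - hmean)^2 / g]. *)
Lemma hmean_lt_amean : (exists y z, g y <> g z) -> hmean < amean.
Proof.
move=> [y [z gyz]].
pose F x := rate_primitive x - 2 * hmean * x + hmean ^+ 2 * travel x.
have dF (x : R) : is_derive x 1 F ((g x - hmean) ^+ 2 / g x).
  have := dvD (dvB (dv_rate_primitive x) (dvZ (2 * hmean) (dv_id x)))
              (dvZ (hmean ^+ 2) (dv_travel x)).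
  by move/dv_eq; apply; field; exact: rate_neq0.
have F1 : F 1 = amean - hmean.
  rewrite /F -/amean /hmean; field.
  by rewrite gt_eqF // travel1_gt0.
have F0 : F 0 = 0 by rewrite /F rate_primitive0 travel0; ring.
have dF0 x : 0 <= (g x - hmean) ^+ 2 / g x.
  by rewrite divr_ge0 ?sqr_ge0 // ltW // rate_gt0.
have Fm := dv_ge0_nondecreasing dF dF0.
rewrite -subr_gt0 -F1 lt_neqAle -{2}F0 Fm ?ler01 // andbT.
apply/negP => /eqP E; apply: gyz.
(* otherwise F is constant on [0,1], so that g = hmean there *)
have H x : 0 < x < 1 -> g x = hmean.
  move=> /andP[x0 x1].
  have m0 : 0 < Num.min x (1 - x) by rewrite lt_min; lra.
  have FE r : 0 <= r -> r <= 1 -> F r = 0.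
    move=> r0 r1; apply/eqP; rewrite eq_le; apply/andP; split.
      by rewrite E Fm.
    by rewrite -[leLHS]F0 Fm.
  have d0 : is_derive x 1 F 0.
    apply: dv_near m0 _ (dv_cst 0 x) => r.
    rewrite lt_min !ltr_norml => /andP[/andP[r1 r2] /andP[r3 r4]].
    by rewrite FE //; lra.
  have := dF x; case=> _ e1; case: d0 => _; rewrite e1 => /eqP.
  rewrite mulf_eq0 invr_eq0 (negbTE (rate_neq0 x)) orbF sqrf_eq0 subr_eq0.
  by move/eqP.
have H01 x : 0 <= x <= 1 -> g x = hmean.
  move=> /andP[x0 x1]; apply/eqP; rewrite -subr_eq0 -normr_le0.
  apply/ler_addgt0Pr => e e0; rewrite add0r.
  pose L := rate_lip g + 1.
  have L0 : 0 < L by have := rate_lip_ge0 g; rewrite /L; lra.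
  pose d := Num.min (e / L) (4^-1).
  have d0 : 0 < d by rewrite lt_min divr_gt0 //= invr_gt0 ltr0n.
  have [d1 d2] : d <= e / L /\ d <= 4^-1.
    by split; rewrite ge_min lexx ?orbT.
  have [w w01 wx] : exists2 w, 0 < w < 1 & `|x - w| <= d.
    have [x2|x2] := leP x (2^-1).
      exists (x + d); first by apply/andP; split; lra.
      by rewrite opprD addNKr normrN gtr0_norm.
    exists (x - d); first by apply/andP; split; lra.
    by rewrite opprB addrC subrK gtr0_norm.
  rewrite -(H w w01); apply: le_trans (rate_lipP g x w) _.
  apply: (@le_trans _ _ (L * (e / L))).
    apply: ler_pM => //; [exact: rate_lip_ge0|by rewrite lerDl|].
    exact: le_trans wx d1.
  by rewrite mulrCA divff ?mulr1 // gt_eqF.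
have [y' y01 ->] := periodic1_reduce (@rate_periodic _ g) y.
have [z' z01 ->] := periodic1_reduce (@rate_periodic _ g) z.
by rewrite !H01.
Qed.

End Means.

(** * An averaged squared rate *)

Section Resolvent.
Variables (R : realType) (g : reaction R).
Implicit Types (m x y z : R) (h k : R -> R).

(** [h] is [g ^+ 2] averaged over an exponentially distributed time, of mean
    [m], along the flow [y' = g y]: it solves [h - m g h' = g ^+ 2]. *)
Definition is_resolvent m h := periodic1 h /\
  forall y, is_derive y 1 h ((h y - g y ^+ 2) / (m * g y)).

(** Variation of constants, with the free constant fixed by periodicity. *)
Lemma resolvent_exists m : 0 < m -> exists h, is_resolvent m h.
Proof.
move=> m0; have mN : m != 0 by rewrite gt_eqF.
pose G y := travel g y / m.
have dG y : is_derive y 1 G ((g y)^-1 / m).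
  have := dvZ m^-1 (dv_travel g y).
  by rewrite mulrC; have -> : (fun r => m^-1 * travel g r) = G by apply/funext => r; rewrite mulrC.
have dE y : is_derive y 1 (fun r => expR (G r)) (expR (G y) * ((g y)^-1 / m)).
  exact: dv_comp (is_derive_expR _) (dG y).
have dEN y : is_derive y 1 (fun r => expR (- G r)) (expR (- G y) * - ((g y)^-1 / m)).
  exact: (dv_comp (g := fun r => - G r) (is_derive_expR _) (dvN (dG y))).
have EN y : expR (- G y) = (expR (G y))^-1 by rewrite expRN.
have E0 y : expR (G y) != 0 by rewrite gt_eqF // expR_gt0.
have kc : continuous (fun y => g y * (expR (- G y) / m)).
  move=> y; apply: cvgM; first exact: rate_continuous.
  by apply: cvgMl; apply: dv_continuous (dEN y).
have [J [J0 dJ]] := antiderivative kc.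
have G1 : 1 < expR (G 1) by rewrite expR_gt1 divr_gt0 // travel1_gt0.
have G1N : expR (G 1) - 1 != 0 by rewrite gt_eqF // subr_gt0.
pose C := expR (G 1) * J 1 / (expR (G 1) - 1).
pose h y := expR (G y) * (C - J y).
have dh y : is_derive y 1 h ((h y - g y ^+ 2) / (m * g y)).
  apply: dv_eq (dvM (dE y) (dvB (dv_cst C y) (dJ y))) _.
  rewrite /h EN; field.
  by rewrite mN rate_neq0 E0.
exists h; split => // y.
pose D z := (h (z + 1) - h z) * expR (- G z).
have dD z : is_derive z 1 D 0.
  have d1 := dv_comp (g := fun z => z + 1) (dh (z + 1)) (dvD (dv_id z) (dv_cst 1 z)).
  apply: dv_eq (dvM (dvB d1 (dh z)) (dEN z)) _.
  rewrite rate_periodic; field.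
  by rewrite mN rate_neq0.
have D0 : D 0 = 0.
  rewrite /D /h add0r J0 /G travel0 mul0r oppr0 expR0 -/(G 1) /C.
  by field.
have := is_derive_0_is_cst y 0 dD; rewrite D0 /D => /eqP.
by rewrite mulf_eq0 (gt_eqF (expR_gt0 _)) orbF subr_eq0 => /eqP.
Qed.

Lemma resolvent_continuous m h : is_resolvent m h -> continuous h.
Proof. by case=> _ dh; exact: dv_continuousT dh. Qed.

Let crit (a b : R) : 0 < b -> a / b = 0 -> a = 0.
Proof.
by move=> b0 /eqP; rewrite mulf_eq0 invr_eq0 (gt_eqF b0) orbF => /eqP.
Qed.

Let mg_gt0 m y : 0 < m -> 0 < m * g y.
Proof. by move=> m0; rewrite mulr_gt0 // rate_gt0. Qed.

(** Maximum principle: at an extremum of [h] one has [h = g ^+ 2]. *)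
Lemma resolvent_bounds m h : 0 < m -> is_resolvent m h ->
  forall y, rate_min g ^+ 2 <= h y <= rate_max g ^+ 2.
Proof.
move=> m0 rh y; have hc := resolvent_continuous rh; case: rh => hp dh.
have [c Hc] := periodic1_max hc hp; have [d Hd] := periodic1_min hc hp.
have /(crit (mg_gt0 c m0)) Ec := dv_max0 (dh c) Hc.
have /(crit (mg_gt0 d m0)) Ed := dv_min0 (dh d) Hd.
have g0 := rate_min_gt0 g; have g1 := rate_max_gt0 g.
apply/andP; split.
  apply: le_trans (Hd y); rewrite -subr_ge0.
  have -> : h d = g d ^+ 2 by lra.
  by rewrite subr_ge0 lerXn2r ?nnegrE ?rate_minP // ltW // rate_gt0.
apply: (le_trans (Hc y)).
have -> : h c = g c ^+ 2 by lra.
by rewrite lerXn2r ?nnegrE ?rate_maxP // ltW // rate_gt0.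
Qed.

Lemma resolvent_dist m h : 0 < m -> is_resolvent m h ->
  forall y, `|h y - g y ^+ 2| <= rate_max g ^+ 2.
Proof.
move=> m0 rh y; have /andP[h1 h2] := resolvent_bounds m0 rh y.
have : g y ^+ 2 <= rate_max g ^+ 2.
  by rewrite lerXn2r ?nnegrE ?rate_maxP // ltW // ?rate_gt0 // rate_max_gt0.
have := sqr_ge0 (g y); have := sqr_ge0 (rate_min g).
by rewrite ler_norml; lra.
Qed.

(** At an extremum of [h - h'] the two derivatives agree, which makes
    [h - g ^+ 2] and [h' - g ^+ 2] proportional to [m] and [m']. *)
Lemma resolvent_close m m' h h' : 0 < m -> 0 < m' ->
  is_resolvent m h -> is_resolvent m' h' ->
  forall y, `|h y - h' y| <= rate_max g ^+ 2 * `|1 - m' / m|.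
Proof.
move=> m0 m'0 rh rh' y.
have H c : (h c - g c ^+ 2) / (m * g c) - (h' c - g c ^+ 2) / (m' * g c) = 0 ->
    `|h c - h' c| <= rate_max g ^+ 2 * `|1 - m' / m|.
  move=> E; have -> : h c - h' c = (h c - g c ^+ 2) * (1 - m' / m).
    have := rate_neq0 g c; have mN : m != 0 by rewrite gt_eqF.
    have m'N : m' != 0 by rewrite gt_eqF.
    move=> gN.
    have E2 : (h c - g c ^+ 2) / m * m' = h' c - g c ^+ 2.
      have : ((h c - g c ^+ 2) / (m * g c) - (h' c - g c ^+ 2) / (m' * g c)) * (g c * m') = 0.
        by rewrite E mul0r.
      have -> : ((h c - g c ^+ 2) / (m * g c) - (h' c - g c ^+ 2) / (m' * g c)) * (g c * m')
        = (h c - g c ^+ 2) / m * m' - (h' c - g c ^+ 2).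
        by field; rewrite mN m'N gN.
      lra.
    have -> : h c - h' c = (h c - g c ^+ 2) - (h' c - g c ^+ 2) by ring.
    by rewrite -E2; ring.
  by rewrite normrM ler_wpM2r // (resolvent_dist m0 rh).
have dc : continuous (fun y => h y - h' y).
  move=> z; apply: cvgB; [exact: resolvent_continuous rh z|exact: resolvent_continuous rh' z].
have [hp dh] := rh; have [hp' dh'] := rh'.
have dp : periodic1 (fun y => h y - h' y) by move=> z; rewrite hp hp'.
have [c Hc] := periodic1_max dc dp; have [d Hd] := periodic1_min dc dp.
have /H := dv_max0 (dvB (dh c) (dh' c)) Hc.
have /H := dv_min0 (dvB (dh d) (dh' d)) Hd.
rewrite !ler_norml => /andP[a1 _] /andP[_ a2].
have /= := Hd y; have /= := Hc y.
by move=> b1 b2; apply/andP; split; lra.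
Qed.

Let Lam := 2 * rate_max g * rate_lip g.

Let sqr_rate_lip y z : `|g y ^+ 2 - g z ^+ 2| <= Lam * `|y - z|.
Proof.
have -> : g y ^+ 2 - g z ^+ 2 = (g y + g z) * (g y - g z) by ring.
have g1 := rate_max_gt0 g.
have gy := rate_gt0 g y; have gz := rate_gt0 g z.
rewrite normrM /Lam -mulrA ler_pM ?rate_lipP //.
rewrite ger0_norm; last by lra.
by have := rate_maxP g y; have := rate_maxP g z; lra.
Qed.

(** At a maximum of [h - g ^+ 2] the slope of [h], which is proportional to
    [h - g ^+ 2], is at most the Lipschitz constant of [g ^+ 2]. *)
Lemma resolvent_small m h : 0 < m -> is_resolvent m h ->
  forall y, `|h y - g y ^+ 2| <= 2 * rate_max g * rate_lip g * rate_max g * m.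
Proof.
move=> m0 rh y; have hc := resolvent_continuous rh; have [hp dh] := rh.
have gc2 : continuous (fun y => g y ^+ 2).
  exact: (lipschitz_continuous sqr_rate_lip).
have dc : continuous (fun y => h y - g y ^+ 2) by move=> z; apply: cvgB; [exact: hc|exact: gc2].
have dp : periodic1 (fun y => h y - g y ^+ 2) by move=> z; rewrite hp rate_periodic.
have [c Hc] := periodic1_max dc dp; have [d Hd] := periodic1_min dc dp.
have g1 := rate_max_gt0 g; have L0 := rate_lip_ge0 g.
have La0 : 0 <= Lam by rewrite /Lam; nra.
have mul_le (a z : R) : a / (m * g z) <= Lam -> a <= Lam * rate_max g * m.
  rewrite ler_pdivrMr ?mg_gt0 // => /le_trans; apply.
  rewrite -mulrA ler_wpM2l // mulrC ler_wpM2r ?rate_maxP //; exact: ltW.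
have Uc : h c - g c ^+ 2 <= Lam * rate_max g * m.
  apply: (mul_le _ c); apply: (dv_le_right ltr01 (dh c)) => r r0 _.
  have := Hc (c + r) => /= H1; have := sqr_rate_lip (c + r) c.
  have -> : c + r - c = r by ring.
  rewrite (gtr0_norm r0) ler_norml => /andP[_ H2]; lra.
have Ud : - (h d - g d ^+ 2) <= Lam * rate_max g * m.
  apply: (mul_le _ d); rewrite mulNr.
  have dN := dvN (dh d).
  apply: (dv_le_right ltr01 dN) => r r0 _.
  have := Hd (d + r) => /= H1; have := sqr_rate_lip (d + r) d.
  have -> : d + r - d = r by ring.
  rewrite (gtr0_norm r0) ler_norml => /andP[H2 _]; lra.
have /= := Hc y; have /= := Hd y; rewrite -/Lam => H1 H2.
by rewrite ler_norml; apply/andP; split; lra.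
Qed.

End Resolvent.

(** * Correctors for one slope *)

Section Frozen.
Variables (R : realType) (g : reaction R).
Implicit Types (m M x y z e : R).

(** Phases are [fA] up to a factor: the corrector of squared slope [m] has a
    derivative proportional to [1 / sqrt h], where [h] averages [g ^+ 2] over a
    time of mean [m / hmean g ^+ 2]. *)
Record frozen m := Frozen {
  fh : R -> R;
  fA : R -> R;
  frozen_resolvent : is_resolvent g (m * travel g 1 ^+ 2) fh;
  frozen_A0 : fA 0 = 0;
  dv_frozen_A : forall y, is_derive y 1 fA (Num.sqrt (fh y))^-1 }.

Let T := travel g 1.
Let g0 := rate_min g.
Let g1 := rate_max g.
Let c0 := hmean g.

Let T0 : 0 < T. Proof. exact: travel1_gt0. Qed.
Let g0P : 0 < g0. Proof. exact: rate_min_gt0. Qed.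
Let g1P : 0 < g1. Proof. exact: rate_max_gt0. Qed.
Let mT0 m : 0 < m -> 0 < m * T ^+ 2.
Proof. by move=> m0; rewrite mulr_gt0 // exprn_gt0. Qed.

Lemma frozen_inhabited m : 0 < m -> exists w : frozen m, True.
Proof.
move=> m0; have [h rh] := resolvent_exists g (mT0 m0).
have h0 y : 0 < h y.
  have /andP[+ _] := resolvent_bounds (mT0 m0) rh y.
  by apply: lt_le_trans; rewrite exprn_gt0.
have hc : continuous (fun y => (Num.sqrt (h y))^-1).
  move=> y; apply: cvgV; first by rewrite gt_eqF // sqrtr_gt0.
  apply: continuous_comp; [exact: resolvent_continuous rh y|exact: sqrt_continuous].
have [A [A0 dA]] := antiderivative hc.
by exists (Frozen rh A0 dA).
Qed.

Section Fixed.
Variables (m : R) (m0 : 0 < m) (w : frozen m).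

Let h := fh w.
Definition fa y := Num.sqrt (fh w y).
Definition fmu := (fA w 1)^-1.

(** The corrector [fPsi] maps the value [y] of a profile to its phase. It is
    normalised to advance by 1 over each period; [m] is the squared slope for
    which it is designed. *)
Definition fPsi y := fmu * fA w y.
Definition fpsi y := fmu * (fa y)^-1.
Definition fdpsi y :=
  - (fmu * (fh w y - g y ^+ 2)) / (2 * (fa y) ^+ 3 * (m * T ^+ 2 * g y)).

Let hb y : g0 ^+ 2 <= h y <= g1 ^+ 2.
Proof. exact: resolvent_bounds (mT0 m0) (frozen_resolvent w) y. Qed.

Let h0 y : 0 < h y.
Proof. by have /andP[+ _] := hb y; apply: lt_le_trans; rewrite exprn_gt0. Qed.

Lemma fa_bounds y : g0 <= fa y <= g1.
Proof.
have /andP[h1 h2] := hb y; rewrite /fa; apply/andP; split.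
  by rewrite -[leLHS](gtr0_norm g0P) -sqrtr_sqr ler_wsqrtr.
by rewrite -[leRHS](gtr0_norm g1P) -sqrtr_sqr ler_wsqrtr.
Qed.

Lemma fa_gt0 y : 0 < fa y.
Proof. by have /andP[+ _] := fa_bounds y; apply: lt_le_trans. Qed.

Lemma fa_sqr y : fa y ^+ 2 = h y.
Proof. by rewrite /fa sqr_sqrtr // ltW // h0. Qed.

Lemma fA1_bounds : g1^-1 <= fA w 1 <= g0^-1.
Proof.
have bnd y : g1^-1 <= (fa y)^-1 <= g0^-1.
  by have /andP[a1 a2] := fa_bounds y; rewrite !lef_pV2 ?posrE ?fa_gt0 // a1 a2.
have H1 : g1^-1 * 1 - g1^-1 * 0 <= fA w 1 - fA w 0.
  apply: (primitive_le (fun y => dvZ g1^-1 (dv_id y)) (dv_frozen_A w)) => y.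
  by rewrite mulr1; case/andP: (bnd y).
have H2 : fA w 1 - fA w 0 <= g0^-1 * 1 - g0^-1 * 0.
  apply: (primitive_le (dv_frozen_A w) (fun y => dvZ g0^-1 (dv_id y))) => y.
  by rewrite mulr1; case/andP: (bnd y).
by move: H1 H2; rewrite frozen_A0 !mulr1 !mulr0 !subr0 => -> ->.
Qed.

(** The harmonic speed is the smallest one: [1 / fa <= 1 / g - (m T^2 / 2)
    (ln fh)'] by the inequality of arithmetic and geometric means, and the
    logarithmic derivative integrates to 0 over a period. *)
Lemma fA1_le_travel : fA w 1 <= T.
Proof.
pose mh := m * T ^+ 2.
have dl y : is_derive y 1 (fun r => travel g r - mh / 2 * ln (h r))
   ((g y)^-1 - mh / 2 * ((h y)^-1 * ((h y - g y ^+ 2) / (mh * g y)))).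
  have d1 := (frozen_resolvent w).2 y.
  have d2 := dv_comp (is_derive1_ln (h0 y)) d1.
  exact: dvB (dv_travel g y) (dvZ (mh / 2) d2).
suff : fA w 1 - fA w 0 <=
    travel g 1 - mh / 2 * ln (h 1) - (travel g 0 - mh / 2 * ln (h 0)).
  have -> : h 1 = h 0 by have := (frozen_resolvent w).1 0; rewrite add0r.
  by rewrite frozen_A0 travel0 -/T; lra.
apply: (primitive_le (dv_frozen_A w) dl) => y; rewrite -/(fa y) -/h -fa_sqr.
have a0 := fa_gt0 y; have gy := rate_gt0 g y.
have mh0 : 0 < mh := mT0 m0.
rewrite -subr_ge0.
have -> : (g y)^-1 - mh / 2 * ((fa y ^+ 2)^-1 * ((fa y ^+ 2 - g y ^+ 2) / (mh * g y))) - (fa y)^-1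
  = (fa y - g y) ^+ 2 / (2 * g y * fa y ^+ 2).
  by field; rewrite !gt_eqF.
by rewrite divr_ge0 ?sqr_ge0 // mulr_ge0 ?sqr_ge0 // mulr_ge0 // ltW.
Qed.

Let A10 : 0 < fA w 1.
Proof. by have /andP[+ _] := fA1_bounds; apply: lt_le_trans; rewrite invr_gt0. Qed.

Lemma fmu_bounds : [/\ c0 <= fmu, g0 <= fmu & fmu <= g1].
Proof.
have /andP[a1 a2] := fA1_bounds; rewrite /fmu; split.
- by rewrite /c0 /hmean lef_pV2 ?posrE // fA1_le_travel.
- by rewrite -[leLHS]invrK lef_pV2 ?posrE ?invr_gt0.
- by rewrite -[leRHS]invrK lef_pV2 ?posrE ?invr_gt0.
Qed.

Let mu0 : 0 < fmu. Proof. by rewrite invr_gt0. Qed.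

Lemma fpsi_bounds y : g0 / g1 <= fpsi y <= g1 / g0.
Proof.
have [_ m1 m2] := fmu_bounds; have /andP[a1 a2] := fa_bounds y.
have a0 := fa_gt0 y.
apply/andP; split; rewrite /fpsi.
  by apply: ler_pM => //; rewrite ?invr_ge0 ?lef_pV2 ?posrE // ltW.
by apply: ler_pM => //; rewrite ?invr_ge0 ?lef_pV2 ?posrE // ltW.
Qed.

Lemma dv_fPsi y : is_derive y 1 fPsi (fpsi y).
Proof. exact: dvZ (dv_frozen_A w y). Qed.

Lemma dv_fpsi y : is_derive y 1 fpsi (fdpsi y).
Proof.
have a0 := fa_gt0 y; have gy := rate_gt0 g y; have mh := mT0 m0.
have d1 := dv_sqrt (h0 y) ((frozen_resolvent w).2 y).
have a0' : Num.sqrt (h y) != 0 by rewrite gt_eqF.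
apply: (@dv_eq _ fpsi y _ (fdpsi y) (dvZ fmu (dvV (f := fa) a0' d1))).
rewrite /fdpsi /fa -/h -/(fa y) -/T -[h y]fa_sqr.
rewrite -/(fa y); field.
by rewrite !gt_eqF.
Qed.

Lemma fPsi_shift y : fPsi (y + 1) = fPsi y + 1.
Proof.
have ap : periodic1 (fun y => (Num.sqrt (fh w y))^-1).
  by move=> z; rewrite (frozen_resolvent w).1.
rewrite /fPsi (antiderivative_shift ap (dv_frozen_A w) (frozen_A0 w)).
by rewrite mulrDr mulVf // gt_eqF.
Qed.

Lemma fPsi_near y : `|fPsi y - y| <= 1.
Proof.
have pp : periodic1 (fun y => fPsi y - y) by move=> z; rewrite fPsi_shift; ring.
have [z /andP[z0 z1] ->] := periodic1_reduce pp y.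
have inc := dv_ge0_nondecreasing dv_fPsi.
have psi0 x : 0 <= fpsi x.
  by have /andP[+ _] := fpsi_bounds x; apply: le_trans; rewrite divr_ge0 // ltW.
have P0 : fPsi 0 = 0 by rewrite /fPsi frozen_A0 mulr0.
have := inc psi0 _ _ z0; have := inc psi0 _ _ z1.
have -> : fPsi 1 = 1 by have := fPsi_shift 0; rewrite add0r P0 add0r.
rewrite P0 => h1 h2.
by rewrite ler_norml; apply/andP; split; lra.
Qed.

Definition frozen_K1 := g1 ^+ 3 / (2 * g0 ^+ 3 * (T ^+ 2 * g0)).

Lemma fdpsi_bound y : `|fdpsi y| <= frozen_K1 / m.
Proof.
have [_ m1 m2] := fmu_bounds; have /andP[a1 a2] := fa_bounds y.
have a0 := fa_gt0 y; have gy := rate_gt0 g y.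
have d1 := resolvent_dist (mT0 m0) (frozen_resolvent w) y.
have TT : 0 < T ^+ 2 by rewrite exprn_gt0.
have a3 : 0 < fa y ^+ 3 by rewrite exprn_gt0.
have den0 : 0 < 2 * fa y ^+ 3 * (m * T ^+ 2 * g y) by rewrite !mulr_gt0.
rewrite /fdpsi normrM normrN normrM (gtr0_norm mu0) normfV (gtr0_norm den0).
have -> : frozen_K1 / m = (g1 * g1 ^+ 2) / (2 * g0 ^+ 3 * (m * T ^+ 2 * g0)).
  by rewrite /frozen_K1; field; rewrite !gt_eqF.
apply: ler_pM; first by rewrite mulr_ge0 // ltW.
- by rewrite invr_ge0 ltW.
- by apply: ler_pM => //; exact: ltW.
- have g03 : 0 < g0 ^+ 3 by rewrite exprn_gt0.
  rewrite lef_pV2 ?posrE //; last by rewrite !mulr_gt0.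
  have mT := mT0 m0; apply: ler_pM.
  + by rewrite mulr_ge0 // ltW.
  + by rewrite mulr_ge0 // ltW.
  + by rewrite ler_pM2l // lerXn2r ?nnegrE // ltW.
  + by rewrite (ler_pM2l mT) rate_minP.
Qed.

(** For steep slopes the phase is nearly the value itself: [fpsi] has mean 1
    over a period and a small derivative. *)
Lemma fpsi_near1 y : `|fpsi y - 1| <= frozen_K1 / m.
Proof.
have pp : periodic1 fpsi by move=> z; rewrite /fpsi /fa (frozen_resolvent w).1.
have [z /andP[z0 z1] ->] := periodic1_reduce pp y.
have Pc : continuous fPsi := dv_continuousT dv_fPsi.
have pc : continuous fpsi := dv_continuousT dv_fpsi.
have [|c c01] := @MVT_segment R fPsi fpsi 0 1 ler01 (fun x _ => dv_fPsi x).
  exact: continuous_subspaceT.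
have -> : fPsi 1 - fPsi 0 = 1 by have := fPsi_shift 0; rewrite add0r => ->; ring.
rewrite subr0 mulr1 => c1.
move: c01; rewrite in_itv /= => /andP[c0' c1'].
have K0 : 0 <= frozen_K1 / m by apply: le_trans (normr_ge0 _) (fdpsi_bound y).
have H a b : 0 <= a -> b <= 1 -> a <= b -> `|fpsi b - fpsi a| <= frozen_K1 / m.
  move=> a0 b1 ab.
  have [|d _ ->] := @MVT_segment R fpsi fdpsi a b ab (fun x _ => dv_fpsi x).
    exact: continuous_subspaceT.
  rewrite normrM -[leRHS]mulr1 ler_pM ?fdpsi_bound //.
  by rewrite ger0_norm; lra.
rewrite {1}c1; have [zc|cz] := leP z c; last by apply: H => //; exact: ltW.
by rewrite distrC; apply: H.
Qed.

(** The main inequality. Up to a positive factor, the difference of the two sides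
    is a quadratic polynomial in [fmu] and [fa] which, for [d = 0] and [M = m], equals
    [(fmu * g - c0 * fa)^2 / 2 + (fmu^2 - c0^2) * g^2 / 2]; it is nonnegative
    because [c0 <= fmu]. The loss [d] of speed pays for slopes [M <> m] and leaves
    a strict inequality. *)
Lemma fpsi_sub d M y : 0 <= d <= 1 ->
  `|(M / m - 1) * (fh w y - g y ^+ 2)| <= d * g0 ^+ 2 ->
  c0 * (1 - d) * fpsi y ^+ 2 + M * fdpsi y + d * (c0 ^+ 3 * g0 ^+ 2 / (2 * g1 ^+ 4))
     <= g y * fpsi y ^+ 3.
Proof.
move=> /andP[d0 d1]; rewrite ler_norml => /andP[e1 e2].
have [mu1 mu2 mu3] := fmu_bounds; have /andP[a1 a2] := fa_bounds y.
have a0 := fa_gt0 y; have gy := rate_gt0 g y; have gm := rate_minP g y.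
have gM := rate_maxP g y.
have c00 : 0 < c0 by exact: hmean_gt0.
have cT : T = c0^-1 by rewrite /c0 /hmean invrK.
set E := (M / m - 1) * (fh w y - g y ^+ 2) in e1 e2.
pose D := fmu ^+ 2 * g y ^+ 2 - c0 * (1 - d) * fmu * g y * fa y
   + c0 ^+ 2 / 2 * (fa y ^+ 2 - g y ^+ 2) + c0 ^+ 2 / 2 * E.
have -> : g y * fpsi y ^+ 3 = c0 * (1 - d) * fpsi y ^+ 2 + M * fdpsi y
    + fmu / (g y * fa y ^+ 3) * D.
  rewrite /D /E /fpsi /fdpsi cT -/h -fa_sqr; field.
  by rewrite !gt_eqF.
rewrite lerD2l.
have D1 : d * (c0 ^+ 2 * g0 ^+ 2 / 2) <= D.
  have b1 : 0 <= fmu ^+ 2 * g y ^+ 2 - c0 * fmu * g y * fa y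
   + c0 ^+ 2 / 2 * (fa y ^+ 2 - g y ^+ 2).
    have -> : fmu ^+ 2 * g y ^+ 2 - c0 * fmu * g y * fa y
      + c0 ^+ 2 / 2 * (fa y ^+ 2 - g y ^+ 2) =
      (fmu * g y - c0 * fa y) ^+ 2 / 2 + (fmu ^+ 2 - c0 ^+ 2) * g y ^+ 2 / 2 by field.
    rewrite addr_ge0 //; first by rewrite divr_ge0 // sqr_ge0.
    by rewrite divr_ge0 // mulr_ge0 ?sqr_ge0 // subr_ge0 lerXn2r ?nnegrE // ltW.
  have b2 : d * (c0 ^+ 2 * g0 ^+ 2) <= d * (c0 * fmu * g y * fa y).
    rewrite ler_wpM2l // expr2 expr2.
    have -> : c0 * c0 * (g0 * g0) = c0 * c0 * g0 * g0 by ring.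
    by rewrite !ler_pM // ?mulr_ge0 // ltW.
  have b3 : - (d * (c0 ^+ 2 * g0 ^+ 2) / 2) <= c0 ^+ 2 / 2 * E.
    have -> : - (d * (c0 ^+ 2 * g0 ^+ 2) / 2) = c0 ^+ 2 / 2 * - (d * g0 ^+ 2) by field.
    by rewrite ler_wpM2l // divr_ge0 // sqr_ge0.
  rewrite /D; move: b1 b2 b3.
  set u := fmu ^+ 2 * g y ^+ 2; set v := c0 ^+ 2 / 2 * _; set q := c0 ^+ 2 / 2 * E.
  lra.
have -> : d * (c0 ^+ 3 * g0 ^+ 2 / (2 * g1 ^+ 4)) =
  c0 / (g1 * g1 ^+ 3) * (d * (c0 ^+ 2 * g0 ^+ 2 / 2)) by field; rewrite gt_eqF.
have c2 : 0 <= c0 ^+ 2 * g0 ^+ 2 / 2 by rewrite divr_ge0 // mulr_ge0 // sqr_ge0.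
have a3 : 0 < fa y ^+ 3 by rewrite exprn_gt0.
have g3 : 0 < g1 ^+ 3 by rewrite exprn_gt0.
apply: ler_pM => //; first by rewrite divr_ge0 ?mulr_ge0 // ltW.
  by rewrite mulr_ge0.
apply: ler_pM => //; first exact: ltW.
  by rewrite invr_ge0 ltW // mulr_gt0.
rewrite lef_pV2 ?posrE ?mulr_gt0 // ler_pM //; try exact: ltW.
by rewrite lerXn2r ?nnegrE // ltW.
Qed.

Definition frozen_K3 :=
  2 * g1 * rate_lip g * g1 * T ^+ 2 * (g1 ^+ 2 / (2 * g0 ^+ 3) + g1 / (2 * g0 ^+ 2)).

(** In a nearly flat state the phase advances at a speed close to the harmonic
    mean, because [fa] is close to [g]. *)
Lemma fpsi_rate y : fpsi y * g y <= c0 + frozen_K3 * m.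
Proof.
pose K := 2 * g1 * rate_lip g * g1 * (m * T ^+ 2).
have small z : `|fa z - g z| <= K / (2 * g0).
  have := resolvent_small (mT0 m0) (frozen_resolvent w) z.
  rewrite -/g1 -/K -/h -fa_sqr.
  have /andP[a1 a2] := fa_bounds z; have gz := rate_minP g z.
  have -> : fa z ^+ 2 - g z ^+ 2 = (fa z + g z) * (fa z - g z) by ring.
  rewrite normrM ger0_norm; last by have := rate_gt0 g z; have := fa_gt0 z; lra.
  move=> H; rewrite ler_pdivlMr ?mulr_gt0 // mulrC; apply: le_trans H.
  by rewrite ler_wpM2r //; rewrite -/g0 in gz; lra.
have K0 : 0 <= K / (2 * g0) by apply: le_trans (normr_ge0 _) (small 0).
have invs z : (g z)^-1 - K / (2 * g0) / g0 ^+ 2 <= (fa z)^-1.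
  have a0 := fa_gt0 z; have gz := rate_gt0 g z.
  have /andP[a1 a2] := fa_bounds z; have gz' := rate_minP g z.
  rewrite lerBlDr -lerBlDl.
  have -> : (g z)^-1 - (fa z)^-1 = (fa z - g z) / (fa z * g z) by field; rewrite !gt_eqF.
  apply: (le_trans (ler_norm _)); rewrite normrM normfV.
  rewrite [`|fa z * g z|]gtr0_norm ?mulr_gt0 //.
  apply: ler_pM => //; first by rewrite invr_ge0 ltW // mulr_gt0.
  by rewrite lef_pV2 ?posrE ?mulr_gt0 ?exprn_gt0 // expr2 ler_pM // ltW.
have A1 : T - K / (2 * g0) / g0 ^+ 2 <= fA w 1.
  suff : travel g 1 - K / (2 * g0) / g0 ^+ 2 * 1 -
    (travel g 0 - K / (2 * g0) / g0 ^+ 2 * 0) <= fA w 1 - fA w 0.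
    by rewrite travel0 frozen_A0 -/T; lra.
  apply: (primitive_le (fun z => dvB (dv_travel g z) (dvZ _ (dv_id z)))
     (dv_frozen_A w)) => z.
  by rewrite mulr1; exact: invs.
have [mu1 mu2 mu3] := fmu_bounds.
have c00 : 0 < c0 by exact: hmean_gt0.
have muc : fmu - c0 <= K / (2 * g0) / g0 ^+ 2 * g1 ^+ 2.
  have -> : fmu - c0 = (T - fA w 1) * (fmu * c0).
    rewrite /fmu /c0 /hmean -/T; field.
    by rewrite !gt_eqF.
  apply: ler_pM; first by have := fA1_le_travel; lra.
  - by rewrite ltW // mulr_gt0.
  - lra.
  - rewrite expr2; apply: ler_pM => //; try exact: ltW.
    exact: le_trans mu1 mu3.
have a0 := fa_gt0 y; have /andP[a1 a2] := fa_bounds y.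
have -> : fpsi y * g y = fmu + fmu * ((g y - fa y) / fa y).
  by rewrite /fpsi; field; rewrite gt_eqF.
have -> : frozen_K3 * m =
  K / (2 * g0) / g0 ^+ 2 * g1 ^+ 2 + g1 * (K / (2 * g0) / g0).
  by rewrite /frozen_K3 /K; field; rewrite gt_eqF.
have : fmu * ((g y - fa y) / fa y) <= g1 * (K / (2 * g0) / g0).
  apply: (le_trans (ler_norm _)); rewrite normrM (gtr0_norm mu0).
  apply: ler_pM => //; first exact: ltW.
  rewrite normrM normfV (gtr0_norm a0) distrC; apply: ler_pM => //.
    by rewrite invr_ge0 ltW.
  by rewrite lef_pV2 ?posrE.
lra.
Qed.

End Fixed.

Definition frozen_K2 :=
  g1 ^+ 2 / (2 * g0) / g0 ^+ 2 * (g1 + g1 ^+ 2 / g0).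

(** Correctors of nearby slopes are close in relative terms, so that a geometric
    grid of slopes suffices to interpolate between them. *)
Lemma fpsi_close m m' (w : frozen m) (w' : frozen m') : 0 < m -> 0 < m' ->
  forall y, `|fpsi w y - fpsi w' y| <= frozen_K2 * `|1 - m' / m|.
Proof.
move=> m0 m'0 y; set e := `|1 - m' / m|.
pose k := g1 ^+ 2 / (2 * g0) / g0 ^+ 2 * e.
have eE : e = `|1 - m' * T ^+ 2 / (m * T ^+ 2)|.
  rewrite /e; have -> // : m' * T ^+ 2 / (m * T ^+ 2) = m' / m.
  by field; rewrite !gt_eqF.
have invs z : `|(fa w z)^-1 - (fa w' z)^-1| <= k.
  have := resolvent_close (mT0 m0) (mT0 m'0) (frozen_resolvent w) (frozen_resolvent w') z.
  rewrite -eE -(fa_sqr m0) -(fa_sqr m'0) -/g1.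
  have a0 := fa_gt0 m0 w z; have a0' := fa_gt0 m'0 w' z.
  have /andP[a1 a2] := fa_bounds m0 w z; have /andP[a1' a2'] := fa_bounds m'0 w' z.
  have -> : fa w z ^+ 2 - fa w' z ^+ 2 = (fa w z + fa w' z) * (fa w z - fa w' z) by ring.
  rewrite normrM ger0_norm; last by rewrite ltW // addr_gt0.
  move=> H.
  have H2 : `|fa w z - fa w' z| <= g1 ^+ 2 / (2 * g0) * e.
    rewrite mulrAC ler_pdivlMr ?mulr_gt0 // mulrC; apply: le_trans H.
    by rewrite ler_wpM2r //; lra.
  have -> : (fa w z)^-1 - (fa w' z)^-1 = - ((fa w z - fa w' z) / (fa w z * fa w' z)).
    by field; rewrite !gt_eqF.
  rewrite normrN normrM normfV [`|fa w z * _|]gtr0_norm ?mulr_gt0 //.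
  have -> : k = g1 ^+ 2 / (2 * g0) * e * (g0 ^+ 2)^-1 by rewrite /k mulrAC.
  apply: ler_pM => //; first by rewrite invr_ge0 ltW // mulr_gt0.
  by rewrite lef_pV2 ?posrE ?mulr_gt0 ?exprn_gt0 // expr2 ler_pM // ltW.
have k0 : 0 <= k by apply: le_trans (normr_ge0 _) (invs 0).
have A1 : `|fA w 1 - fA w' 1| <= k.
  have H z : (fa w z)^-1 - (fa w' z)^-1 <= k /\ (fa w' z)^-1 - (fa w z)^-1 <= k.
    by have := invs z; rewrite ler_norml => /andP[]; split; lra.
  have H1 : fA w 1 - fA w 0 <= fA w' 1 + k * 1 - (fA w' 0 + k * 0).
    apply: (primitive_le (dv_frozen_A w)
      (fun z => dvD (dv_frozen_A w' z) (dvZ k (dv_id z)))) => z.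
    by rewrite mulr1; have := (H z).1; rewrite /fa; lra.
  have H2 : fA w' 1 - fA w' 0 <= fA w 1 + k * 1 - (fA w 0 + k * 0).
    apply: (primitive_le (dv_frozen_A w')
      (fun z => dvD (dv_frozen_A w z) (dvZ k (dv_id z)))) => z.
    by rewrite mulr1; have := (H z).2; rewrite /fa; lra.
  move: H1 H2; rewrite !frozen_A0 ler_norml => H1 H2.
  by apply/andP; split; lra.
have [mu1 mu2 mu3] := fmu_bounds m0 w; have [mu1' mu2' mu3'] := fmu_bounds m'0 w'.
have m1 : 0 < fmu w by apply: lt_le_trans mu2.
have m1' : 0 < fmu w' by apply: lt_le_trans mu2'.
have a0' := fa_gt0 m'0 w' y; have /andP[a1' a2'] := fa_bounds m'0 w' y.
have -> : fpsi w y - fpsi w' y =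
  fmu w * ((fa w y)^-1 - (fa w' y)^-1) - fmu w * fmu w' * (fA w 1 - fA w' 1) * (fa w' y)^-1.
  have e1 : fmu w * fA w 1 = 1 by rewrite /fmu mulVf // -invr_eq0 gt_eqF.
  have e2 : fmu w' * fA w' 1 = 1 by rewrite /fmu mulVf // -invr_eq0 gt_eqF.
  have -> : fmu w * fmu w' * (fA w 1 - fA w' 1) = fmu w' - fmu w.
    have -> : fmu w * fmu w' * (fA w 1 - fA w' 1) =
      (fmu w * fA w 1) * fmu w' - fmu w * (fmu w' * fA w' 1) by ring.
    by rewrite e1 e2; ring.
  by rewrite /fpsi; ring.
apply: (le_trans (ler_normB _ _)).
have -> : frozen_K2 * e = g1 * k + g1 ^+ 2 * k / g0 by rewrite /frozen_K2 /k; ring.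
apply: lerD.
  by rewrite normrM gtr0_norm // ler_pM // ltW.
rewrite normrM normrM normfV (gtr0_norm a0') [`|fmu w * _|]gtr0_norm ?mulr_gt0 //.
have mm0 : 0 < fmu w * fmu w' by rewrite mulr_gt0.
apply: ler_pM.
- by rewrite mulr_ge0 // ltW.
- by rewrite invr_ge0 ltW.
- by apply: ler_pM => //; [exact: ltW|rewrite expr2 ler_pM // ltW].
- by rewrite lef_pV2 ?posrE.
Qed.

(** Two regimes in which the tolerance of [fpsi_sub] is met: slopes close to the
    design slope, and all smaller slopes when the design slope is small. *)
Lemma fpsi_sub_near d m M (w : frozen m) y : 0 <= d <= 1 -> 0 < m ->
  `|M / m - 1| * g1 ^+ 2 <= d * g0 ^+ 2 ->
  c0 * (1 - d) * fpsi w y ^+ 2 + M * fdpsi w y + d * (c0 ^+ 3 * g0 ^+ 2 / (2 * g1 ^+ 4))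
     <= g y * fpsi w y ^+ 3.
Proof.
move=> d01 m0 H; apply: fpsi_sub => //; rewrite normrM.
apply: le_trans H; rewrite ler_wpM2l //.
exact: resolvent_dist (mT0 m0) (frozen_resolvent w) y.
Qed.

Lemma fpsi_sub_small d m M (w : frozen m) y : 0 <= d <= 1 -> 0 < m ->
  0 <= M <= m -> 2 * g1 * rate_lip g * g1 * (m * T ^+ 2) <= d * g0 ^+ 2 ->
  c0 * (1 - d) * fpsi w y ^+ 2 + M * fdpsi w y + d * (c0 ^+ 3 * g0 ^+ 2 / (2 * g1 ^+ 4))
     <= g y * fpsi w y ^+ 3.
Proof.
move=> d01 m0 /andP[M0 Mm] H; apply: fpsi_sub => //; rewrite normrM.
apply: le_trans H; rewrite -[leRHS]mul1r ler_pM //.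
  have q0 := divr_ge0 M0 (ltW m0).
  have q1 : M / m <= 1 by rewrite ler_pdivrMr // mul1r.
  by rewrite ler_norml; apply/andP; split; lra.
exact: resolvent_small (mT0 m0) (frozen_resolvent w) y.
Qed.

End Frozen.

(** * Slope-dependent correctors *)

Section Modulation.
Variable R : realType.
Implicit Types (a b r x y z M : R).

(** A family of correctors indexed by a slope parameter [M], with its partial
    derivatives up to order two. *)
Record modulation := Modulation {
  mval : R -> R -> R; my : R -> R -> R; mM : R -> R -> R;
  myy : R -> R -> R; myM : R -> R -> R; mMM : R -> R -> R }.

(** Differentiability is only used through composition with curves, so it is
    stated as the chain rule itself. *)
Definition chain_rule (F Fy FM : R -> R -> R) :=
  forall (a b : R -> R) r a' b', 0 <= b r ->
    is_derive r 1 a a' -> is_derive r 1 b b' ->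
    is_derive r 1 (fun s => F (a s) (b s))
      (Fy (a r) (b r) * a' + FM (a r) (b r) * b').

Definition smooth2 (W : modulation) :=
  [/\ chain_rule (mval W) (my W) (mM W), chain_rule (my W) (myy W) (myM W),
      chain_rule (mM W) (myM W) (mMM W) &
      forall y M, 0 <= M -> {for (y, M), continuous (fun p => mval W p.1 p.2)}].

(** The weights in [1 + M] reflect that the corrector tends to the identity like
    [1 / M]; with them all error terms of the barrier are small uniformly in the
    slope. *)
Definition tame (W : modulation) C := forall y M, 0 <= M ->
  [/\ `|mval W y M - y| <= C, `|my W y M| <= C, (1 + M) * `|myy W y M| <= C,
      (1 + M) * `|mM W y M| <= C &
      (1 + M) * `|myM W y M| <= C /\ (1 + M) ^+ 2 * `|mMM W y M| <= C].

Definition identity_modulation := Modulation (fun y _ => y) (fun _ _ => 1)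
  (fun _ _ => 0) (fun _ _ => 0) (fun _ _ => 0) (fun _ _ => 0).

Lemma smooth2_identity : smooth2 identity_modulation.
Proof.
split; last by move=> y M _; exact: (cvg_fst : (z.1 : R) @[z --> (y, M)] --> y).
all: move=> a b r a' b' _ da db /=.
- by apply: dv_eq da _; ring.
- by apply: dv_eq (dv_cst 1 r) _; ring.
- by apply: dv_eq (dv_cst 0 r) _; ring.
Qed.

Lemma tame_identity : tame identity_modulation 1.
Proof. by move=> y M M0 /=; rewrite subrr !normr0 !mulr0 normr1; split=> //; split. Qed.

Definition add_product (W : modulation) (t t1 t2 Z Z1 Z2 : R -> R) :=
  Modulation (fun y M => mval W y M + t M * Z y) (fun y M => my W y M + t M * Z1 y)
   (fun y M => mM W y M + t1 M * Z y) (fun y M => myy W y M + t M * Z2 y)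
   (fun y M => myM W y M + t1 M * Z1 y) (fun y M => mMM W y M + t2 M * Z y).

Definition derivs2 (f f1 f2 : R -> R) (D : R -> Prop) := forall r, D r ->
  is_derive r 1 f (f1 r) /\ is_derive r 1 f1 (f2 r).

Lemma chain_rule_add F Fy FM G Gy GM : chain_rule F Fy FM -> chain_rule G Gy GM ->
  chain_rule (fun y M => F y M + G y M) (fun y M => Fy y M + Gy y M)
             (fun y M => FM y M + GM y M).
Proof.
move=> cF cG a b r a' b' b0 da db.
by apply: dv_eq (dvD (cF _ _ _ _ _ b0 da db) (cG _ _ _ _ _ b0 da db)) _; ring.
Qed.

Lemma chain_rule_prod (t t1 Z Z1 : R -> R) :
  (forall r, 0 <= r -> is_derive r 1 t (t1 r)) ->
  (forall r, is_derive r 1 Z (Z1 r)) ->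
  chain_rule (fun y M => t M * Z y) (fun y M => t M * Z1 y) (fun y M => t1 M * Z y).
Proof.
move=> dt dZ a b r a' b' b0 da db.
have d1 := dv_comp (g := b) (dt _ b0) db.
have d2 := dv_comp (g := a) (dZ (a r)) da.
by apply: dv_eq (dvM d1 d2) _; ring.
Qed.

Lemma smooth2_add W t t1 t2 Z Z1 Z2 : smooth2 W ->
  derivs2 t t1 t2 (fun r => 0 <= r) -> derivs2 Z Z1 Z2 setT ->
  smooth2 (add_product W t t1 t2 Z Z1 Z2).
Proof.
case=> c1 c2 c3 cc dt dZ.
have dt1 r (h : 0 <= r) := (dt r h).1; have dt2 r (h : 0 <= r) := (dt r h).2.
have dZ1 r := (dZ r I).1; have dZ2 r := (dZ r I).2.
split; try by apply: chain_rule_add => //; exact: chain_rule_prod.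
move=> y M M0.
have tc : (t z.2 : R) @[z --> (y, M)] --> t M.
  exact: (cvg_comp (@snd R R) t cvg_snd (dv_continuous (dt1 M M0))).
have Zc : (Z z.1 : R) @[z --> (y, M)] --> Z y.
  exact: (cvg_comp (@fst R R) Z cvg_fst (dv_continuous (dZ1 y))).
exact: (continuousD (cc y M M0) (continuousM tc Zc)).
Qed.

Lemma tame_add W C t t1 t2 Z Z1 Z2 Ct CZ : tame W C ->
  (forall M, 0 <= M -> [/\ (1 + M) * `|t M| <= Ct, (1 + M) * `|t1 M| <= Ct
                         & (1 + M) ^+ 2 * `|t2 M| <= Ct]) ->
  (forall y, [/\ `|Z y| <= CZ, `|Z1 y| <= CZ & `|Z2 y| <= CZ]) ->
  tame (add_product W t t1 t2 Z Z1 Z2) (C + Ct * CZ).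
Proof.
move=> tW tt tZ y M M0.
have [a1 a2 a3 a4 [a5 a6]] := tW y M M0.
have [b1 b2 b3] := tt M M0; have [z1 z2 z3] := tZ y.
have M1 : 0 <= 1 + M by rewrite addr_ge0.
have K k u v z : 0 <= k -> k * `|u| <= C -> k * `|v| <= Ct -> `|z| <= CZ ->
    k * `|u + v * z| <= C + Ct * CZ.
  move=> k0 h1 h2 h3; apply: (@le_trans _ _ (k * `|u| + (k * `|v|) * `|z|)).
    by rewrite -mulrA -mulrDr ler_wpM2l // (le_trans (ler_normD _ _)) // normrM.
  by rewrite lerD // ler_pM // mulr_ge0.
have K1 u v z : `|u| <= C -> (1 + M) * `|v| <= Ct -> `|z| <= CZ ->
    `|u + v * z| <= C + Ct * CZ.
  move=> h1 h2 h3; rewrite -[leLHS]mul1r; apply: K => //; rewrite mul1r //.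
  by apply: le_trans h2; rewrite ler_peMl // lerDl.
split; rewrite /=; try by apply: K.
- have -> : mval W y M + t M * Z y - y = mval W y M - y + t M * Z y by ring.
  exact: K1.
- exact: K1.
- by split; apply: K => //; rewrite exprn_ge0.
Qed.

Lemma cutoff A B : 0 <= A -> A < B -> exists (t t1 t2 : R -> R) C,
  [/\ derivs2 t t1 t2 setT,
      (forall M, M <= A -> t M = 1), (forall M, B <= M -> t M = 0),
      (forall M, 0 <= t M <= 1) &
      forall M, 0 <= M -> [/\ (1 + M) * `|t M| <= C, (1 + M) * `|t1 M| <= C
                            & (1 + M) ^+ 2 * `|t2 M| <= C]].
Proof.
move=> A0 AB; have BA : 0 < B - A by rewrite subr_gt0.
have [X [X1 [X2 [[dX dX1] X0 X10 X01 [b1 b2]]]]] := smooth_step R.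
pose l M := (M - A) / (B - A).
have dl M : is_derive M 1 l (B - A)^-1.
  have d := dvM (dvB (dv_id M) (dv_cst A M)) (dv_cst (B - A)^-1 M).
  by apply: dv_eq d _; ring.
pose k := (B - A)^-1.
exists (fun M => 1 - X (l M)), (fun M => - k * X1 (l M)), (fun M => - k ^+ 2 * X2 (l M)).
exists ((1 + B) ^+ 2 * (1 + 30 * k + 60 * k ^+ 2)).
have k0 : 0 < k by rewrite invr_gt0.
have l1 M : B <= M -> 1 <= l M by move=> h; rewrite /l ler_pdivlMr // mul1r lerD2r.
split.
- move=> r _; split.
    by apply: dv_eq (dvB (dv_cst 1 r) (dv_comp (g := l) (dX (l r)) (dl r))) _; rewrite /k; ring.
  by apply: dv_eq (dvZ (- k) (dv_comp (g := l) (dX1 (l r)) (dl r))) _; rewrite /k; ring.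
- by move=> M MA; rewrite X0 ?subr0 // /l pmulr_lle0 ?invr_gt0 // subr_le0.
- by move=> M /l1 /X10[-> _ _]; rewrite subrr.
- by move=> M; have := X01 (l M) => /andP[]; lra.
- move=> M M0.
  have B0 : 0 <= B by lra.
  have c0 : 0 <= (1 + B) ^+ 2 * (1 + 30 * k + 60 * k ^+ 2).
    by rewrite mulr_ge0 ?sqr_ge0 // !addr_ge0 // mulr_ge0 ?sqr_ge0 // ltW.
  have [MB|BM] := leP M B; last first.
    have [-> -> ->] := X10 _ (l1 _ (ltW BM)).
    by rewrite subrr !mulr0 !normr0 !mulr0.
  have k2 := sqr_ge0 k.
  have H1 u : `|u| <= 1 + 30 * k + 60 * k ^+ 2 ->
      (1 + M) * `|u| <= (1 + B) ^+ 2 * (1 + 30 * k + 60 * k ^+ 2).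
    move=> hu; apply: ler_pM => //; first lra.
    have : 0 <= (1 + B) * B by rewrite mulr_ge0 //; lra.
    have -> : (1 + B) ^+ 2 = 1 + B + (1 + B) * B by ring.
    lra.
  have H2 u : `|u| <= 1 + 30 * k + 60 * k ^+ 2 ->
      (1 + M) ^+ 2 * `|u| <= (1 + B) ^+ 2 * (1 + 30 * k + 60 * k ^+ 2).
    move=> hu; apply: ler_pM => //; first exact: sqr_ge0.
    by rewrite lerXn2r ?nnegrE; lra.
  split; [apply: H1|apply: H1|apply: H2].
  + have /andP[x1 x2] := X01 (l M); have k60 : 0 <= 60 * k ^+ 2 by rewrite mulr_ge0.
    by rewrite ler_norml; apply/andP; split; lra.
  + rewrite normrM normrN (gtr0_norm k0); have := ler_wpM2l (ltW k0) (b1 (l M)); lra.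
  + rewrite normrM normrN (ger0_norm k2); have := ler_wpM2l k2 (b2 (l M)); lra.
Qed.

(** Switches on the decaying weight [1 / (1 + M)] where [t] switches off. *)
Lemma complementary_cutoff (t t1 t2 : R -> R) Ct :
  derivs2 t t1 t2 setT -> (forall M, 0 <= t M <= 1) ->
  (forall M, 0 <= M -> [/\ (1 + M) * `|t M| <= Ct, (1 + M) * `|t1 M| <= Ct
                         & (1 + M) ^+ 2 * `|t2 M| <= Ct]) ->
  exists v1 v2, derivs2 (fun M => (1 - t M) * (1 + M)^-1) v1 v2 (fun M => 0 <= M) /\
    forall M, 0 <= M -> [/\ (1 + M) * `|(1 - t M) * (1 + M)^-1| <= 3 * Ct + 2,
                            (1 + M) * `|v1 M| <= 3 * Ct + 2
                          & (1 + M) ^+ 2 * `|v2 M| <= 3 * Ct + 2].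
Proof.
move=> dt t01 tb.
pose v1 M := - t1 M * (1 + M)^-1 - (1 - t M) * (1 + M)^-1 ^+ 2.
pose v2 M := - t2 M * (1 + M)^-1 + 2 * t1 M * (1 + M)^-1 ^+ 2
   + 2 * (1 - t M) * (1 + M)^-1 ^+ 3.
exists v1, v2; split.
- move=> M M0; have M1 : 1 + M != 0 by rewrite gt_eqF //; lra.
  have [dt1 dt2] := dt M I.
  have di := dvV (f := fun M => 1 + M) M1 (dvD (dv_cst 1 M) (dv_id M)).
  have du := dvB (dv_cst 1 M) dt1.
  split.
    by apply: dv_eq (dvM du di) _; rewrite /v1; field.
  apply: dv_eq (dvB (dvM (dvN dt2) di) (dvM du (dv_sqr di))) _.
  by rewrite /v2; field.
- move=> M M0; have M1 : 0 < 1 + M by lra.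
  have [b1 b2 b3] := tb M M0; have /andP[ta tb'] := t01 M.
  set th := (1 + M)^-1.
  have th0 : 0 < th by rewrite invr_gt0.
  have th1 : th <= 1 by rewrite invf_le1 //; lra.
  have Mth : (1 + M) * th = 1 by rewrite /th mulfV // gt_eqF.
  have C0 : 0 <= Ct by apply: le_trans b1; rewrite mulr_ge0 // ltW.
  have n1 : `|t1 M| <= Ct by apply: le_trans b2; rewrite ler_peMl //; lra.
  have n2 : (1 + M) * `|t2 M| <= Ct.
    apply: le_trans b3; rewrite expr2 -mulrA ler_peMl ?mulr_ge0 //; lra.
  have u1 : `|1 - t M| <= 1 by rewrite ler_norml; apply/andP; split; lra.
  have thn : `|th| = th by rewrite gtr0_norm.
  split.
  - rewrite -/th normrM thn mulrCA Mth mulr1; lra.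
  - have -> : v1 M = (- t1 M - (1 - t M) * th) * th by rewrite /v1 -/th; ring.
    rewrite normrM thn mulrCA Mth mulr1; apply: le_trans (ler_normB _ _) _.
    rewrite normrN normrM thn.
    have : `|1 - t M| * th <= 1 * 1 by rewrite ler_pM // ltW.
    lra.
  - have -> : v2 M = ((- t2 M) + 2 * (t1 M * th) + 2 * ((1 - t M) * th ^+ 2)) * th.
      by rewrite /v2 -/th; ring.
    rewrite expr2 normrM thn.
    set X := `|_|.
    have -> : (1 + M) * (1 + M) * (X * th) = (1 + M) * X * ((1 + M) * th) by ring.
    rewrite Mth mulr1.
    have X1 : X <= `|t2 M| + 2 * (`|t1 M| * th) + 2 * (`|1 - t M| * th ^+ 2).
      rewrite /X; apply: le_trans (ler_normD _ _) _; apply: lerD.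
        apply: le_trans (ler_normD _ _) _; rewrite normrN lerD2l.
        by rewrite !normrM thn ger0_norm.
      rewrite normrM (ger0_norm (ler0n R 2)) normrM.
      by rewrite (ger0_norm (exprn_ge0 2 (ltW th0))).
    apply: (@le_trans _ _ ((1 + M) * `|t2 M| + 2 * (`|t1 M| * ((1 + M) * th))
        + 2 * (`|1 - t M| * (th * ((1 + M) * th))))).
      apply: le_trans (ler_wpM2l (ltW M1) X1) _.
      by rewrite le_eqVlt; apply/orP; left; apply/eqP; ring.
    rewrite Mth !mulr1.
    have : `|1 - t M| * th <= 1 * 1 by rewrite ler_pM // ltW.
    lra.
Qed.

Lemma periodic1_bounded (f : R -> R) : continuous f -> periodic1 f ->
  exists2 B, 0 <= B & forall y, `|f y| <= B.
Proof.
move=> fc fp; have [c Hc] := periodic1_max fc fp; have [d Hd] := periodic1_min fc fp.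
exists (`|f c| + `|f d|) => // y; have := Hc y; have := Hd y.
have := ler_norm (f c); have := lerNnormlW (lexx `|f d|).
have := normr_ge0 (f c); have := normr_ge0 (f d).
by rewrite ler_norml => *; apply/andP; split; lra.
Qed.

End Modulation.

(** * Gluing correctors over all slopes *)

Section ModulatedCorrector.
Variables (R : realType) (g : reaction R).
Hypothesis gap : hmean g < amean g.
Implicit Types (a b d m r s x y z A M : R).

Let g0 := rate_min g.
Let g1 := rate_max g.
Let c0 := hmean g.
Let c1 := amean g.
Let T := travel g 1.
Let g0P : 0 < g0. Proof. exact: rate_min_gt0. Qed.
Let g1P : 0 < g1. Proof. exact: rate_max_gt0. Qed.
Let c00 : 0 < c0. Proof. exact: hmean_gt0. Qed.
Let T0 : 0 < T. Proof. exact: travel1_gt0. Qed.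

Let gap' : c0 < c1. Proof. exact: gap. Qed.
Let c1_max : c1 <= g1.
Proof.
have : rate_primitive g 1 - rate_primitive g 0 <= g1 * 1 - g1 * 0.
  apply: (primitive_le (dv_rate_primitive g) (fun y => dvZ g1 (dv_id y))) => y.
  by rewrite mulr1 rate_maxP.
by rewrite rate_primitive0 mulr1 mulr0 !subr0.
Qed.

(** Convex combinations of nearby correctors remain correctors: the quadratic
    term is convex, and the cubic one only loses the distance between them. *)
Lemma interpolate c s P e M t gy p q p' q' : 0 <= c -> 0 <= t <= 1 -> 0 <= gy <= g1 ->
  0 <= p <= P -> 0 <= q <= P -> `|p - q| <= e -> g1 * (3 * P ^+ 2 * e) <= s ->
  c * p ^+ 2 + M * p' + s <= gy * p ^+ 3 ->
  c * q ^+ 2 + M * q' + s <= gy * q ^+ 3 ->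
  c * (q + t * (p - q)) ^+ 2 + M * (q' + t * (p' - q')) <= gy * (q + t * (p - q)) ^+ 3.
Proof.
move=> c_ge /andP[t0 t1] /andP[gy0 gy1] /andP[p0 pP] /andP[q0 qP] pq sE Hp Hq.
set r := q + t * (p - q).
have r0 : 0 <= r.
  have -> : r = t * p + (1 - t) * q by rewrite /r; ring.
  by rewrite addr_ge0 ?mulr_ge0 //; lra.
have rP : r <= P.
  have -> : r = t * p + (1 - t) * q by rewrite /r; ring.
  have h1 := ler_wpM2l t0 pP; have h2 : (1 - t) * q <= (1 - t) * P by rewrite ler_wpM2l //; lra.
  lra.
have e0 : 0 <= e by apply: le_trans pq.
have cube u : 0 <= u <= P -> `|u - r| <= e -> u ^+ 3 <= r ^+ 3 + 3 * P ^+ 2 * e.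
  move=> /andP[u0 uP] ur.
  have -> : u ^+ 3 = r ^+ 3 + (u - r) * (u ^+ 2 + u * r + r ^+ 2) by ring.
  rewrite lerD2l; apply: le_trans (ler_norm _) _; rewrite normrM mulrC.
  have s0 : 0 <= u ^+ 2 + u * r + r ^+ 2 by rewrite !addr_ge0 ?sqr_ge0 ?mulr_ge0.
  rewrite (ger0_norm s0) ler_pM //.
  have h1 : u ^+ 2 <= P ^+ 2 by rewrite lerXn2r ?nnegrE //; apply: le_trans uP.
  have h2 : r ^+ 2 <= P ^+ 2 by rewrite lerXn2r ?nnegrE //; apply: le_trans uP.
  have h3 : u * r <= P ^+ 2 by rewrite expr2 ler_pM.
  lra.
have Cp : p ^+ 3 <= r ^+ 3 + 3 * P ^+ 2 * e.
  apply: cube; first by apply/andP.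
  have -> : p - r = (1 - t) * (p - q) by rewrite /r; ring.
  rewrite normrM -[leRHS]mul1r ler_pM // ler_norml; apply/andP; split; lra.
have Cq : q ^+ 3 <= r ^+ 3 + 3 * P ^+ 2 * e.
  apply: cube; first by apply/andP.
  have -> : q - r = - t * (p - q) by rewrite /r; ring.
  rewrite normrM normrN -[leRHS]mul1r ler_pM // ler_norml; apply/andP; split; lra.
have sq : c * r ^+ 2 <= t * (c * p ^+ 2) + (1 - t) * (c * q ^+ 2).
  rewrite -subr_ge0.
  have -> : t * (c * p ^+ 2) + (1 - t) * (c * q ^+ 2) - c * r ^+ 2
    = c * (t * (1 - t) * (p - q) ^+ 2) by rewrite /r; ring.
  by rewrite mulr_ge0 // mulr_ge0 ?sqr_ge0 // mulr_ge0 //; lra.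
have Hp' := ler_wpM2l t0 Hp.
have t0' : 0 <= 1 - t by lra.
have Hq' := ler_wpM2l t0' Hq.
have Cp' := ler_wpM2l t0 (ler_wpM2l gy0 Cp).
have Cq' := ler_wpM2l t0' (ler_wpM2l gy0 Cq).
have E0 : 0 <= 3 * P ^+ 2 * e by rewrite mulr_ge0 // mulr_ge0 // sqr_ge0.
have gE := ler_wpM2r E0 gy1.
have -> : M * (q' + t * (p' - q')) = t * (M * p') + (1 - t) * (M * q') by ring.
move: sq Hp' Hq' Cp' Cq' gE sE.
rewrite !mulrDr !mulrDl !mul1r !mulNr.
move: (c * r ^+ 2) (t * (c * p ^+ 2)) (c * q ^+ 2) (t * (M * p')) (M * q').
move: (gy * p ^+ 3) (gy * q ^+ 3) (gy * r ^+ 3) (3 * P ^+ 2 * e) => *.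
lra.
Qed.

(** For steep slopes the corrector is [y + Z y / (1 + M)] with [Z'' = g - c1]:
    diffusion averages the rate arithmetically. *)
Lemma steep_primitives : exists (Z z : R -> R) B,
  [/\ 0 <= B, forall y, is_derive y 1 Z (z y), forall y, is_derive y 1 z (g y - c1),
      forall y, `|Z y| <= B & forall y, `|z y| <= B].
Proof.
pose u y := rate_primitive g y - c1 * y.
have du y : is_derive y 1 u (g y - c1).
  by apply: dv_eq (dvB (dv_rate_primitive g y) (dvZ c1 (dv_id y))) _; rewrite mulr1.
have gp : periodic1 (fun y => g y - c1) by move=> y; rewrite rate_periodic.
have up : periodic1 u.
  have u0 : u 0 = 0 by rewrite /u rate_primitive0 mulr0 subrr.
  move=> y; rewrite (antiderivative_shift gp du u0).
  by rewrite {2}/u -/(amean g) -/c1 mulr1 subrr addr0.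
have uc := dv_continuousT du.
have [v [v0 dv]] := antiderivative uc.
pose Z y := v y - v 1 * y; pose z y := u y - v 1.
have dZ y : is_derive y 1 Z (z y).
  by apply: dv_eq (dvB (dv y) (dvZ (v 1) (dv_id y))) _; rewrite mulr1.
have dz y : is_derive y 1 z (g y - c1).
  by apply: dv_eq (dvB (du y) (dv_cst (v 1) y)) _; rewrite subr0.
have zp : periodic1 z by move=> y; rewrite /z up.
have Zp : periodic1 Z.
  by move=> y; rewrite /Z (antiderivative_shift up dv v0); ring.
have [B1 B10 HB1] := periodic1_bounded (dv_continuousT dZ) Zp.
have [B2 B20 HB2] := periodic1_bounded (dv_continuousT dz) zp.
exists Z, z, (B1 + B2); split=> //; first exact: addr_ge0.
  by move=> y; apply: le_trans (HB1 y) _; rewrite lerDl.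
by move=> y; apply: le_trans (HB2 y) _; rewrite lerDr.
Qed.

(** Here [u] is the derivative of [Z / (1 + M)], of order [1 / (1 + M)]; the main
    terms are [(c0 + c1) / 2 + (g y - c1)] against [g y]. *)
Lemma steep_sub B u M y : 0 <= M -> `|u| * (1 + M) <= B -> B <= 1 + M ->
  g1 * (10 * B + 2) <= (c1 - c0) / 4 * (1 + M) ->
  (c0 + c1) / 2 * (1 + u) ^+ 2 + M * ((1 + M)^-1 * (g y - c1)) + (c1 - c0) / 4
    <= g y * (1 + u) ^+ 3.
Proof.
move=> M0 uB BM HM.
have M1 : 0 < 1 + M by lra.
have gy := rate_gt0 g y; have gM := rate_maxP g y.
have b0 : 0 <= `|u| := normr_ge0 u.
have u1 : `|u| <= 1 by rewrite -(ler_pM2r M1) mul1r; lra.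
pose th := (1 + M)^-1.
have th0 : 0 < th by rewrite invr_gt0.
have Mth : M * th = 1 - th by rewrite /th; field; rewrite gt_eqF.
have uth : `|u| <= B * th by rewrite /th ler_pdivlMr.
have HM' : g1 * (10 * B + 2) * th <= (c1 - c0) / 4 by rewrite /th ler_pdivrMr.
have -> : M * ((1 + M)^-1 * (g y - c1)) = (1 - th) * (g y - c1) by rewrite -Mth /th; ring.
have /andP[un1 un2] : - `|u| <= u <= `|u| by rewrite -ler_norml.
have u2 : u ^+ 2 <= `|u|.
  by rewrite -(real_normK (num_real u)) expr2 -[leRHS]mul1r ler_wpM2r.
have u2' := sqr_ge0 u.
have u3 : - `|u| <= u ^+ 3.
  rewrite lerNl; apply: le_trans (ler_norm _) _.
  rewrite normrN normrX exprS -[leRHS]mulr1 ler_wpM2l //.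
  by rewrite expr_le1.
have k1 : - (7 * `|u|) <= 3 * u + 3 * u ^+ 2 + u ^+ 3 by lra.
have k2 : 2 * u + u ^+ 2 <= 3 * `|u| by lra.
have -> : (1 + u) ^+ 3 = 1 + (3 * u + 3 * u ^+ 2 + u ^+ 3) by ring.
have -> : (1 + u) ^+ 2 = 1 + (2 * u + u ^+ 2) by ring.
move: k1 k2; set X := 3 * u + _ + _; set Y := 2 * u + _ => k1 k2.
have cc0 : 0 < (c0 + c1) / 2 by have := c00; have := gap'; lra.
have K1 : - (7 * g1 * `|u|) <= g y * X.
  have := ler_wpM2l (ltW gy) k1.
  have := ler_wpM2r b0 gM; rewrite -/g1 => *; lra.
have K2 : (c0 + c1) / 2 * Y <= 3 * g1 * `|u|.
  have := ler_wpM2l (ltW cc0) k2.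
  have h : (c0 + c1) / 2 <= g1 by have := c1_max; have := gap'; lra.
  have := ler_wpM2r b0 h => *; lra.
have K3 : - (th * g1 * 2) <= th * (g y - c1).
  have h : - (2 * g1) <= g y - c1 by have := c1_max; have := g1P; lra.
  have := ler_wpM2l (ltW th0) h; lra.
have K4 : 10 * g1 * `|u| <= 10 * g1 * (B * th) by rewrite ler_wpM2l //; have := g1P; lra.
have := c1_max; have := gap'.
lra.
Qed.

Let P := 2 * (g1 / g0).
Let low := g0 / g1 / 2.
Let g01 : g0 <= g1. Proof. exact: le_trans (rate_minP g 0) (rate_maxP g 0). Qed.
Let P2 : 2 <= P.
Proof.
have : 1 <= g1 / g0 by rewrite ler_pdivlMr // mul1r.
by rewrite /P; lra.
Qed.
Let P0 : 0 < P. Proof. exact: lt_le_trans P2. Qed.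
Let low0 : 0 < low. Proof. by rewrite /low !divr_gt0. Qed.
Let low1 : low <= 2^-1.
Proof.
have : g0 / g1 <= 1 by rewrite ler_pdivrMr // mul1r.
by rewrite /low; lra.
Qed.

(** The inequality by which a profile with phase [mval W] and squared slope [M]
    advances at least at speed [c]. *)
Definition corrector_at c (W : modulation R) y M :=
  c * my W y M ^+ 2 + M * myy W y M <= g y * my W y M ^+ 3.

Let frozen_range m (w : frozen g m) y : 0 < m -> 0 <= fpsi w y <= P /\ low <= fpsi w y.
Proof.
move=> m0; have /andP[h1 h2] := fpsi_bounds m0 w y.
have a0 : 0 < g0 / g1 by rewrite divr_gt0.
rewrite /P /low; rewrite -/g0 -/g1 in h1 h2.
split; first by apply/andP; split; [apply: le_trans h1; exact: ltW|lra].
lra.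
Qed.

Let low_comb p q t : 0 <= t <= 1 -> low <= p -> low <= q -> low <= q + t * (p - q).
Proof.
move=> /andP[t0 t1] hp hq; have h1 := ler_wpM2l t0 hp.
have h2 : (1 - t) * low <= (1 - t) * q by rewrite ler_wpM2l //; lra.
lra.
Qed.

Section FixedSlack.
Variables (d : R) (d01 : 0 < d <= 1).

Let cl := c0 * (1 - d).
Let s0 := Num.min (d * (c0 ^+ 3 * g0 ^+ 2 / (2 * g1 ^+ 4))) ((c1 - c0) / 4).
Let d0 : 0 < d. Proof. by case/andP: d01. Qed.
Let d01' : 0 <= d <= 1. Proof. by case/andP: d01 => /ltW -> ->. Qed.
Let s00 : 0 < s0.
Proof.
rewrite lt_min; apply/andP; split; last by rewrite divr_gt0 // subr_gt0.
by rewrite mulr_gt0 // divr_gt0 // mulr_gt0 // exprn_gt0.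
Qed.
Let cl0 : 0 <= cl.
Proof. by rewrite /cl mulr_ge0 //; [exact: ltW|case/andP: d01 => ? ?; lra]. Qed.
Let cl1 : cl <= c0.
Proof. by rewrite /cl -[leRHS]mulr1 ler_wpM2l ?ltW //; case/andP: d01 => ? ?; lra. Qed.

(** Largest admissible distance between two interpolated correctors. *)
Let e0 := s0 / (g1 * (3 * P ^+ 2)).
Let gP0 : 0 < g1 * (3 * P ^+ 2).
Proof. by rewrite mulr_gt0 // mulr_gt0 // exprn_gt0. Qed.
Let e00 : 0 < e0. Proof. by rewrite divr_gt0. Qed.
Let e0E : g1 * (3 * P ^+ 2 * e0) <= s0.
Proof. by rewrite mulrA mulrC divfK // gt_eqF. Qed.

(** Ratio of the geometric grid of slope parameters. *)
Let io := Num.min (Num.min (2^-1) (d * g0 ^+ 2 / (2 * g1 ^+ 2))) (e0 / frozen_K2 g).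
Let K20 : 0 < frozen_K2 g.
Proof.
rewrite /frozen_K2 mulr_gt0 ?addr_gt0 // !divr_gt0 ?exprn_gt0 //.
by rewrite mulr_gt0.
Qed.
Let io0 : 0 < io.
Proof.
rewrite !lt_min invr_gt0 ltr0n /= !divr_gt0 // ?mulr_gt0 // exprn_gt0 //.
Qed.
Let ioH : [/\ io <= 2^-1, 2 * io * g1 ^+ 2 <= d * g0 ^+ 2 & frozen_K2 g * io <= e0].
Proof.
split.
- by rewrite !ge_min lexx.
- have h : io <= d * g0 ^+ 2 / (2 * g1 ^+ 2) by rewrite !ge_min lexx !orbT.
  have g2 : 0 < 2 * g1 ^+ 2 by rewrite mulr_gt0 // exprn_gt0.
  have := h; rewrite ler_pdivlMr //.
  by have -> : io * (2 * g1 ^+ 2) = 2 * io * g1 ^+ 2 by ring.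
- have h : io <= e0 / frozen_K2 g by rewrite !ge_min lexx !orbT.
  by have := h; rewrite ler_pdivlMr // mulrC.
Qed.

Let frozen_near m M (w : frozen g m) y : 0 < m -> `|M / m - 1| <= 2 * io ->
  cl * fpsi w y ^+ 2 + M * fdpsi w y + s0 <= g y * fpsi w y ^+ 3.
Proof.
move=> m0 H; have [_ i2 _] := ioH.
have := @fpsi_sub_near R g d m M w y d01' m0.
rewrite -/g0 -/g1 -/c0 -/cl => h.
apply: le_trans (h _); first by rewrite lerD2l ge_min lexx.
by apply: le_trans i2; rewrite ler_wpM2r // exprn_ge0 // ltW.
Qed.

(** Induction hypothesis of the gluing: [A] decreases along the grid, and below [A]
    the frozen corrector is kept, to be joined with the next one. *)
Definition correct_above K A := exists W C, [/\ smooth2 W, tame W C,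
   exists w : frozen g A, forall y M, M <= A ->
     [/\ mval W y M = fPsi w y, my W y M = fpsi w y & myy W y M = fdpsi w y],
   forall y M, A <= M -> low <= my W y M /\ corrector_at cl W y M &
   forall y M, K <= M -> corrector_at ((c0 + c1) / 2) W y M].

Lemma frozen_bounded m (w : frozen g m) : 0 < m -> exists B, forall y,
  [/\ `|fPsi w y - y| <= B, `|fpsi w y| <= B & `|fdpsi w y| <= B].
Proof.
move=> m0; exists (1 + P + frozen_K1 g / m) => y.
have h1 := fPsi_near m0 w y.
have [/andP[p0 pP] _] := frozen_range w y m0.
have h3 := fdpsi_bound m0 w y.
have K0 := le_trans (normr_ge0 _) h3.
by split; rewrite ?(ger0_norm p0); lra.
Qed.

(** Between [A * (1 - io)] and [A] the frozen correctors of both slopes are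
    correct and close to each other, so that they can be interpolated. *)
Lemma correct_above_step K A : 0 < A -> A < K -> correct_above K A ->
  correct_above K (A * (1 - io)).
Proof.
move=> A0 AK [W [C [sW tW [w wE] lW hW]]].
have [i1 i2 i3] := ioH.
set A' := A * (1 - io).
have A'A : A' < A by rewrite /A' gtr_pMr //; have := io0; lra.
have A'0 : 0 < A' by rewrite /A' mulr_gt0 //; lra.
have [w' _] := frozen_inhabited g A'0.
have [t [t1 [t2 [Ct [dt tA' tA t01 tb]]]]] := cutoff (ltW A'0) A'A.
have [B HB] := frozen_bounded w A0; have [B' HB'] := frozen_bounded w' A'0.
pose Z y := fPsi w' y - fPsi w y; pose Z1 y := fpsi w' y - fpsi w y.
pose Z2 y := fdpsi w' y - fdpsi w y.
exists (add_product W t t1 t2 Z Z1 Z2), (C + Ct * (B + B')); split.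
- apply: smooth2_add => //.
    by move=> r _; exact: dt.
  move=> r _; split.
    exact: dvB (dv_fPsi w' r) (dv_fPsi w r).
  exact: dvB (dv_fpsi A'0 w' r) (dv_fpsi A0 w r).
- apply: tame_add => // y; have [b1 b2 b3] := HB y; have [b1' b2' b3'] := HB' y.
  split.
  + have -> : Z y = (fPsi w' y - y) - (fPsi w y - y) by rewrite /Z; ring.
    by apply: le_trans (ler_normB _ _) _; lra.
  + by apply: le_trans (ler_normB _ _) _; lra.
  + by apply: le_trans (ler_normB _ _) _; lra.
- exists w' => y M MA'; have MA : M <= A by lra.
  have [e1 e2 e3] := wE y M MA.
  by rewrite /= e1 e2 e3 tA' // /Z /Z1 /Z2; split; ring.
- move=> y M A'M; rewrite /corrector_at /=.
  have [AM|MA] := leP A M.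
    by rewrite tA // !mul0r !addr0; exact: lW.
  have [e1 e2 e3] := wE y M (ltW MA); rewrite e2 e3.
  have [r1 r2] := frozen_range w y A0; have [r1' r2'] := frozen_range w' y A'0.
  split; first exact: low_comb.
  have AA' : `|1 - A' / A| = io.
    have -> : 1 - A' / A = io by rewrite /A'; field; rewrite gt_eqF.
    by rewrite gtr0_norm.
  apply: (@interpolate cl s0 P e0) => //.
  + by rewrite ltW ?rate_gt0 //= rate_maxP.
  + rewrite distrC; apply: le_trans (fpsi_close w w' A0 A'0 y) _.
    by rewrite AA'.
  + apply: frozen_near => //.
    have q1 : 1 <= M / A' by rewrite ler_pdivlMr // mul1r.
    have q2 : M / A' <= 1 + 2 * io.
      rewrite ler_pdivrMr //; apply: (le_trans (ltW MA)).
      have -> : (1 + 2 * io) * A' = A * (1 + io * (1 - 2 * io)) by rewrite /A'; ring.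
      rewrite -[leLHS]mulr1; apply: (ler_wpM2l (ltW A0)).
      by rewrite lerDl mulr_ge0 //; [exact: ltW|lra].
    by rewrite ger0_norm; lra.
  + apply: frozen_near => //.
    have q1 : M / A <= 1 by rewrite ler_pdivrMr // mul1r ltW.
    have q2 : 1 - io <= M / A by rewrite ler_pdivlMr // mulrC.
    by rewrite ler_norml; apply/andP; split; have := io0; lra.
- move=> y M KM; rewrite /corrector_at /=.
  by rewrite tA; [rewrite !mul0r !addr0; exact: hW|lra].
Qed.

(** For a large slope [K] the steep corrector and the frozen corrector of slope
    [K] both have a derivative within [O(1 / K)] of 1, hence can be interpolated. *)
Lemma correct_above_base : exists K A, [/\ 0 < A, A < K & correct_above K A].
Proof.
have [Z [z [B [B0 dZ dz HZ Hz]]]] := steep_primitives.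
have gap0 : 0 < c1 - c0 by rewrite subr_gt0.
pose K := 1 + 2 * B + g1 * (10 * B + 2) * (4 / (c1 - c0)) + (frozen_K1 g + B) / e0.
have K10 : 0 <= frozen_K1 g.
  by rewrite /frozen_K1 divr_ge0 ?mulr_ge0 ?exprn_ge0 // ltW.
have k1 : 0 <= g1 * (10 * B + 2) * (4 / (c1 - c0)).
  have h1 : 0 <= 10 * B + 2 by lra.
  have h2 : 0 <= 4 / (c1 - c0) by rewrite divr_ge0 // ltW.
  by rewrite mulr_ge0 // mulr_ge0 // ltW.
have k2 : 0 <= (frozen_K1 g + B) / e0 by rewrite divr_ge0 ?addr_ge0 // ltW.
have Kge1 : 1 <= K by rewrite /K; lra.
have K0 : 0 < K by lra.
have KB : 2 * B <= K by rewrite /K; lra.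
have Kg : g1 * (10 * B + 2) <= (c1 - c0) / 4 * K.
  have h : g1 * (10 * B + 2) * (4 / (c1 - c0)) <= K by rewrite /K; lra.
  have q0 : 0 <= (c1 - c0) / 4 by lra.
  have := ler_wpM2l q0 h; apply: le_trans.
  rewrite le_eqVlt; apply/orP; left; apply/eqP; field.
  by rewrite gt_eqF.
have Ke : frozen_K1 g + B <= e0 * K.
  have h : (frozen_K1 g + B) / e0 <= K by rewrite /K; lra.
  by have := h; rewrite ler_pdivrMr // mulrC.
have KK1 : K < K * (1 + io) by rewrite ltr_pMr // ltrDl.
exists (K * (1 + io)), K; split=> //.
have [w _] := frozen_inhabited g K0.
have [t [t1 [t2 [Ct [dt tA tB t01 tb]]]]] := cutoff (ltW K0) KK1.
have [Bw HB] := frozen_bounded w K0.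
have [v1 [v2 [dv vb]]] := complementary_cutoff dt t01 tb.
pose v M := (1 - t M) * (1 + M)^-1.
pose W0 := add_product (identity_modulation R) t t1 t2
   (fun y => fPsi w y - y) (fun y => fpsi w y - 1) (fdpsi w).
pose W := add_product W0 v v1 v2 Z z (fun y => g y - c1).
have gB y : `|g y - c1| <= 2 * g1.
  have h1 := rate_gt0 g y; have h2 := rate_maxP g y; rewrite -/g1 in h2.
  by rewrite ler_norml; apply/andP; split; have := c1_max; have := c00; have := gap'; lra.
have myE y M : my W y M = (1 + z y / (1 + M)) + t M * (fpsi w y - (1 + z y / (1 + M))).
  by rewrite /= /v; ring.
have myyE y M : myy W y M =
    (1 + M)^-1 * (g y - c1) + t M * (fdpsi w y - (1 + M)^-1 * (g y - c1)).
  by rewrite /= /v; ring.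
have steep y M : K <= M -> [/\ `|z y / (1 + M)| <= 2^-1,
    (c0 + c1) / 2 * (1 + z y / (1 + M)) ^+ 2 + M * ((1 + M)^-1 * (g y - c1)) + (c1 - c0) / 4
    <= g y * (1 + z y / (1 + M)) ^+ 3 & `|z y / (1 + M)| <= B / K].
  move=> KM; have M0 : 0 < 1 + M by lra.
  have zM : `|z y / (1 + M)| * (1 + M) <= B.
    by rewrite normrM normfV (gtr0_norm M0) divfK ?gt_eqF.
  split.
  - rewrite -(ler_pM2r M0); apply: le_trans zM _; lra.
  - apply: steep_sub zM _ _; [lra|lra|].
    apply: le_trans Kg _; rewrite ler_wpM2l //; lra.
  - rewrite -(ler_pM2r M0); apply: le_trans zM _.
    rewrite mulrAC ler_pdivlMr // ler_wpM2l //; lra.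
exists W, (1 + Ct * (Bw + 1 + P) + (3 * Ct + 2) * (B + 2 * g1)); split.
- apply: smooth2_add => //.
  apply: smooth2_add; first exact: smooth2_identity.
    by move=> r _; exact: dt.
  move=> r _; split; first exact: dvB (dv_fPsi w r) (dv_id r).
  by apply: dv_eq (dvB (dv_fpsi K0 w r) (dv_cst 1 r)) _; rewrite subr0.
- apply: tame_add => //; last first.
    move=> y; split; [apply: le_trans (HZ y) _|apply: le_trans (Hz y) _|apply: le_trans (gB y) _];
      have := g1P; lra.
  apply: tame_add => //; first exact: tame_identity.
  move=> y; have [b1 b2 b3] := HB y.
  split.
  + by have := P0; lra.
  + by apply: le_trans (ler_normB _ _) _; rewrite normr1; have := P0; lra.
  + by have := P0; lra.
- exists w => y M MK; rewrite /= /v tA //; split; ring.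
- move=> y M KM; have [s1 s2 s3] := steep y M KM.
  rewrite /corrector_at myE myyE.
  have [r1 r2] := frozen_range w y K0.
  move: s1; rewrite ler_norml => /andP[s1 s1'].
  have q_low : low <= 1 + z y / (1 + M) by have := low1; lra.
  split; first exact: low_comb.
  have h1 : cl * (1 + z y / (1 + M)) ^+ 2 <= (c0 + c1) / 2 * (1 + z y / (1 + M)) ^+ 2.
    by rewrite ler_wpM2r ?sqr_ge0 //; have := cl1; have := gap'; lra.
  have [MK1|K1M] := leP M (K * (1 + io)); last first.
    by rewrite tB ?(ltW K1M) // !mul0r !addr0; lra.
  apply: (@interpolate cl s0 P e0) => //.
  + by rewrite ltW ?rate_gt0 //= rate_maxP.
  + by apply/andP; split; [have := low0; lra|have := P2; lra].
  + have n1 := fpsi_near1 K0 w y.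
    have -> : fpsi w y - (1 + z y / (1 + M)) = (fpsi w y - 1) - z y / (1 + M) by ring.
    apply: le_trans (ler_normB _ _) _.
    have : (frozen_K1 g + B) / K <= e0 by rewrite ler_pdivrMr.
    by rewrite mulrDl; lra.
  + apply: frozen_near => //.
    have q1 : 1 <= M / K by rewrite ler_pdivlMr // mul1r.
    have q2 : M / K <= 1 + io by rewrite ler_pdivrMr // mulrC.
    by rewrite ger0_norm; have := io0; lra.
  + apply: le_trans s2.
    have h2 : s0 <= (c1 - c0) / 4 by rewrite /s0 ge_min lexx orbT.
    lra.
- move=> y M K1M; have KM : K <= M by lra.
  have [s1 s2 s3] := steep y M KM.
  rewrite /corrector_at myE myyE tB // !mul0r !addr0; lra.
Qed.

Lemma bernoulli_decay (i : R) k : 0 <= i <= 1 -> (1 - i) ^+ k * (1 + k%:R * i) <= 1.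
Proof.
move=> /andP[i0 i1]; elim: k => [|k IH]; first by rewrite expr0 mul0r addr0 mulr1.
apply: le_trans IH; rewrite exprS -mulrA mulrCA ler_wpM2l ?exprn_ge0 ?subr_ge0 //.
rewrite -natr1; have kR : 0 <= k%:R :> R by rewrite ler0n.
have : 0 <= (k%:R + 1) * (i * i) by rewrite mulr_ge0 ?mulr_ge0 // addr_ge0.
by lra.
Qed.

Lemma correct_above_arbitrary K A : 0 < A -> A < K -> correct_above K A ->
  forall A', 0 < A' -> exists A'', [/\ 0 < A'', A'' <= A', A'' < K & correct_above K A''].
Proof.
move=> A0 AK cA A' A'0.
have [i1 _ _] := ioH; have i0 := io0.
have H k : [/\ 0 < A * (1 - io) ^+ k, A * (1 - io) ^+ k <= A
             & correct_above K (A * (1 - io) ^+ k)].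
  elim: k => [|k [h1 h2 h3]]; first by rewrite expr0 mulr1.
  rewrite exprSr mulrA; split.
  - by rewrite mulr_gt0 //; lra.
  - apply: le_trans h2; rewrite -[leRHS]mulr1 ler_wpM2l //; [exact: ltW|lra].
  - by apply: correct_above_step => //; exact: le_lt_trans AK.
have [k Hk] : exists k : nat, A / (io * A') < k%:R.
  by have := archi_boundP (ltW (divr_gt0 A0 (mulr_gt0 i0 A'0))); exists (Num.bound (A / (io * A'))).
have [h1 h2 h3] := H k.
exists (A * (1 - io) ^+ k); split=> //; last exact: le_lt_trans AK.
have b := @bernoulli_decay io k.
have {}b : (1 - io) ^+ k * (1 + k%:R * io) <= 1 by apply: b; apply/andP; split; lra.
have k0 : 0 <= k%:R :> R by rewrite ler0n.
have ki : 0 <= k%:R * io by rewrite mulr_ge0 // ltW.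
have p0 : 0 <= (1 - io) ^+ k by rewrite exprn_ge0 //; lra.
have b2 : (1 - io) ^+ k * (k%:R * io) <= 1 by lra.
move: Hk; rewrite ltr_pdivrMr ?mulr_gt0 // => Hk.
have : A * (1 - io) ^+ k <= k%:R * (io * A') * (1 - io) ^+ k by rewrite ler_wpM2r // ltW.
move/le_trans; apply.
have -> : k%:R * (io * A') * (1 - io) ^+ k = A' * ((1 - io) ^+ k * (k%:R * io)) by ring.
by rewrite -[leRHS]mulr1 ler_wpM2l // ltW.
Qed.

End FixedSlack.

(** The grid is continued down to a slope whose frozen corrector is correct for all
    smaller slopes. *)
Theorem modulated_corrector d : 0 < d <= 1 -> exists W C K l,
  [/\ smooth2 W, tame W C, 0 < K /\ 0 < l,
   forall y M, 0 <= M -> l <= my W y M /\ corrector_at (c0 * (1 - d)) W y M &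
   forall y M, K <= M -> corrector_at ((c0 + c1) / 2) W y M].
Proof.
move=> d01; have /andP[d0 d1] := d01.
have [K [A [A0 AK cA]]] := correct_above_base d01.
pose L := 2 * g1 * rate_lip g * g1 * T ^+ 2.
have L0 : 0 <= L by rewrite !mulr_ge0 ?rate_lip_ge0 ?exprn_ge0 // ltW.
have A'0 : 0 < d * g0 ^+ 2 / (L + 1).
  by rewrite divr_gt0 ?mulr_gt0 ?exprn_gt0 // ltr_wpDl.
have [A' [pA' A'le A'K [W [C [sW tW [w wE] lW hW]]]]] :=
  correct_above_arbitrary d01 A0 AK cA A'0.
exists W, C, K, low; split=> //; first by split=> //; lra.
move=> y M M0; have [AM|MA] := leP A' M; first exact: lW.
have [e1 e2 e3] := wE y M (ltW MA).
rewrite /corrector_at e2 e3; split; first by case: (frozen_range w y pA').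
have H : 2 * g1 * rate_lip g * g1 * (A' * T ^+ 2) <= d * g0 ^+ 2.
  move: A'le; rewrite ler_pdivlMr; last by lra.
  have -> : 2 * g1 * rate_lip g * g1 * (A' * T ^+ 2) = A' * L by rewrite /L; ring.
  lra.
have d01' : 0 <= d <= 1 by rewrite ltW.
have M01 : 0 <= M <= A' by rewrite M0 ltW.
have := fpsi_sub_small w y d01' pA' M01 H; apply: le_trans.
rewrite lerDl mulr_ge0 ?divr_ge0 ?mulr_ge0 ?exprn_ge0 // ltW //.
Qed.

End ModulatedCorrector.

(** * Minima over space-time slabs *)

Section SpaceTime.
Variables (R : realType) (n : nat).
Notation V := 'rV[R]_n.
Implicit Types (x : V) (t r a b C T : R) (F G U N : V -> R) (w : V -> R -> R).

Lemma coord_le_norm x i : `|x 0 i| <= `|x|.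
Proof.
rewrite [leRHS](mx_normrE x).
by rewrite (le_trans _ (le_bigmax _ (fun ij => `|x ij.1 ij.2|) (0, i))).
Qed.

Lemma norm_le_coord x a : 0 <= a -> (forall i, `|x 0 i| <= a) -> `|x| <= a.
Proof.
move=> a0 H; rewrite [leLHS](mx_normrE x); apply: bigmax_le => // -[j i] _ /=.
by rewrite ord1.
Qed.

Lemma compact_box a T : compact ([set x : V | forall i, x 0 i \in `[- a, a]] `*` `[0, T]).
Proof.
apply: compact_setX; last exact: segment_compact.
exact: (@rV_compact R n (fun=> `[- a, a]%classic) (fun i => @segment_compact R _ _)).
Qed.

(** Coercivity reduces the search to a compact box; a negative minimum cannot be
    attained at time 0. *)
Lemma negative_minimum w T a C x1 t1 :
  {within [set z : V * R | 0 <= z.2], continuous (fun z => w z.1 z.2)} ->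
  0 < a -> (forall x t, 0 <= t <= T -> a * `|x| - C <= w x t) ->
  (forall x, 0 <= w x 0) -> 0 <= t1 <= T -> w x1 t1 < 0 ->
  exists x0 t0, [/\ 0 < t0, t0 <= T, w x0 t0 < 0 &
    forall x t, 0 <= t <= T -> w x0 t0 <= w x t].
Proof.
move=> wc a0 wC w0 t1T w1.
pose rho := `|x1| + `|C| / a.
have rho0 : 0 <= rho by rewrite addr_ge0 // divr_ge0 // ltW.
pose K : set (V * R) := [set x : V | forall i, x 0 i \in `[- rho, rho]] `*` `[0, T]%classic.
have K1 : K (x1, t1).
  split => /=; last by rewrite in_itv.
  move=> i; rewrite in_itv /= -ler_norml (le_trans (coord_le_norm _ _)) //.
  by rewrite lerDl divr_ge0 // ltW.
have Kc : {within K, continuous (fun z => w z.1 z.2)}.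
  apply: continuous_subspaceW wc => -[x t] [_ /=].
  by rewrite in_itv /= => /andP[].
have [[x0 t0] + Hmin] := @compact_EVT_min _ R _ K (ex_intro _ _ K1) (@compact_box rho T) Kc.
rewrite inE => -[Kx0 /=]; rewrite in_itv /= => /andP[t00 t0T].
have m1 : w x0 t0 < 0 by apply: le_lt_trans w1; apply: (Hmin (x1, t1)); rewrite inE.
exists x0, t0; split=> //.
  rewrite lt_neqAle t00 andbT; apply/negP => /eqP E.
  by have := w0 x0; rewrite {2}E leNgt m1.
move=> x t tT; have [Kx|nKx] := pselect (forall i, x 0 i \in `[- rho, rho]).
  by apply: (Hmin (x, t)); rewrite inE; split => //=; rewrite in_itv.
have xr : rho < `|x|.
  rewrite ltNge; apply/negP => H; apply: nKx => i.
  by rewrite in_itv /= -ler_norml; apply: le_trans (coord_le_norm x i) H.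
apply: le_trans (ltW m1) _; apply: le_trans (wC x t tT).
rewrite subr_ge0 (le_trans (ler_norm C)) // -ler_pdivrMl // mulrC.
by apply: le_trans (ltW xr); rewrite lerDr.
Qed.

(** The Laplacian only involves the pure second derivatives, here [F2 i]; so the
    maximum principle can be run along the coordinate axes. *)
Definition C2_axes F (F1 F2 : 'I_n -> V -> R) := forall x i,
  is_derive (0 : R) 1 (fun r : R => F (x + r *: unit_vec R i)) (F1 i x) /\
  is_derive (0 : R) 1 (fun r : R => F1 i (x + r *: unit_vec R i)) (F2 i x).

Lemma dv_axis F (G : V -> R) i : (forall x,
    is_derive (0 : R) 1 (fun r : R => F (x + r *: unit_vec R i)) (G x)) ->
  forall x (s : R), is_derive s 1 (fun r : R => F (x + r *: unit_vec R i))
     (G (x + s *: unit_vec R i)).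
Proof.
move=> dF x s; pose h r := F (x + s *: unit_vec R i + r *: unit_vec R i).
have dh : is_derive (s - s) 1 h (G (x + s *: unit_vec R i)) by rewrite subrr; exact: dF.
have := dv_comp (g := fun r => r - s) dh (dvB (dv_id s) (dv_cst s s)).
rewrite subr0 mulr1.
suff -> : (fun r => h (r - s)) = (fun r => F (x + r *: unit_vec R i)) by [].
by apply/funext => r; rewrite /h -addrA -scalerDl [s + _]addrC subrK.
Qed.

Lemma C2_axesD F (F1 F2 : 'I_n -> V -> R) G (G1 G2 : 'I_n -> V -> R) : C2_axes F F1 F2 -> C2_axes G G1 G2 ->
  C2_axes (fun x => F x + G x) (fun i x => F1 i x + G1 i x) (fun i x => F2 i x + G2 i x).
Proof.
move=> dF dG x i; have [a1 a2] := dF x i; have [b1 b2] := dG x i.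
by split; [exact: dvD a1 b1|exact: dvD a2 b2].
Qed.

Lemma C2_axesZ (k : R) F (F1 F2 : 'I_n -> V -> R) : C2_axes F F1 F2 ->
  C2_axes (fun x => k * F x) (fun i x => k * F1 i x) (fun i x => k * F2 i x).
Proof.
by move=> dF x i; have [a1 a2] := dF x i; split; [exact: dvZ a1|exact: dvZ a2].
Qed.

Lemma C2_axes_cst (k : R) : C2_axes (fun=> k) (fun _ _ => 0) (fun _ _ => 0).
Proof. by move=> x i; split; exact: dv_cst. Qed.

Lemma axes_minimum F (F1 F2 : 'I_n -> V -> R) x : C2_axes F F1 F2 -> (forall z, F x <= F z) ->
  forall i, F1 i x = 0 /\ 0 <= F2 i x.
Proof.
move=> dF Fm i; have [a1 a2] := dF x i.
have m (r : R) : F (x + 0 *: unit_vec R i) <= F (x + r *: unit_vec R i).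
  by rewrite scale0r addr0.
split; first exact: (dv_min0 a1 m).
have d1 := dv_axis (fun z => (dF z i).1) x.
exact: (dv2_min d1 a2 m).
Qed.

(** First and second derivatives of [mval W (U x) (N x)] along the axes. *)
Definition mod1 (W : modulation R) (U N : V -> R) (U1 N1 : 'I_n -> V -> R) i x :=
  my W (U x) (N x) * U1 i x + mM W (U x) (N x) * N1 i x.

Definition mod2 (W : modulation R) (U N : V -> R) (U1 N1 U2 N2 : 'I_n -> V -> R) i x :=
  myy W (U x) (N x) * U1 i x ^+ 2 + 2 * myM W (U x) (N x) * (U1 i x * N1 i x)
  + mMM W (U x) (N x) * N1 i x ^+ 2
  + my W (U x) (N x) * U2 i x + mM W (U x) (N x) * N2 i x.

Lemma C2_axes_modulation W U N (U1 N1 U2 N2 : 'I_n -> V -> R) : smooth2 W -> (forall x, 0 <= N x) ->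
  C2_axes U U1 U2 -> C2_axes N N1 N2 ->
  C2_axes (fun x => mval W (U x) (N x)) (mod1 W U N U1 N1) (mod2 W U N U1 N1 U2 N2).
Proof.
move=> [c1 c2 c3 _] N0 dU dN x i; have [u1 u2] := dU x i; have [n1 n2] := dN x i.
have N0' : 0 <= N (x + 0 *: unit_vec R i) by [].
have E (G : V -> R) : G (x + 0 *: unit_vec R i) = G x by rewrite scale0r addr0.
split.
  by apply: dv_eq (c1 _ _ _ _ _ N0' u1 n1) _; rewrite /= !E.
have d2 := c2 _ _ _ _ _ N0' u1 n1; have d3 := c3 _ _ _ _ _ N0' u1 n1.
apply: dv_eq (dvD (dvM d2 u2) (dvM d3 n2)) _.
by rewrite /= !E /mod2; ring.
Qed.

End SpaceTime.

(** * Space-time derivatives and the smooth cone *)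

Section Solutions.
Variables (R : realType) (n : nat).
Notation V := 'rV[R]_n.
Implicit Types (x : V) (t r a b C T e : R).

Lemma dv_of_derivable (F : V -> R) x v : derivable F x v ->
  is_derive (0 : R) 1 (fun r : R => F (x + r *: v)) ('D_v F x).
Proof.
move=> dF.
have E : (fun h : R => h^-1 *: (((fun r : R => F (x + r *: v)) \o shift 0) (h *: 1) -
     F (x + 0 *: v))) = (fun h : R => h^-1 *: ((F \o shift x) (h *: v) - F x)).
  apply/funext => h /=; rewrite scale0r addr0 addr0 [h *: 1]mulr1.
  by rewrite (addrC (h *: v)).
apply: DeriveDef; first by rewrite /derivable E.
by rewrite /derive E.
Qed.

(** The derivatives are carried as data, so that those of sums and composites are
    given by formulas. *)
Definition parabolic_jet (v vt : V -> R -> R) (v1 v2 : 'I_n -> V -> R -> R) :=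
  forall t, 0 < t -> (forall x, is_derive t 1 (v x) (vt x t)) /\
    C2_axes (v ^~ t) (fun i x => v1 i x t) (fun i x => v2 i x t).

Lemma solution_jet g alpha (u0 : V -> R) e v : is_solution g alpha u0 e v ->
  parabolic_jet v (dt v) (fun i => dx i v) (fun i => dx i (dx i v)).
Proof.
move=> [reg _ _ _ _] t t0.
have h : 0 < (2^-1 : R) < 1 by apply/andP; split; lra.
have [vt vx vxx _ _] := reg _ h.
split.
  by move=> x; apply: DeriveDef; [exact: vt|rewrite /dt derive1E].
move=> x i; split; first exact: dv_of_derivable (vx i x t t0).
exact: dv_of_derivable (vxx i i x t t0).
Qed.

Lemma parabolic_jetD v vt v1 v2 w wt w1 w2 :
  parabolic_jet v vt v1 v2 -> parabolic_jet w wt w1 w2 ->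
  parabolic_jet (fun x t => v x t + w x t) (fun x t => vt x t + wt x t)
    (fun i x t => v1 i x t + w1 i x t) (fun i x t => v2 i x t + w2 i x t).
Proof.
move=> dv dw t t0; have [a1 a2] := dv t t0; have [b1 b2] := dw t t0.
split; first by move=> x; exact: dvD (a1 x) (b1 x).
exact: C2_axesD a2 b2.
Qed.

Lemma parabolic_jetZ k v vt v1 v2 : parabolic_jet v vt v1 v2 ->
  parabolic_jet (fun x t => k * v x t) (fun x t => k * vt x t)
    (fun i x t => k * v1 i x t) (fun i x t => k * v2 i x t).
Proof.
move=> dv t t0; have [a1 a2] := dv t t0.
split; first by move=> x; exact: dvZ (a1 x).
exact: C2_axesZ a2.
Qed.

Variable x0 : V.
Variable rho : R.
Hypothesis rho0 : 0 < rho.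

Definition omega x := \sum_(j < n) (x 0 j - x0 0 j) ^+ 2.

(** A smooth substitute for the Euclidean distance to [x0]. *)
Definition cone x := Num.sqrt (rho ^+ 2 + omega x).

Lemma omega_ge0 x : 0 <= omega x.
Proof. by apply: sumr_ge0 => j _; exact: sqr_ge0. Qed.

Let rad_gt0 x : 0 < rho ^+ 2 + omega x.
Proof. by rewrite ltr_pwDl ?omega_ge0 // exprn_gt0. Qed.

Lemma cone_gt0 x : 0 < cone x.
Proof. by rewrite sqrtr_gt0. Qed.

Lemma cone_sqr x : cone x ^+ 2 = rho ^+ 2 + omega x.
Proof. by rewrite sqr_sqrtr // ltW. Qed.

Lemma cone_ge_rho x : rho <= cone x.
Proof.
rewrite -(ger0_norm (ltW rho0)) -sqrtr_sqr ler_wsqrtr // lerDl; exact: omega_ge0.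
Qed.

Lemma coord_le_cone x i : `|x 0 i - x0 0 i| <= cone x.
Proof.
rewrite -sqrtr_sqr ler_wsqrtr // /omega (bigD1 i) //=.
have : 0 <= \sum_(j < n | j != i) (x 0 j - x0 0 j) ^+ 2.
  by apply: sumr_ge0 => j _; exact: sqr_ge0.
have := sqr_ge0 rho; lra.
Qed.

Lemma dist_le_cone x : `|x - x0| <= cone x.
Proof.
apply: norm_le_coord; first exact: ltW (cone_gt0 x).
by move=> i; rewrite !mxE; exact: coord_le_cone.
Qed.

Lemma cone_le_norm x : cone x <= rho + n%:R * `|x - x0|.
Proof.
have b0 : 0 <= rho + n%:R * `|x - x0| by rewrite addr_ge0 ?mulr_ge0 // ltW.
rewrite -[leRHS](ger0_norm b0) -sqrtr_sqr ler_wsqrtr //.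
have o : omega x <= n%:R * `|x - x0| ^+ 2.
  rewrite /omega; apply: (@le_trans _ _ (\sum_(j < n) `|x - x0| ^+ 2)).
    apply: ler_sum => j _; rewrite -[leLHS]real_normK ?num_real //.
    by rewrite lerXn2r ?nnegrE // (le_trans _ (coord_le_norm _ j)) // !mxE.
  by rewrite sumr_const card_ord -[leLHS]mulr_natl.
have nn : n%:R <= n%:R ^+ 2 :> R by rewrite -natrX ler_nat; case: (n) => // k; rewrite expnS expn1 leq_pmulr.
have h2 : n%:R * `|x - x0| ^+ 2 <= n%:R ^+ 2 * `|x - x0| ^+ 2.
  by rewrite ler_wpM2r // exprn_ge0.
have h3 : 0 <= rho * (n%:R * `|x - x0|) by rewrite mulr_ge0 ?mulr_ge0 // ltW.
have -> : (rho + n%:R * `|x - x0|) ^+ 2 =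
  rho ^+ 2 + 2 * (rho * (n%:R * `|x - x0|)) + n%:R ^+ 2 * `|x - x0| ^+ 2 by ring.
lra.
Qed.

Definition cone1 (i : 'I_n) x := (x 0 i - x0 0 i) / cone x.
Definition cone2 (i : 'I_n) x := (cone x)^-1 - (x 0 i - x0 0 i) ^+ 2 / cone x ^+ 3.

Lemma dv_omega x i :
  is_derive (0 : R) 1 (fun r : R => omega (x + r *: unit_vec R i)) (2 * (x 0 i - x0 0 i)).
Proof.
have -> : (fun r : R => omega (x + r *: unit_vec R i)) =
   (fun r : R => omega x + (2 * (x 0 i - x0 0 i) * r + r * r)).
  apply/funext => r; rewrite /omega (bigD1 i) //= [in RHS](bigD1 i) //=.
  rewrite (eq_bigr (fun j => (x 0 j - x0 0 j) ^+ 2)); last first.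
    by move=> j ji; rewrite /unit_vec !mxE (negbTE ji) ?andbF /= mulr0 addr0.
  by rewrite /unit_vec !mxE !eqxx /= mulr1; ring.
have d1 := dvZ (2 * (x 0 i - x0 0 i)) (dv_id (0 : R)).
apply: dv_eq (dvD (dv_cst (omega x) (0 : R)) (dvD d1 (dvM (dv_id (0 : R)) (dv_id (0 : R))))) _.
by ring.
Qed.

Lemma C2_axes_cone : C2_axes cone cone1 cone2.
Proof.
move=> x i.
have E (G : V -> R) : G (x + 0 *: unit_vec R i) = G x by rewrite scale0r addr0.
have c0 := cone_gt0 x.
have d1 : is_derive (0 : R) 1 (fun r : R => cone (x + r *: unit_vec R i)) (cone1 i x).
  have d := dvD (dv_cst (rho ^+ 2) (0 : R)) (dv_omega x i).
  apply: dv_eq (dv_sqrt (f := fun r => rho ^+ 2 + omega (x + r *: unit_vec R i)) _ d) _.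
    by rewrite E.
  rewrite (E (fun y => Num.sqrt (rho ^+ 2 + omega y))) -/(cone x) /cone1 add0r.
  by field; rewrite gt_eqF.
split=> //.
have dc : is_derive (0 : R) 1 (fun r : R => (x + r *: unit_vec R i) 0 i - x0 0 i) 1.
  have -> : (fun r : R => (x + r *: unit_vec R i) 0 i - x0 0 i) = (fun r => (x 0 i - x0 0 i) + r).
    by apply/funext => r; rewrite /unit_vec !mxE !eqxx /= mulr1; ring.
  by apply: dv_eq (dvD (dv_cst (x 0 i - x0 0 i) (0 : R)) (dv_id (0 : R))) _; rewrite add0r.
have cN : cone (x + 0 *: unit_vec R i) != 0 by rewrite E gt_eqF.
apply: dv_eq (dvM dc (dvV (f := fun r => cone (x + r *: unit_vec R i)) cN d1)) _.
rewrite E (E (fun y => y 0 i - x0 0 i)) /cone2 /cone1.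
by field; rewrite gt_eqF.
Qed.

Lemma cone1_sqr_sum x : \sum_(i < n) cone1 i x ^+ 2 = 1 - rho ^+ 2 / cone x ^+ 2.
Proof.
rewrite (eq_bigr (fun i => (x 0 i - x0 0 i) ^+ 2 * (cone x ^+ 2)^-1)); last first.
  by move=> i _; rewrite /cone1 exprMn exprVn.
rewrite -mulr_suml -/(omega x).
have c2 : cone x ^+ 2 != 0 by rewrite gt_eqF // exprn_gt0 // cone_gt0.
have -> : omega x = cone x ^+ 2 - rho ^+ 2 by rewrite cone_sqr; ring.
by rewrite mulrBl mulfV.
Qed.

Lemma cone2_bounds x i : 0 <= cone2 i x <= rho^-1.
Proof.
have c0 := cone_gt0 x; have cr := cone_ge_rho x.
have c3 : 0 < cone x ^+ 3 by rewrite exprn_gt0.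
apply/andP; split.
  have -> : cone2 i x = (cone x ^+ 2 - (x 0 i - x0 0 i) ^+ 2) / cone x ^+ 3.
    by rewrite /cone2; field; rewrite gt_eqF.
  apply: divr_ge0; last exact: ltW.
  rewrite subr_ge0 -[leLHS]real_normK ?num_real //.
  by rewrite lerXn2r ?nnegrE ?coord_le_cone // ltW.
rewrite /cone2; apply: (@le_trans _ _ (cone x)^-1); last by rewrite lef_pV2.
by rewrite gerBl divr_ge0 ?sqr_ge0 // ltW.
Qed.

Lemma C2_axes_radial (f f1 f2 : R -> R) :
  (forall z : R, 0 < z -> is_derive z 1 f (f1 z) /\ is_derive z 1 f1 (f2 z)) ->
  C2_axes (fun x => f (cone x)) (fun i x => f1 (cone x) * cone1 i x)
    (fun i x => f2 (cone x) * cone1 i x ^+ 2 + f1 (cone x) * cone2 i x).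
Proof.
move=> df x i; have [c1 c2] := C2_axes_cone x i.
have E (G : V -> R) : G (x + 0 *: unit_vec R i) = G x by rewrite scale0r addr0.
have [d1 d2] := df (cone (x + 0 *: unit_vec R i)) (cone_gt0 _).
pose gc r := cone (x + r *: unit_vec R i).
split.
  by apply: dv_eq (dv_comp (g := gc) d1 c1) _; rewrite E.
apply: dv_eq (dvM (dv_comp (g := gc) d2 c1) c2) _.
by rewrite /gc !E; ring.
Qed.

Lemma cone_continuous : continuous cone.
Proof.
have oc : continuous omega.
  rewrite /omega; apply: continuous_big; first exact: add_continuous.
  move=> j _ y.
  apply: (@continuous_comp _ _ _ (fun y : V => y 0 j - x0 0 j) (fun r : R => r ^+ 2)).
    by apply: continuousB; [exact: coord_continuous|exact: cst_continuous].
  exact: exprn_continuous.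
move=> x; apply: (@continuous_comp _ _ _ (fun y => rho ^+ 2 + omega y)); last exact: sqrt_continuous.
by apply: continuousD; [exact: cst_continuous|exact: oc].
Qed.

End Solutions.

(** * Comparison for the heat equation *)

Section HeatComparison.
Variables (R : realType) (n : nat).
Notation V := 'rV[R]_n.
Implicit Types (x : V) (t r a b C T e : R).

Definition strip := [set z : V * R | 0 <= z.2].

Lemma time_minimum (f : R -> R) (t l : R) : 0 < t -> is_derive t 1 f l ->
  (forall s, 0 <= s <= t -> f t <= f s) -> l <= 0.
Proof.
move=> t0 df fm; rewrite -oppr_ge0; apply: (dv_ge_left t0 (dvN df)) => r r0 rt.
rewrite mul0r opprK addrC subr_ge0; apply: fm.
by apply/andP; split; lra.
Qed.

Lemma strip_continuousD (f g : V * R -> R) :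
  {within strip, continuous f} -> {within strip, continuous g} ->
  {within strip, continuous (fun z => f z + g z)}.
Proof. by move=> fc gc z; apply: cvgD; [exact: fc|exact: gc]. Qed.

Lemma strip_continuousZ (k : R) (f : V * R -> R) :
  {within strip, continuous f} -> {within strip, continuous (fun z => k * f z)}.
Proof. by move=> fc z; apply: cvgM; [exact: cvg_cst|exact: fc]. Qed.

Lemma strip_continuous_cone x0 rho (f : R -> R -> R) : 0 < rho ->
  (forall q t : R, 0 < q -> {for (q, t), continuous (fun p => f p.1 p.2)}) ->
  {within strip, continuous (fun z => f (cone x0 rho z.1) z.2)}.
Proof.
move=> rho0 fc; apply: continuous_subspaceT => -[x t].
apply: (@continuous_comp _ _ _ (fun z : V * R => (cone x0 rho z.1, z.2)) (fun p => f p.1 p.2)).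
  have h : (cone x0 rho z.1, z.2) @[z --> (x, t)] --> (cone x0 rho x, t).
    have h1 : cone x0 rho z.1 @[z --> (x, t)] --> cone x0 rho x.
      exact: (cvg_comp (@fst V R) (cone x0 rho) cvg_fst (@cone_continuous R n x0 rho x)).
    have h2 : (z.2 : R) @[z --> (x, t)] --> t by exact: cvg_snd.
    exact: (cvg_pair h1 h2).
  exact: h.
by apply: fc; exact: cone_gt0.
Qed.

(** Both sides are half a pure second derivative of the quadratic polynomial
    [cone ^+ 2]. *)
Lemma cone_second x0 rho x i : 0 < rho ->
  cone1 x0 rho i x ^+ 2 + cone x0 rho x * cone2 x0 rho i x = 1.
Proof.
move=> rho0; rewrite /cone1 /cone2; field.
by rewrite gt_eqF // cone_gt0.
Qed.

(** Maximum principle on the whole space: the linear growth is absorbed by a small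
    quadratic penalty. *)
Lemma heat_comparison (kap : R) z zt z1 z2 : 0 <= kap ->
  parabolic_jet z zt z1 z2 ->
  {within strip, continuous (fun p => z p.1 p.2)} ->
  (forall T, exists C, forall x t, 0 <= t <= T -> - (C * (1 + `|x|)) <= z x t) ->
  (forall x, 0 <= z x 0) ->
  (forall x t, 0 < t -> 0 <= zt x t - kap * \sum_(i < n) z2 i x t) ->
  forall x t, 0 <= t -> 0 <= z x t.
Proof.
move=> k0 jz zc zg zi zs x1 t1 t10; rewrite leNgt; apply/negP => z0.
pose q := cone (0 : V) 1; pose D := 2 * n%:R * kap + 1.
have D0 : 0 < D by rewrite ltr_wpDl // !mulr_ge0.
have q1 x : 0 < q x ^+ 2 by rewrite exprn_gt0 // cone_gt0.
pose S := q x1 ^+ 2 + D * t1.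
have S0 : 0 < S by rewrite ltr_wpDr // mulr_ge0 // ltW.
pose mu := - z x1 t1 / (2 * S).
have mu0 : 0 < mu by rewrite divr_gt0 ?oppr_gt0 // mulr_gt0.
pose p x t := q x ^+ 2 + D * t.
pose w x t := z x t + mu * p x t.
have pj : parabolic_jet p (fun _ _ => D)
   (fun i x _ => 2 * q x * cone1 0 1 i x)
   (fun i x _ => 2 * cone1 0 1 i x ^+ 2 + 2 * q x * cone2 0 1 i x).
  move=> t t0; split.
    move=> x; apply: dv_eq (dvD (dv_cst (q x ^+ 2) t) (dvZ D (dv_id t))) _.
    by rewrite add0r mulr1.
  have d := C2_axes_radial 0 ltr01 (f := fun s => s ^+ 2) (f1 := fun s => 2 * s)
     (f2 := fun=> 2).
  have d' : C2_axes (fun x => q x ^+ 2) (fun i x => 2 * q x * cone1 0 1 i x)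
    (fun i x => 2 * cone1 0 1 i x ^+ 2 + 2 * q x * cone2 0 1 i x).
    apply: d => s _; split.
      by apply: dv_eq (dv_sqr (dv_id s)) _; rewrite mulr1.
    by apply: dv_eq (dvZ 2 (dv_id s)) _; rewrite mulr1.
  have := C2_axesD d' (@C2_axes_cst R n (D * t)).
  by under [X in C2_axes _ X _]eq_fun => i do under eq_fun => x do rewrite addr0;
     under [X in C2_axes _ _ X]eq_fun => i do under eq_fun => x do rewrite addr0.
have wj := parabolic_jetD jz (parabolic_jetZ mu pj).
have pc : {within strip, continuous (fun y => p y.1 y.2)}.
  apply: (@strip_continuous_cone 0 1 (fun s t => s ^+ 2 + D * t) ltr01) => s t _.
  apply: cvgD.
    apply: (@continuous_comp _ _ _ (fun p : R * R => p.1) (fun r : R => r ^+ 2)).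
      exact: cvg_fst.
    exact: exprn_continuous.
  by apply: cvgM; [exact: cvg_cst|exact: cvg_snd].
have wc : {within strip, continuous (fun y => w y.1 y.2)}.
  by apply: strip_continuousD => //; exact: strip_continuousZ.
have [C HC] := zg t1.
have x_le_q x : `|x| <= q x by have := dist_le_cone 0 ltr01 x; rewrite subr0.
have [||||x0 [t0 [t00 t0T w0 wm]]] :=
  @negative_minimum R n w t1 1 (C + (C + 1) ^+ 2 / (4 * mu)) x1 t1 wc ltr01.
- move=> x t tT; have := HC x t tT.
  have h1 : `|x| ^+ 2 <= q x ^+ 2.
    by rewrite lerXn2r ?nnegrE // ltW // cone_gt0.
  have h2 : 0 <= D * t by rewrite mulr_ge0 ?(ltW D0) //; case/andP: tT.
  have h3 : mu * `|x| ^+ 2 <= mu * p x t by rewrite ler_wpM2l ?(ltW mu0) // /p; lra.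
  have h4 : 0 <= (2 * mu * `|x| - (C + 1)) ^+ 2 / (4 * mu).
    by rewrite divr_ge0 ?sqr_ge0 // mulr_ge0 // ltW.
  have h5 : (2 * mu * `|x| - (C + 1)) ^+ 2 / (4 * mu) =
    mu * `|x| ^+ 2 - (C + 1) * `|x| + (C + 1) ^+ 2 / (4 * mu).
    by field; rewrite gt_eqF.
  rewrite /w; lra.
- move=> x; rewrite addr_ge0 // mulr_ge0 ?(ltW mu0) // /p mulr0 addr0; exact: ltW.
- by rewrite t10 lexx.
- have -> : w x1 t1 = z x1 t1 / 2.
    by rewrite /w /p -/S /mu; field; rewrite gt_eqF.
  by rewrite pmulr_llt0 ?invr_gt0.
have [wt wx] := wj t0 t00.
have Ht : zt x0 t0 + mu * D <= 0.
  apply: (time_minimum t00 (wt x0)) => s /andP[s0 st]; apply: wm.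
  by rewrite s0 (le_trans st).
have Hx i : 0 <= z2 i x0 t0 + mu * 2.
  have wm0 y : w x0 t0 <= w y t0 by apply: wm; rewrite (ltW t00).
  have [_] := axes_minimum wx wm0 i.
  have := cone_second 0 x0 i ltr01; rewrite -/(q x0) => E.
  have -> : 2 * cone1 0 1 i x0 ^+ 2 + 2 * q x0 * cone2 0 1 i x0 =
    2 * (cone1 0 1 i x0 ^+ 2 + q x0 * cone2 0 1 i x0) by ring.
  by rewrite E mulr1.
have Hs : 0 <= \sum_(i < n) z2 i x0 t0 + n%:R * (mu * 2).
  have : 0 <= \sum_(i < n) (z2 i x0 t0 + mu * 2) by apply: sumr_ge0.
  by rewrite big_split /= sumr_const card_ord -[X in _ <= _ + X]mulr_natl.
have := zs x0 t0 t00; have := ler_wpM2l k0 Hs; rewrite mulr0 mulrDr.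
move: Ht; rewrite /D => Ht h1 h2.
have : mu * (2 * n%:R * kap + 1) = kap * (n%:R * (mu * 2)) + mu by ring.
lra.
Qed.

End HeatComparison.

(** * Comparison of solutions with barriers *)

Section ContactAlgebra.
Variable R : realType.

(** Bound, in units of [kap], on the error terms of [contact_algebra]. *)
Definition contact_const (C l CE : R) : R :=
  let CQ := ((2 + 2 * C ^+ 2 * CE) / l ^+ 2 + CE) / 2 in
  CE + 2 * (C * C * CQ / l) + C * C ^+ 2 * CE / l ^+ 2 + 2 * (CQ * C) + 3 * (CE * C).

Let sum_of_errors (F T1 T2 T3 T4 T5 T6 u0 u1 u2 u3 u4 : R) :
  `|F| <= u0 -> `|T1| <= u1 -> `|T2| <= u2 -> `|T3| <= u3 -> `|T4| <= u4 ->
  `|T5| <= u4 -> `|T6| <= u4 ->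
  - (u0 + 2 * u1 + u2 + 2 * u3 + 3 * u4) <= F + (2 * T1 + T2) - 2 * T3 - T4 - T5 + T6.
Proof.
rewrite !ler_norml.
move=> /andP[? ?] /andP[? ?] /andP[? ?] /andP[? ?] /andP[? ?] /andP[? ?] /andP[? ?].
lra.
Qed.

(** What the contact of [eps * mval W (v / eps) M] with a test function says
    about the test function [phi]. The letters [P], [Q], [S], [F], [E2] and [U2]
    stand for the sums over the coordinates of [v_i ^+ 2], [v_i E_i], [E_i ^+ 2],
    [phi_ii], [E_ii] and [v_ii], where [E] is the squared slope of [phi]; the
    first- and second-order conditions at the contact point are the hypotheses on
    [E], [F] and [ft]. All terms that come from the dependence of the corrector on
    the slope are of order [kap], by the weights in [tame]. *)
Lemma contact_algebra (C l CE psi pyy pM pyM pMM kap eps E g ft ut P Q S F E2 Et c U2 : R) :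
  0 < l -> l <= psi -> 0 < eps -> 0 <= kap <= 1 -> 0 <= E -> 0 <= CE ->
  let h := kap / eps in let M := h * E in
  (1 + M) * `|pyy| <= C -> (1 + M) * `|pM| <= C -> (1 + M) * `|pyM| <= C ->
  (1 + M) ^+ 2 * `|pMM| <= C ->
  E = psi ^+ 2 * P + 2 * (psi * (kap * pM)) * Q + (kap * pM) ^+ 2 * S ->
  0 <= P -> `|Q| <= (P + S) / 2 -> psi ^+ 2 * P <= 2 * E + 2 * ((kap * pM) ^+ 2 * S) ->
  0 <= S -> S <= CE * E -> `|F| <= CE -> `|E2| <= CE -> `|Et| <= CE ->
  F <= pyy * P / eps + 2 * pyM * h * Q + eps * pMM * h ^+ 2 * S + psi * U2
       + kap * pM * E2 ->
  psi * ut + kap * pM * Et <= ft -> ut = kap * U2 + g ->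
  c * psi ^+ 2 + M * pyy <= g * psi ^+ 3 ->
  c - kap * contact_const C l CE <= ft.
Proof.
move=> l0 lpsi eps0 /andP[k0 k1] E0 CE0 h M b1 b2 b3 b4 eE P0 hQ hP S0 SE hF hE2 hEt H1 H2 eu H3.
have psi0 : 0 < psi := lt_le_trans l0 lpsi.
have h0 : 0 <= h by rewrite divr_ge0 // ltW.
have M0 : 0 <= M by rewrite mulr_ge0.
have hE : h = kap / eps by [].
have ME : M = h * E by [].
clearbody M h.
have C0 : 0 <= C by apply: le_trans b1; rewrite mulr_ge0 //; lra.
have wM (x : R) : (1 + M) * `|x| <= C -> `|x| <= C /\ M * `|x| <= C.
  by move=> hx; have := normr_ge0 x; have := mulr_ge0 M0 (normr_ge0 x); split; lra.
have [yy1 yy2] := wM _ b1; have [pM1 pM2] := wM _ b2; have [yM1 yM2] := wM _ b3.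
have [MM1 MM2] : `|pMM| <= C /\ M * `|pMM| <= C.
  apply: wM; apply: le_trans b4; rewrite ler_wpM2r // expr2 ler_peMl //; lra.
set CP := (2 + 2 * C ^+ 2 * CE) / l ^+ 2.
set CQ := (CP + CE) / 2.
have pM2C : (kap * pM) ^+ 2 <= C ^+ 2.
  rewrite -[leLHS]real_normK ?num_real // lerXn2r ?nnegrE // normrM ger0_norm //.
  by rewrite -[leRHS]mul1r ler_pM.
have l2 : 0 < l ^+ 2 by rewrite exprn_gt0.
have PE : P <= CP * E.
  have p1 : l ^+ 2 * P <= psi ^+ 2 * P.
    by rewrite ler_wpM2r // lerXn2r ?nnegrE // ltW.
  have p2 : (kap * pM) ^+ 2 * S <= C ^+ 2 * (CE * E) by rewrite ler_pM // sqr_ge0.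
  have -> : CP * E = (2 * E + 2 * (C ^+ 2 * (CE * E))) / l ^+ 2 by rewrite /CP; field; rewrite gt_eqF.
  rewrite ler_pdivlMr // mulrC; lra.
have QE : `|Q| <= CQ * E by rewrite /CQ; lra.
have CQ0 : 0 <= CQ.
  have q0 : 0 <= CP.
    apply: divr_ge0; last exact: ltW.
    by rewrite addr_ge0 // !mulr_ge0 // sqr_ge0.
  by rewrite /CQ; lra.
have hQM : h * `|Q| <= CQ * M.
  by move: (ler_wpM2l h0 QE); rewrite ME; clear -R; lra.
have hSM : h * S <= CE * M by move: (ler_wpM2l h0 SE); rewrite ME; clear -R; lra.
have hS0 : 0 <= h * S by rewrite mulr_ge0.
have hQ0 : 0 <= h * `|Q| by rewrite mulr_ge0.
have psiN : psi != 0 by rewrite gt_eqF.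
pose T1 := h * Q * pyy * pM / psi.
pose T2 := kap * (h * S * pyy * pM ^+ 2 / psi ^+ 2).
pose T3 := h * Q * pyM.
pose T4 := h * S * pMM.
have n0 (x : R) := normr_ge0 x.
have vl : psi^-1 <= l^-1 by rewrite lef_pV2.
have vl2 : (psi ^+ 2)^-1 <= (l ^+ 2)^-1.
  by rewrite lef_pV2 ?posrE ?exprn_gt0 // lerXn2r ?nnegrE // ltW.
have B1 : `|T1| <= C * C * CQ / l.
  rewrite /T1 !normrM (ger0_norm h0) normfV (gtr0_norm psi0).
  apply: ler_pM; [by rewrite !mulr_ge0|by rewrite invr_ge0 ltW| |exact: vl].
  apply: (@le_trans _ _ (CQ * M * `|pyy| * C)).
    apply: ler_pM => //; first by rewrite !mulr_ge0.
    by rewrite ler_wpM2r.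
  have := ler_wpM2l CQ0 yy2 => y2.
  by move: (ler_wpM2r C0 y2); clear -R; lra.
have B2 : `|T2| <= C * C ^+ 2 * CE / l ^+ 2.
  rewrite /T2 normrM (ger0_norm k0) -[leRHS]mul1r; apply: ler_pM => //.
  have p2 : 0 <= h * S * (pM ^+ 2 / psi ^+ 2) by apply: mulr_ge0 => //; apply: divr_ge0; exact: sqr_ge0.
  have -> : h * S * pyy * pM ^+ 2 / psi ^+ 2 = h * S * (pM ^+ 2 / psi ^+ 2) * pyy by ring.
  rewrite normrM (ger0_norm p2).
  have -> : h * S * (pM ^+ 2 / psi ^+ 2) * `|pyy| = h * S * `|pyy| * `|pM| ^+ 2 / psi ^+ 2.
    by rewrite real_normK ?num_real //; ring.
  apply: ler_pM; [by rewrite !mulr_ge0 ?exprn_ge0|by rewrite invr_ge0 exprn_ge0 // ltW| |exact: vl2].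
  apply: (@le_trans _ _ (CE * M * `|pyy| * C ^+ 2)).
    apply: ler_pM; [by rewrite !mulr_ge0|by rewrite exprn_ge0|by rewrite ler_wpM2r|].
    by rewrite lerXn2r ?nnegrE.
  have := ler_wpM2l CE0 yy2 => y2.
  by move: (ler_wpM2r (exprn_ge0 2 C0) y2); clear -R; lra.
have B3 : `|T3| <= CQ * C.
  rewrite /T3 !normrM (ger0_norm h0).
  apply: (@le_trans _ _ (CQ * M * `|pyM|)); first by rewrite ler_wpM2r.
  by move: (ler_wpM2l CQ0 yM2); clear -R; lra.
have B4 : `|T4| <= CE * C.
  rewrite /T4 normrM (ger0_norm hS0).
  apply: (@le_trans _ _ (CE * M * `|pMM|)); first by rewrite ler_wpM2r.
  by move: (ler_wpM2l CE0 MM2); clear -R; lra.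
have B5 : `|pM * E2| <= CE * C by rewrite normrM mulrC ler_pM.
have B6 : `|pM * Et| <= CE * C by rewrite normrM mulrC ler_pM.
have a1 : pyy * P / eps * kap = M * pyy / psi ^+ 2 - kap * (2 * T1 + T2).
  have -> : pyy * P / eps * kap = h * pyy * P by rewrite hE; ring.
  by rewrite ME eE /T1 /T2; field.
have g1 : c <= psi * g - M * pyy / psi ^+ 2.
  have p2 : 0 < psi ^+ 2 by rewrite exprn_gt0.
  rewrite -(ler_pM2r p2) mulrBl divfK ?gt_eqF //.
  have -> : psi * g * psi ^+ 2 = g * psi ^+ 3 by ring.
  lra.
have H1' := ler_wpM2l k0 H1.
have e1 : kap * (pyy * P / eps + 2 * pyM * h * Q + eps * pMM * h ^+ 2 * S + psi * U2
       + kap * pM * E2) =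
   pyy * P / eps * kap + kap * (2 * T3) + kap * (kap * T4) + kap * psi * U2 + kap * (kap * (pM * E2)).
  by rewrite /T3 /T4 hE; field; rewrite gt_eqF.
rewrite e1 a1 in H1'.
have e2 : psi * ut + kap * pM * Et = kap * psi * U2 + psi * g + kap * (pM * Et) by rewrite eu; ring.
rewrite e2 in H2.
have cc : contact_const C l CE =
   CE + 2 * (C * C * CQ / l) + C * C ^+ 2 * CE / l ^+ 2 + 2 * (CQ * C) + 3 * (CE * C).
  by [].
have tot : - contact_const C l CE <=
   F + (2 * T1 + T2) - 2 * T3 - kap * T4 - kap * (pM * E2) + pM * Et.
  have k4 : `|kap * T4| <= CE * C by rewrite normrM (ger0_norm k0) -[leRHS]mul1r ler_pM.
  have k5 : `|kap * (pM * E2)| <= CE * C by rewrite normrM (ger0_norm k0) -[leRHS]mul1r ler_pM.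
  by rewrite cc; exact: sum_of_errors.
have tot' := ler_wpM2l k0 tot.
move: H1' H2 g1 tot'.
move: (M * pyy / psi ^+ 2) (kap * psi * U2) (psi * g) => x1 x2 x3 y1 y2 y3 y4.
clear -y1 y2 y3 y4; lra.
Qed.

End ContactAlgebra.

Section BarrierComparison.
Variables (R : realType) (n : nat).
Notation V := 'rV[R]_n.
Implicit Types (x : V) (t C : R).

(** [phi] is compared with [e * mval W (v / e) M], which differs from [v] by at most
    [C * e]: at a contact point the speed of [phi] would be at least that of the
    corrector for its slope. *)
Lemma barrier_comparison (g : R -> R) alpha (u0 : V -> R) (e : R) v W (C l CE : R)
    (phi phit E Et : V -> R -> R) (phi1 phi2 E1 E2 : 'I_n -> V -> R -> R) :
  0 < e -> e `^ alpha <= 1 -> is_solution g alpha u0 e v ->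
  smooth2 W -> tame W C -> 0 < l -> 0 <= CE ->
  let h := e `^ alpha / e in
  parabolic_jet phi phit phi1 phi2 -> parabolic_jet E Et E1 E2 ->
  {within @strip R n, continuous (fun z => phi z.1 z.2)} ->
  {within @strip R n, continuous (fun z => E z.1 z.2)} ->
  (forall x t, 0 <= t -> 0 <= E x t) ->
  (forall x t, 0 < t -> E x t = \sum_(i < n) phi1 i x t ^+ 2) ->
  (forall x t, 0 < t -> [/\ \sum_(i < n) E1 i x t ^+ 2 <= CE * E x t,
     `|\sum_(i < n) E2 i x t| <= CE, `|Et x t| <= CE & `|\sum_(i < n) phi2 i x t| <= CE]) ->
  (forall y M, 0 <= M -> l <= my W y M) ->
  (forall x t y, 0 < t -> exists2 c, c * my W y (h * E x t) ^+ 2 +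
        h * E x t * myy W y (h * E x t) <= g y * my W y (h * E x t) ^+ 3 &
      phit x t < c - e `^ alpha * contact_const C l CE) ->
  (forall x, phi x 0 + C * e <= u0 x) ->
  (forall T, exists B, forall x t, 0 <= t <= T -> `|x| - B <= v x t - phi x t) ->
  forall x t, 0 <= t -> phi x t <= v x t + C * e.
Proof.
move=> e0 kap1 sol sW tW l0 CE0 h jphi jE phic Ec E0 EE Eb lW cW init grow x1 t1 t10.
set kap := e `^ alpha in h kap1 cW *.
have kap0 : 0 < kap by rewrite powR_gt0.
have h0 : 0 <= h by rewrite divr_ge0 // ltW.
have jv := solution_jet sol; case: sol => _ vc _ pde vi.
rewrite leNgt; apply/negP => neg.
pose w x t := e * mval W (v x t / e) (h * E x t) + -1 * phi x t.
have eC0 M : 0 <= M -> forall y, `|e * mval W (y / e) M - y| <= C * e.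
  move=> M0 y; have [vW _ _ _ _] := tW (y / e) M M0.
  have -> : e * mval W (y / e) M - y = e * (mval W (y / e) M - y / e).
    by field; rewrite gt_eqF.
  by rewrite normrM gtr0_norm // mulrC ler_wpM2r // ltW.
have N0 x t : 0 <= t -> 0 <= h * E x t by move=> t0; rewrite mulr_ge0 // E0.
have w_low x t : 0 <= t -> v x t - phi x t - C * e <= w x t.
  move=> t0; have := eC0 _ (N0 x t t0) (v x t); rewrite ler_norml => /andP[].
  by rewrite /w => *; lra.
have w_up x t : 0 <= t -> w x t <= v x t - phi x t + C * e.
  move=> t0; have := eC0 _ (N0 x t t0) (v x t); rewrite ler_norml => /andP[].
  by rewrite /w => *; lra.
have wc : {within @strip R n, continuous (fun z => w z.1 z.2)}.
  apply: strip_continuousD; last exact: strip_continuousZ.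
  apply: strip_continuousZ.
  case: sW => _ _ _ mc.
  apply/subspace_continuousP => z z0.
  have m := mc (v z.1 z.2 / e) _ (N0 z.1 z.2 z0).
  have vE : (v y.1 y.2 / e : R) @[y --> within (@strip R n) (nbhs z)] --> v z.1 z.2 / e.
    by apply: cvgM; [exact: (subspace_continuousP _ _).1 vc z z0|exact: cvg_cst].
  have hE : (h * E y.1 y.2 : R) @[y --> within (@strip R n) (nbhs z)] --> h * E z.1 z.2.
    by apply: cvgM; [exact: cvg_cst|exact: (subspace_continuousP _ _).1 Ec z z0].
  exact: (cvg_comp _ _ (cvg_pair vE hE) m).
have [B HB] := grow t1.
have [||||x0 [t0 [t00 t0T w0 wm]]] :=
  @negative_minimum R n w t1 1 (B + C * e) x1 t1 wc ltr01.
- move=> x t tT; have := HB x t tT; have := w_low x t; case/andP: (tT) => tt _ /(_ tt); lra.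
- by move=> x; have := w_low x 0 (lexx 0); have := init x; rewrite vi; lra.
- by rewrite t10 lexx.
- by have := w_up x1 t1 t10; lra.
have [vt vx] := jv t0 t00; have [pt px] := jphi t0 t00; have [Et0 Ex] := jE t0 t00.
pose U x := e^-1 * v x t0; pose N x := h * E x t0.
have jU := C2_axesZ e^-1 vx; have jN := C2_axesZ h Ex.
have N0' x : 0 <= N x by apply: N0; exact: ltW.
have jW := C2_axes_modulation sW N0' jU jN.
have jw := C2_axesD (C2_axesZ e jW) (C2_axesZ (-1) px).
have wmx y : w x0 t0 <= w y t0 by apply: wm; rewrite (ltW t00).
have wUN x : e * mval W (U x) (N x) + -1 * phi x t0 = w x t0 by rewrite /w /U /N (mulrC e^-1).
have wmin y : e * mval W (U x0) (N x0) + -1 * phi x0 t0 <= e * mval W (U y) (N y) + -1 * phi y t0.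
  by rewrite !wUN.
have HX i := axes_minimum jw wmin i.
have HT : my W (U x0) (N x0) * dt v x0 t0 + kap * mM W (U x0) (N x0) * Et x0 t0 <= phit x0 t0.
  case: sW => c1 _ _ _.
  have dU := dvZ e^-1 (vt x0); have dN := dvZ h (Et0 x0).
  have dW := c1 (fun r => e^-1 * v x0 r) (fun r => h * E x0 r) t0 _ _
    (N0 x0 t0 (ltW t00)) dU dN.
  have dw := dvD (dvZ e dW) (dvZ (-1) (pt x0)).
  rewrite -subr_le0; have := time_minimum t00 dw.
  have -> : e * (my W (e^-1 * v x0 t0) (h * E x0 t0) * (e^-1 * dt v x0 t0) +
     mM W (e^-1 * v x0 t0) (h * E x0 t0) * (h * Et x0 t0)) + -1 * phit x0 t0 =
     my W (U x0) (N x0) * dt v x0 t0 + kap * mM W (U x0) (N x0) * Et x0 t0 - phit x0 t0.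
    by rewrite /U /N /h; field; rewrite gt_eqF.
  apply => s /andP[s0 st].
  have := wm x0 s; rewrite /w !(mulrC _ e^-1); apply.
  by rewrite s0 (le_trans st).
have [c cW1 cW2] := cW x0 t0 (U x0) t00.
move: cW2; apply/negP; rewrite -leNgt.
have [SE hE2 hEt hF] := Eb x0 t0 t00.
have [_ _ b1 b2 [b3 b4]] := tW (U x0) (N x0) (N0' x0).
set psi := my W (U x0) (N x0) in HT *; set pM := mM W (U x0) (N x0) in HT b2 *.
set pyy := myy W (U x0) (N x0) in b1 *; set pyM := myM W (U x0) (N x0) in b3 *.
set pMM := mMM W (U x0) (N x0) in b4 *.
have kapE : kap = h * e by rewrite /h divfK // gt_eqF.
have first i : phi1 i x0 t0 = psi * dx i v x0 t0 + kap * pM * E1 i x0 t0.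
  have [+ _] := HX i; rewrite /mod1 -/(U x0) -/psi -/pM => H.
  have -> : psi * dx i v x0 t0 + kap * pM * E1 i x0 t0 =
     e * (psi * (e^-1 * dx i v x0 t0) + pM * (h * E1 i x0 t0)).
    by rewrite kapE; field; rewrite gt_eqF.
  lra.
have second i : phi2 i x0 t0 <= pyy * (dx i v x0 t0 ^+ 2) / e +
    2 * pyM * h * (dx i v x0 t0 * E1 i x0 t0) + e * pMM * h ^+ 2 * E1 i x0 t0 ^+ 2
    + psi * dx i (dx i v) x0 t0 + kap * pM * E2 i x0 t0.
  have [_] := HX i; rewrite /mod2 -/(U x0) -/psi -/pM -/pyy -/pyM -/pMM => H.
  rewrite -subr_ge0; apply: le_trans H _.
  by rewrite le_eqVlt; apply/orP; left; apply/eqP; rewrite kapE; field; rewrite gt_eqF.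
pose a i := dx i v x0 t0; pose b i := E1 i x0 t0.
have k01 : 0 <= kap <= 1 by rewrite ltW.
have hM : h * E x0 t0 = N x0 by [].
apply: (@contact_algebra R C l CE psi pyy pM pyM pMM kap e (E x0 t0) (g (U x0))
  (phit x0 t0) (dt v x0 t0) (\sum_(i < n) a i ^+ 2) (\sum_(i < n) a i * b i)
  (\sum_(i < n) b i ^+ 2) (\sum_(i < n) phi2 i x0 t0) (\sum_(i < n) E2 i x0 t0)
  (Et x0 t0) c (laplacian v x0 t0)) => //.
- exact: lW.
- exact: E0 (ltW t00).
- rewrite (EE _ _ t00) !mulr_sumr -!big_split /=; apply: eq_bigr => i _.
  by rewrite first /a /b; ring.
- by apply: sumr_ge0 => i _; exact: sqr_ge0.
- apply: le_trans (ler_norm_sum _ _ _) _.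
  rewrite -big_split /= mulr_suml; apply: ler_sum => i _.
  rewrite normrM -[a i ^+ 2]real_normK ?num_real // -[b i ^+ 2]real_normK ?num_real //.
  have := sqr_ge0 (`|a i| - `|b i|).
  have -> : (`|a i| - `|b i|) ^+ 2 = `|a i| ^+ 2 + `|b i| ^+ 2 - 2 * (`|a i| * `|b i|) by ring.
  by move=> ?; lra.
- rewrite (EE _ _ t00) !mulr_sumr -!big_split /=; apply: ler_sum => i _.
  rewrite first /a /b -subr_ge0.
  have -> : 2 * (psi * dx i v x0 t0 + kap * pM * E1 i x0 t0) ^+ 2 +
      2 * ((kap * pM) ^+ 2 * E1 i x0 t0 ^+ 2) - psi ^+ 2 * dx i v x0 t0 ^+ 2 =
      (psi * dx i v x0 t0 + 2 * (kap * pM * E1 i x0 t0)) ^+ 2 by ring.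
  exact: sqr_ge0.
- by apply: sumr_ge0 => i _; exact: sqr_ge0.
- rewrite /laplacian.
  have -> : pyy * (\sum_(i < n) a i ^+ 2) / e + 2 * pyM * (kap / e) * (\sum_(i < n) a i * b i) +
     e * pMM * (kap / e) ^+ 2 * (\sum_(i < n) b i ^+ 2) +
     psi * (\sum_(i < n) dx i (dx i v) x0 t0) + kap * pM * (\sum_(i < n) E2 i x0 t0)
    = \sum_(i < n) (pyy * (dx i v x0 t0 ^+ 2) / e +
    2 * pyM * h * (dx i v x0 t0 * E1 i x0 t0) + e * pMM * h ^+ 2 * E1 i x0 t0 ^+ 2
    + psi * dx i (dx i v) x0 t0 + kap * pM * E2 i x0 t0).
    by rewrite !big_split /= -!mulr_sumr -mulr_suml -mulr_sumr.
  by apply: ler_sum => i _; exact: second.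
- have := pde x0 t0 t00; rewrite /U (mulrC e^-1) -/kap; lra.
Qed.

End BarrierComparison.

(** * The upper bound *)

Section UpperBound.
Variables (R : realType) (n : nat) (g : reaction R).
Notation V := 'rV[R]_n.
Implicit Types (x : V) (t C S : R).

Lemma C2_axes_comp (f f1 f2 : R -> R) (U : V -> R) (U1 U2 : 'I_n -> V -> R) :
  (forall z : R, is_derive z 1 f (f1 z) /\ is_derive z 1 f1 (f2 z)) -> C2_axes U U1 U2 ->
  C2_axes (fun x => f (U x)) (fun i x => f1 (U x) * U1 i x)
    (fun i x => f2 (U x) * U1 i x ^+ 2 + f1 (U x) * U2 i x).
Proof.
move=> df dU x i; have [c1 c2] := dU x i.
have E (G : V -> R) : G (x + 0 *: unit_vec R i) = G x by rewrite scale0r addr0.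
pose c r := U (x + r *: unit_vec R i); have [d1 d2] := df (c 0).
split; first by apply: dv_eq (dv_comp (g := c) d1 c1) _; rewrite /c E.
by apply: dv_eq (dvM (dv_comp (g := c) d2 c1) c2) _; rewrite /c !E; ring.
Qed.

Lemma parabolic_jet_affine (a b : R) : parabolic_jet (fun (_ : V) t => a + b * t)
  (fun _ _ => b) (fun (_ : 'I_n) _ _ => 0) (fun (_ : 'I_n) _ _ => 0).
Proof.
move=> t _; split; last exact: C2_axes_cst.
by move=> x; apply: dv_eq (dvD (dv_cst a t) (dvZ b (dv_id t))) _; rewrite add0r mulr1.
Qed.

Lemma parabolic_jet_cone x0 rho (k : R) : 0 < rho ->
  parabolic_jet (fun x (_ : R) => k * cone x0 rho x) (fun _ _ => 0)
  (fun i x _ => k * cone1 x0 rho i x) (fun i x _ => k * cone2 x0 rho i x).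
Proof.
move=> r0 t _; split; first by move=> x; exact: dv_cst.
by apply: C2_axesZ; exact: C2_axes_cone.
Qed.

Lemma strip_continuous_affine_cone x0 rho (a b k : R) : 0 < rho ->
  {within @strip R n, continuous (fun z => a + b * z.2 + k * cone x0 rho z.1)}.
Proof.
move=> rho0.
apply: (@strip_continuous_cone R n x0 rho (fun q t => a + b * t + k * q) rho0) => q t _.
have f1 : {for (q, t), continuous (fun p : R * R => p.1)} by exact: cvg_fst.
have f2 : {for (q, t), continuous (fun p : R * R => p.2)} by exact: cvg_snd.
apply: continuousD; last by apply: continuousM; [exact: cst_continuous|exact: f1].
apply: continuousD; first exact: cst_continuous.
by apply: continuousM; [exact: cst_continuous|exact: f2].
Qed.

Section Solution.
Variables (alpha e : R) (u0 : V -> R) (v : V -> R -> R).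
Hypothesis e0 : 0 < e.
Hypothesis sol : is_solution g alpha u0 e v.
Let kap := e `^ alpha.
Let kap0 : 0 < kap. Proof. exact: powR_gt0. Qed.

Let growth (T : R) : exists2 C, 0 <= C & forall x t, 0 <= t <= T -> `|v x t| <= C * (1 + `|x|).
Proof.
case: sol => _ _ /(_ T)[C HC] _ _; exists `|C| => // x t tT.
apply: le_trans (HC x t tT) _; rewrite ler_wpM2r ?ler_norm // addr_ge0 //.
Qed.

Let pde x t : 0 < t -> dt v x t = kap * laplacian v x t + g (v x t / e).
Proof. by case: sol => _ _ _ /(_ x t) + _ => /[apply]; rewrite -/kap; lra. Qed.

(** The reaction is positive and the Laplacian of the cone is at most [n / rho], so
    that a cone sinking at the corresponding rate stays below [v]. *)
Lemma solution_ge_cone x0 rho a L : 0 < rho -> 0 <= L ->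
  (forall x, a - L * cone x0 rho x <= u0 x) ->
  forall x t, 0 <= t -> a - L * cone x0 rho x - kap * L * n%:R / rho * t <= v x t.
Proof.
move=> r0 L0 Hu x t t0; rewrite -subr_ge0.
set B := kap * L * n%:R / rho.
have B0 : 0 <= B by rewrite divr_ge0 ?mulr_ge0 // ltW.
have j := parabolic_jetD (solution_jet sol)
  (parabolic_jetD (parabolic_jet_affine (- a) B) (parabolic_jet_cone x0 L r0)).
have -> : v x t - (a - L * cone x0 rho x - B * t) = v x t + (- a + B * t + L * cone x0 rho x) by ring.
apply: (heat_comparison (ltW kap0) j) t0.
- apply: strip_continuousD; last exact: strip_continuous_affine_cone r0.
  by case: sol.
- move=> T; have [C C0 HC] := growth T; exists (C + `|a|) => y s /[dup] sT /andP[s0 _].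
  have := HC y s sT; rewrite ler_norml => /andP[h1 _].
  have h2 : 0 <= L * cone x0 rho y by rewrite mulr_ge0 // ltW // cone_gt0.
  have h3 : 0 <= B * s by rewrite mulr_ge0.
  have h4 := ler_norm a; have h5 : 0 <= `|a| * `|y| by rewrite mulr_ge0.
  lra.
- move=> y; case: sol => _ _ _ _ /(_ y) ->; have := Hu y; lra.
- move=> y s s0; rewrite pde //.
  rewrite (eq_bigr (fun i => dx i (dx i v) y s + L * cone2 x0 rho i y)); last first.
    by move=> i _; rewrite add0r.
  rewrite big_split /= -mulr_sumr -/(laplacian v y s).
  have h1 : \sum_(i < n) cone2 x0 rho i y <= n%:R / rho.
    apply: (@le_trans _ _ (\sum_(i < n) rho^-1)).
      by apply: ler_sum => i _; case/andP: (cone2_bounds x0 r0 y i).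
    by rewrite sumr_const card_ord -[leLHS]mulr_natl.
  have h2 := rate_gt0 g (v y s / e).
  have kL : 0 <= kap * L by rewrite mulr_ge0 // ltW.
  have := ler_wpM2l kL h1; rewrite /B; lra.
Qed.

Let rough_upper S x t : (forall x, u0 x <= S) -> 0 <= t -> v x t <= S + rate_max g * t.
Proof.
move=> HS t0; rewrite -subr_ge0.
have j := parabolic_jetD (parabolic_jet_affine S (rate_max g)) (parabolic_jetZ (-1) (solution_jet sol)).
have -> : S + rate_max g * t - v x t = S + rate_max g * t + -1 * v x t by ring.
apply: (heat_comparison (ltW kap0) j) t0.
- apply: strip_continuousD; last by apply: strip_continuousZ; case: sol.
  have -> : (fun p : V * R => S + rate_max g * p.2) =
      (fun p => S + rate_max g * p.2 + 0 * cone 0 1 p.1).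
    by apply/funext => p; rewrite mul0r addr0.
  exact: strip_continuous_affine_cone ltr01.
- move=> T; have [C C0 HC] := growth T; exists (C + `|S|) => y s /[dup] sT /andP[s0 _].
  have := HC y s sT; rewrite ler_norml => /andP[_ h1].
  have h3 : 0 <= rate_max g * s by rewrite mulr_ge0 // ltW // rate_max_gt0.
  have h4 := lerNnormlW (lexx `|S|); have h5 : 0 <= `|S| * `|y| by rewrite mulr_ge0.
  lra.
- move=> y; case: sol => _ _ _ _ /(_ y) ->; have := HS y; lra.
- move=> y s s0; rewrite pde //.
  rewrite (eq_bigr (fun i => -1 * dx i (dx i v) y s)); last by move=> i _; rewrite add0r.
  rewrite -mulr_sumr -/(laplacian v y s).
  have := rate_maxP g (v y s / e); lra.
Qed.

(** The solution is transported to the phase by the corrector of a nearly flat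
    state; there the speed is nearly [hmean g] and only the small gradient of
    the penalty enters. *)
Lemma solution_le_flat S d x t : (forall x, u0 x <= S) -> 0 < d -> 0 <= t ->
  v x t <= S + 2 * e + (hmean g + d) * t.
Proof.
move=> HS d0 t0.
pose m := d / (2 * (`|frozen_K3 g| + 1)).
have K30 : 0 < `|frozen_K3 g| + 1 by rewrite ltr_wpDl.
have m0 : 0 < m by rewrite divr_gt0 // mulr_gt0.
have Km : frozen_K3 g * m <= d / 2.
  apply: (@le_trans _ _ ((`|frozen_K3 g| + 1) * m)).
    by rewrite ler_wpM2r ?(ltW m0) // (le_trans (ler_norm _)) // lerDl.
  by rewrite /m le_eqVlt; apply/orP; left; apply/eqP; field; rewrite gt_eqF.
have [w _] := frozen_inhabited g m0.
pose F x t := e * fPsi w (e^-1 * v x t).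
have FV y s : `|F y s - v y s| <= e.
  have -> : F y s - v y s = e * (fPsi w (e^-1 * v y s) - e^-1 * v y s).
    by rewrite /F; field; rewrite gt_eqF.
  by rewrite normrM (gtr0_norm e0) -[leRHS]mulr1 ler_pM2l // fPsi_near.
suff : F x t <= S + e + (hmean g + d) * t.
  by have := FV x t; rewrite ler_norml => /andP[h1 _]; lra.
rewrite leNgt; apply/negP => neg.
set c := hmean g + d in neg *.
pose l := rate_min g / rate_max g.
have l0 : 0 < l by rewrite divr_gt0 ?rate_min_gt0 ?rate_max_gt0.
pose q := cone (0 : V) 1.
have q0 y : 0 < q y by exact: cone_gt0.
pose B := kap * (`|frozen_K1 g| / m) / (l ^+ 2 * e).
have B0 : 0 <= B.
  apply: divr_ge0; last by rewrite mulr_ge0 ?sqr_ge0 // ltW.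
  by apply: mulr_ge0; [exact: ltW|rewrite divr_ge0 // ltW].
have A0 : 0 <= kap * n%:R by rewrite mulr_ge0 // ltW.
pose mu := Num.min (Num.min 1 (d / (4 * (kap * n%:R + B + 1))))
                   ((F x t - (S + e + c * t)) / (2 * q x)).
have AB : 0 < kap * n%:R + B + 1 by lra.
have mu0 : 0 < mu.
  by rewrite !lt_min ltr01 !divr_gt0 // ?mulr_gt0 // subr_gt0.
have [mu1 mu2 mu3] : [/\ mu <= 1, mu * (kap * n%:R + B + 1) <= d / 4 &
    mu * q x <= (F x t - (S + e + c * t)) / 2].
  split.
  - by rewrite !ge_min lexx.
  - have h : mu <= d / (4 * (kap * n%:R + B + 1)) by rewrite !ge_min lexx !orbT.
    have -> : d / 4 = d / (4 * (kap * n%:R + B + 1)) * (kap * n%:R + B + 1).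
      by field; rewrite gt_eqF.
    by rewrite ler_wpM2r // ltW.
  - have h : mu <= (F x t - (S + e + c * t)) / (2 * q x) by rewrite ge_min lexx orbT.
    have -> : (F x t - (S + e + c * t)) / 2 = (F x t - (S + e + c * t)) / (2 * q x) * q x.
      by field; rewrite gt_eqF.
    by rewrite ler_wpM2r // ltW.
pose z x t := (S + e + c * t + mu * q x) + -1 * F x t.
have zc : {within @strip R n, continuous (fun p => z p.1 p.2)}.
  apply: strip_continuousD; first exact: strip_continuous_affine_cone ltr01.
  apply: strip_continuousZ; apply: strip_continuousZ => p.
  have vc : {within @strip R n, continuous (fun p => v p.1 p.2)} by case: sol.
  have v1 := @strip_continuousZ R n e^-1 _ vc.
  exact: (cvg_comp _ _ (v1 p) (dv_continuous (dv_fPsi w _))).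
have [||||x0 [t1 [t10 t1T z0 zm]]] :=
  @negative_minimum R n z t mu (rate_max g * t) x t zc mu0.
- move=> y s /andP[s0 st]; have hu := rough_upper y HS s0.
  have := FV y s; rewrite ler_norml => /andP[_ h1].
  have h2 : rate_max g * s <= rate_max g * t by rewrite ler_wpM2l // ltW // rate_max_gt0.
  have h3 : mu * `|y| <= mu * q y.
    by rewrite ler_wpM2l ?(ltW mu0) //; have := dist_le_cone 0 ltr01 y; rewrite subr0.
  have h4 : 0 <= c * s by rewrite mulr_ge0 // addr_ge0 // ltW // hmean_gt0.
  rewrite /z; lra.
- move=> y; have := FV y 0; rewrite ler_norml => /andP[_ h1].
  have h2 : 0 <= mu * q y by rewrite mulr_ge0 // ltW.
  have h3 := HS y; have vi : v y 0 = u0 y by case: sol.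
  rewrite /z; lra.
- by rewrite t0 lexx.
- rewrite /z; have := neg; lra.
have [vt vx] := solution_jet sol t10.
have jF := C2_axesZ e (C2_axes_comp (fun y => conj (dv_fPsi w y) (dv_fpsi m0 w y))
   (C2_axesZ e^-1 vx)).
have [_ jc] := parabolic_jet_cone 0 mu ltr01 t10.
have jz := C2_axesD (C2_axesD (@C2_axes_cst R n (S + e + c * t1)) jc) (C2_axesZ (-1) jF).
have zm0 y : z x0 t1 <= z y t1 by apply: zm; rewrite (ltW t10).
set y0 := e^-1 * v x0 t1.
set psi := fpsi w y0.
have HX i : psi * dx i v x0 t1 = mu * cone1 0 1 i x0 /\
   psi * dx i (dx i v) x0 t1 <= mu * cone2 0 1 i x0 - fdpsi w y0 * dx i v x0 t1 ^+ 2 / e.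
  have [h1 h2] := axes_minimum jz zm0 i.
  split.
    have E : e * (psi * (e^-1 * dx i v x0 t1)) = psi * dx i v x0 t1.
      by field; rewrite gt_eqF.
    move: h1; rewrite -/y0 -/psi E; lra.
  rewrite -subr_ge0; apply: le_trans h2 _; rewrite -/y0 -/psi.
  by rewrite le_eqVlt; apply/orP; left; apply/eqP; field; rewrite gt_eqF.
have Ht : c <= psi * dt v x0 t1.
  have dF := dvZ e (dv_comp (g := fun s => e^-1 * v x0 s) (dv_fPsi w _) (dvZ e^-1 (vt x0))).
  have dz := dvD (dvD (dvD (dv_cst (S + e) t1) (dvZ c (dv_id t1))) (dv_cst (mu * q x0) t1)) (dvZ (-1) dF).
  have E : e * (fpsi w (e^-1 * v x0 t1) * (e^-1 * dt v x0 t1)) = psi * dt v x0 t1.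
    by rewrite /psi /y0; field; rewrite gt_eqF.
  rewrite -subr_le0 -E.
  have -> : c - e * (fpsi w (e^-1 * v x0 t1) * (e^-1 * dt v x0 t1)) = 0 + c * 1 + 0 +
     -1 * (e * (fpsi w (e^-1 * v x0 t1) * (e^-1 * dt v x0 t1))) by ring.
  apply: (time_minimum t10 dz) => s /andP[s0 st].
  by apply: (zm x0 s); rewrite s0 (le_trans st).
have /andP[psil _] := fpsi_bounds m0 w y0; rewrite -/l -/psi in psil.
have psi0 : 0 < psi by apply: lt_le_trans psil.
have pr := fpsi_rate m0 w y0; rewrite -/psi in pr.
have sq : \sum_(i < n) dx i v x0 t1 ^+ 2 <= mu ^+ 2 / l ^+ 2.
  have e1 : psi ^+ 2 * \sum_(i < n) dx i v x0 t1 ^+ 2 <= mu ^+ 2.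
    rewrite mulr_sumr (eq_bigr (fun i => mu ^+ 2 * cone1 0 1 i x0 ^+ 2)); last first.
      by move=> i _; rewrite -exprMn (HX i).1 exprMn.
    rewrite -mulr_sumr cone1_sqr_sum // -[leRHS]mulr1 ler_wpM2l ?sqr_ge0 //.
    by rewrite gerBl divr_ge0 ?sqr_ge0.
  rewrite ler_pdivlMr ?exprn_gt0 // mulrC; apply: le_trans e1.
  rewrite ler_wpM2r //; first by apply: sumr_ge0 => i _; exact: sqr_ge0.
  by rewrite lerXn2r ?nnegrE // ltW.
have lap : psi * laplacian v x0 t1 <= mu * n%:R + (`|frozen_K1 g| / m) / e * (mu ^+ 2 / l ^+ 2).
  rewrite /laplacian mulr_sumr.
  apply: (@le_trans _ _ (\sum_(i < n) (mu + `|frozen_K1 g| / m / e * dx i v x0 t1 ^+ 2))).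
    apply: ler_sum => i _; apply: le_trans (HX i).2 _; apply: lerD.
      rewrite -[leRHS]mulr1 ler_wpM2l ?(ltW mu0) //.
      by have /andP[_] := cone2_bounds 0 ltr01 x0 i; rewrite invr1.
    have -> : - (fdpsi w y0 * dx i v x0 t1 ^+ 2 / e) = - fdpsi w y0 / e * dx i v x0 t1 ^+ 2.
      by ring.
    apply: ler_wpM2r; first exact: sqr_ge0.
    apply: ler_wpM2r; first by rewrite invr_ge0 ltW.
    apply: le_trans (ler_norm _) _; rewrite normrN; apply: le_trans (fdpsi_bound m0 w y0) _.
    by rewrite ler_wpM2r ?invr_ge0 ?(ltW m0) // ler_norm.
  rewrite big_split /= sumr_const card_ord -[mu *+ n]mulr_natr -mulr_sumr lerD2l.
  by rewrite ler_wpM2l // divr_ge0 ?divr_ge0 // ltW.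
move: Ht; rewrite pde // mulrDr.
have -> : v x0 t1 / e = y0 by rewrite /y0 mulrC.
have := ler_wpM2l (ltW kap0) lap.
have -> : kap * (mu * n%:R + (`|frozen_K1 g| / m) / e * (mu ^+ 2 / l ^+ 2)) =
   mu * (kap * n%:R) + mu * (mu * B).
  by rewrite /B; field; rewrite !gt_eqF.
have : mu * (mu * B) <= mu * B by rewrite ler_wpM2l ?(ltW mu0) // -[leRHS]mul1r ler_wpM2r.
have -> : psi * (kap * laplacian v x0 t1) = kap * (psi * laplacian v x0 t1) by ring.
move: mu2 pr Km; rewrite /c; lra.
Qed.

End Solution.
End UpperBound.

(** * The smooth positive part and the scales of the problem *)

Section Softplus.
Variables (R : realType) (d : R).
Hypothesis d0 : 0 < d.
Implicit Types (r : R).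

(** A smooth version of the positive part, at scale [d]. *)
Definition softplus r := d * ln (1 + expR (r / d)).
Definition logistic r := expR (r / d) / (1 + expR (r / d)).

Let den_gt0 r : 0 < 1 + expR (r / d).
Proof. by have := expR_gt0 (r / d); lra. Qed.

Lemma logistic_bounds r : 0 < logistic r < 1.
Proof.
have h := expR_gt0 (r / d); have h1 := den_gt0 r.
by rewrite divr_gt0 //= ltr_pdivrMr // mul1r; lra.
Qed.

Let dv_exp r : is_derive r 1 (fun s => expR (s / d)) (expR (r / d) / d).
Proof.
have dl : is_derive r 1 (fun s => s / d) d^-1.
  by apply: dv_eq (dvM (dv_id r) (dv_cst d^-1 r)) _; rewrite mul1r mulr0 addr0.
exact: (dv_comp (g := fun s => s / d) (is_derive_expR _) dl).
Qed.

Lemma dv_softplus r : is_derive r 1 softplus (logistic r).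
Proof.
have d1 := dvD (dv_cst 1 r) (dv_exp r).
have d2 := dv_comp (g := fun s => 1 + expR (s / d)) (is_derive1_ln (den_gt0 r)) d1.
apply: dv_eq (dvZ d d2) _; rewrite /logistic; field.
by rewrite !gt_eqF.
Qed.

Lemma dv_logistic r : is_derive r 1 logistic (logistic r * (1 - logistic r) / d).
Proof.
have d1 := dvD (dv_cst 1 r) (dv_exp r).
have dN : 1 + expR (r / d) != 0 by rewrite gt_eqF.
have d2 := dvV (f := fun s => 1 + expR (s / d)) dN d1.
apply: dv_eq (dvM (dv_exp r) d2) _; rewrite /logistic; field.
by rewrite !gt_eqF.
Qed.

Lemma softplus_ge r : r <= softplus r.
Proof.
have E : r = d * ln (expR (r / d)) by rewrite expRK mulrC divfK // gt_eqF.
rewrite {1}E /softplus ler_pM2l // ler_ln ?posrE ?expR_gt0 //.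
by rewrite lerDr.
Qed.

Lemma softplus_le_neg r : r <= 0 -> softplus r <= d.
Proof.
move=> r0; rewrite /softplus -[leRHS]mulr1 ler_pM2l //.
have h : expR (r / d) <= 1.
  by rewrite -[leRHS](@expR0 R) ler_expR pmulr_lle0 // invr_gt0.
apply: le_trans h; apply: le_ln1Dx.
by have := expR_gt0 (r / d); lra.
Qed.

Lemma logistic_le s r : 0 < s -> r <= - s -> logistic r <= d / s.
Proof.
move=> s0 rs.
have h1 : logistic r <= expR (r / d).
  rewrite /logistic ler_pdivrMr // ler_peMr ?expR_ge0 //.
  by have := expR_gt0 (r / d); lra.
apply: (le_trans h1); apply: (@le_trans _ _ (expR (- (s / d)))).
  by rewrite ler_expR -mulNr ler_wpM2r // invr_ge0 ltW.
rewrite expRN -[leRHS]invrK lef_pV2 ?posrE ?expR_gt0 ?invr_gt0 ?divr_gt0 //.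
by rewrite invf_div; apply: le_trans (expR_ge1Dx _); rewrite lerDr.
Qed.

End Softplus.

Section PowerScales.
Variable R : realType.
Implicit Types (a y e : R).

Lemma powR_small a y : 0 < a -> 0 < y ->
  exists2 e1, 0 < e1 & forall e, 0 < e -> e <= e1 -> e `^ a <= y.
Proof.
move=> a0 y0; exists (y `^ a^-1); first exact: powR_gt0.
move=> e e0 ee; apply: (@le_trans _ _ ((y `^ a^-1) `^ a)).
  by apply: ge0_ler_powR; rewrite ?nnegrE ?powR_ge0 // ltW.
by rewrite -powRrM mulVf ?gt_eqF // powRr1 // ltW.
Qed.

(** For [0 < alpha < 1] the diffusion coefficient [e `^ alpha] vanishes while the
    squared slope in microscopic units, of order [e `^ alpha / e], blows up. *)
Lemma diffusive_scales a y K : 0 < a < 1 -> 0 < y -> 0 < K ->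
  exists2 e1, 0 < e1 & forall e, 0 < e -> e <= e1 -> e `^ a <= y /\ K <= e `^ a / e.
Proof.
move=> /andP[a0 a1] y0 K0.
have [e1 e10 H1] := powR_small a0 y0.
have a1' : 0 < 1 - a by rewrite subr_gt0.
have Ki0 : 0 < K^-1 by rewrite invr_gt0.
have [e2 e20 H2] := powR_small a1' Ki0.
exists (Num.min e1 e2); first by rewrite lt_min e10.
move=> e e0; rewrite le_min => /andP[h1 h2]; split; first exact: H1.
have E : e `^ a * e `^ (1 - a) = e.
  rewrite -powRD; first by rewrite addrC subrK powRr1 // ltW.
  by apply/implyP => _; rewrite gt_eqF.
have p0 : 0 < e `^ (1 - a) by exact: powR_gt0.
rewrite ler_pdivlMr // -{1}E.
have := H2 e e0 h2; rewrite -(ler_pM2l K0) mulfV ?gt_eqF // => h3.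
have q0 : 0 <= e `^ a by exact: powR_ge0.
have := ler_wpM2l q0 h3; lra.
Qed.

End PowerScales.

(** * The barrier *)

Section LowerBound.
Variables (R : realType) (n : nat).
Notation V := 'rV[R]_n.
Implicit Types (x : V) (t r z : R).

(** The barrier: a plateau rising at speed [b], surrounded by a cone of slope [L]
    that recedes from the plateau at the extra speed [eta]. *)
Section Barrier.
Variables (x0 : V) (rho d L eta c k0 b : R).
Hypotheses (rho0 : 0 < rho) (d0 : 0 < d) (L0 : 0 <= L) (eta0 : 0 <= eta).

Let q := cone x0 rho.
Let q1 := cone1 x0 rho.
Let q2 := cone2 x0 rho.
Let sg := logistic d.
Let ds r : R := sg r * (1 - sg r) / d.
Let dds r : R := ds r * (1 - 2 * sg r) / d.
Let A (z : R) : R := 1 - rho ^+ 2 / z ^+ 2.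
Let dA (z : R) : R := 2 * rho ^+ 2 / z ^+ 3.
Let ddA (z : R) : R := - (6 * rho ^+ 2 / z ^+ 4).

Definition offset (z t : R) := L * z - eta * t - c.
Definition barrier x t := k0 + b * t - softplus d (offset (q x) t).
Definition barrier_t x t := b + eta * sg (offset (q x) t).
Definition barrier1 (i : 'I_n) x t := - (L * sg (offset (q x) t)) * q1 i x.
Definition barrier2 (i : 'I_n) x t :=
  - (L ^+ 2 * ds (offset (q x) t)) * q1 i x ^+ 2 + - (L * sg (offset (q x) t)) * q2 i x.

(** Squared slope of the barrier and its derivatives. *)
Definition slope2 x t := L ^+ 2 * sg (offset (q x) t) ^+ 2 * A (q x).
Let dslope2 (z t : R) :=
  L ^+ 2 * sg (offset z t) * (2 * ds (offset z t) * L * A z + sg (offset z t) * dA z).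
Let ddslope2 (z t : R) := L ^+ 2 * (2 * ds (offset z t) ^+ 2 * L ^+ 2 * A z
   + 2 * sg (offset z t) * dds (offset z t) * L ^+ 2 * A z
   + 4 * sg (offset z t) * ds (offset z t) * L * dA z + sg (offset z t) ^+ 2 * ddA z).
Definition slope2_t x t :=
  - (2 * L ^+ 2 * eta * sg (offset (q x) t) * ds (offset (q x) t) * A (q x)).
Definition slope21 (i : 'I_n) x t := dslope2 (q x) t * q1 i x.
Definition slope22 (i : 'I_n) x t := ddslope2 (q x) t * q1 i x ^+ 2 + dslope2 (q x) t * q2 i x.

Let dv_ds r : is_derive r 1 ds (dds r).
Proof.
have h := dv_logistic d0 r.
have dN : d != 0 by rewrite gt_eqF.
apply: dv_eq (dvM (dvM h (dvB (dv_cst 1 r) h)) (dv_cst d^-1 r)) _.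
by rewrite /dds /ds /sg; ring.
Qed.

Let dv_offset_z (z t : R) : is_derive z 1 (fun s => offset s t) L.
Proof.
apply: dv_eq (dvB (dvB (dvZ L (dv_id z)) (dv_cst (eta * t) z)) (dv_cst c z)) _.
by rewrite mulr1 !subr0.
Qed.

Let dv_offset_t (z t : R) : is_derive t 1 (offset z) (- eta).
Proof.
apply: dv_eq (dvB (dvB (dv_cst (L * z) t) (dvZ eta (dv_id t))) (dv_cst c t)) _.
by rewrite mulr1 sub0r subr0.
Qed.

Lemma barrier_jet : parabolic_jet barrier barrier_t barrier1 barrier2.
Proof.
move=> t _; split.
  move=> x; have d1 := dv_comp (g := offset (q x)) (dv_softplus d0 _) (dv_offset_t (q x) t).
  apply: dv_eq (dvB (dvD (dv_cst k0 t) (dvZ b (dv_id t))) d1) _.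
  by rewrite /barrier_t /sg; ring.
apply: (C2_axes_radial x0 rho0 (f := fun z => k0 + b * t - softplus d (offset z t))
  (f1 := fun z => - (L * sg (offset z t))) (f2 := fun z => - (L ^+ 2 * ds (offset z t)))).
move=> z _; split.
  have d1 := dv_comp (g := offset ^~ t) (dv_softplus d0 _) (dv_offset_z z t).
  by apply: dv_eq (dvB (dv_cst (k0 + b * t) z) d1) _; rewrite /sg; ring.
have d1 := dv_comp (g := offset ^~ t) (dv_logistic d0 _) (dv_offset_z z t).
by apply: dv_eq (dvN (dvZ L d1)) _; rewrite /ds /sg; ring.
Qed.

Let dv_A (z : R) : 0 < z -> is_derive z 1 A (dA z) /\ is_derive z 1 dA (ddA z).
Proof.
move=> z0; have zN : z != 0 by rewrite gt_eqF.
have z2N : z ^+ 2 != 0 by rewrite expf_neq0.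
have z3N : z ^+ 2 * z != 0 by rewrite mulf_neq0.
have d1 := dv_sqr (dv_id z).
split.
  apply: dv_eq (dvB (dv_cst 1 z) (dvZ (rho ^+ 2) (dvV (f := fun s => s ^+ 2) z2N d1))) _.
  by rewrite /dA; field.
have d2 := dvZ (2 * rho ^+ 2) (dvV (f := fun s => s ^+ 2 * s) z3N (dvM d1 (dv_id z))).
have -> : dA = (fun s => 2 * rho ^+ 2 * (s ^+ 2 * s)^-1).
  by apply/funext => s; rewrite /dA [s ^+ 3]exprSr.
by apply: dv_eq d2 _; rewrite /ddA; field.
Qed.

Lemma slope2_jet : parabolic_jet slope2 slope2_t slope21 slope22.
Proof.
move=> t _; split.
  move=> x; have d1 := dv_comp (g := offset (q x)) (dv_logistic d0 _) (dv_offset_t (q x) t).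
  apply: dv_eq (dvM (dvZ (L ^+ 2) (dv_sqr d1)) (dv_cst (A (q x)) t)) _.
  by rewrite /slope2_t /ds /sg; ring.
apply: (C2_axes_radial x0 rho0 (f := fun z => L ^+ 2 * sg (offset z t) ^+ 2 * A z)
  (f1 := dslope2 ^~ t) (f2 := ddslope2 ^~ t)).
move=> z z0; have [a1 a2] := dv_A z0.
have d1 := dv_comp (g := offset ^~ t) (dv_logistic d0 _) (dv_offset_z z t).
have d2 := dv_comp (g := offset ^~ t) (dv_ds _) (dv_offset_z z t).
split.
  apply: dv_eq (dvM (dvZ (L ^+ 2) (dv_sqr d1)) a1) _.
  by rewrite /dslope2 /ds /sg; ring.
have d3 := dvM (dvZ (L ^+ 2) d1) (dvD (dvM (dvM (dvZ 2 d2) (dv_cst L z)) a1) (dvM d1 a2)).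
apply: dv_eq d3 _.
by rewrite /ddslope2 /ds -/sg -/(ds _); ring.
Qed.

Let A_bounds x : 0 <= A (q x) <= 1.
Proof.
have q0 := cone_gt0 x0 rho0 x; have qr := cone_ge_rho x0 rho0 x.
have q20 : 0 < q x ^+ 2 by rewrite exprn_gt0.
apply/andP; split; last by rewrite gerBl divr_ge0 ?sqr_ge0 // ltW.
by rewrite subr_ge0 ler_pdivrMr // mul1r lerXn2r ?nnegrE // ltW.
Qed.

Let sg_bounds r : 0 < sg r < 1. Proof. exact: logistic_bounds. Qed.

Let ds_bounds r : 0 <= ds r <= d^-1.
Proof.
have /andP[s0 s1] := sg_bounds r.
have h0 : 0 <= sg r * (1 - sg r) by rewrite mulr_ge0; lra.
rewrite /ds; apply/andP; split; first by rewrite divr_ge0 // ltW.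
rewrite -[leRHS]mul1r ler_wpM2r ?invr_ge0 ?(ltW d0) // -[leRHS]mulr1.
by rewrite ler_pM //; lra.
Qed.

Lemma slope2_sum x t : slope2 x t = \sum_(i < n) barrier1 i x t ^+ 2.
Proof.
under eq_bigr do rewrite exprMn.
by rewrite -mulr_sumr cone1_sqr_sum // /slope2 /A /q; ring.
Qed.

Lemma slope2_ge0 x t : 0 <= slope2 x t.
Proof. by rewrite slope2_sum; apply: sumr_ge0 => i _; exact: sqr_ge0. Qed.

Let G := 2 * L / d + 2 / rho.
Let G0 : 0 <= G.
Proof. by rewrite addr_ge0 // divr_ge0 ?mulr_ge0 // ltW. Qed.

Let dA_bounds x : 0 <= dA (q x) <= 2 / rho.
Proof.
have q0 := cone_gt0 x0 rho0 x; have qr := cone_ge_rho x0 rho0 x.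
rewrite /dA; apply/andP; split.
  by rewrite divr_ge0 ?mulr_ge0 ?exprn_ge0 // ltW.
have -> : 2 / rho = 2 * rho ^+ 2 / rho ^+ 3 by field; rewrite gt_eqF.
apply: ler_wpM2l; first by rewrite mulr_ge0 // sqr_ge0.
by rewrite lef_pV2 ?posrE ?exprn_gt0 // lerXn2r ?nnegrE // ltW.
Qed.

Let ddA_bound x : `|ddA (q x)| <= 6 / rho ^+ 2.
Proof.
have q0 := cone_gt0 x0 rho0 x; have qr := cone_ge_rho x0 rho0 x.
rewrite /ddA normrN ger0_norm; last by rewrite divr_ge0 ?mulr_ge0 ?exprn_ge0 // ltW.
have -> : 6 / rho ^+ 2 = 6 * rho ^+ 2 / rho ^+ 4 by field; rewrite gt_eqF.
apply: ler_wpM2l; first by rewrite mulr_ge0 // sqr_ge0.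
by rewrite lef_pV2 ?posrE ?exprn_gt0 // lerXn2r ?nnegrE // ltW.
Qed.

(* The bounds below are stated for bare numbers: [s], [e] stand for the values
   of [sg] and its derivative, [a], [p], [p2] for those of [A], [dA], [ddA]. *)
Let num_dslope (s e a p : R) : 0 < s < 1 -> 0 <= e <= d^-1 -> 0 <= a <= 1 ->
  0 <= p <= 2 / rho -> 0 <= 2 * e * L * a + s * p <= G.
Proof.
move=> /andP[s0 s1] /andP[e0 e1] /andP[a0 a1] /andP[p0 p1].
have h1 : 0 <= 2 * e * L by rewrite !mulr_ge0.
apply/andP; split; first by rewrite addr_ge0 // mulr_ge0 // ltW.
apply: lerD; last by rewrite -[leRHS]mul1r ler_pM // ltW.
have -> : 2 * L / d = 2 * d^-1 * L * 1 by ring.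
by apply: ler_pM => //; rewrite ler_wpM2r // ler_wpM2l.
Qed.

Let num_sea (s e a : R) : 0 < s < 1 -> 0 <= e <= d^-1 -> 0 <= a <= 1 ->
  0 <= s * e * a <= d^-1.
Proof.
move=> /andP[s0 s1] /andP[e0 e1] /andP[a0 a1].
have h : 0 <= s * e by rewrite mulr_ge0 // ltW.
apply/andP; split; first exact: mulr_ge0.
have -> : d^-1 = 1 * d^-1 * 1 by ring.
by rewrite ler_pM // ler_pM // ltW.
Qed.

Let num_ddslope (s e a p p2 : R) : 0 < s < 1 -> 0 <= e <= d^-1 -> 0 <= a <= 1 ->
  0 <= p <= 2 / rho -> `|p2| <= 6 / rho ^+ 2 ->
  `|2 * e ^+ 2 * L ^+ 2 * a + 2 * s * (e * (1 - 2 * s) / d) * L ^+ 2 * a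
    + 4 * s * e * L * p + s ^+ 2 * p2| <=
  4 * L ^+ 2 / d ^+ 2 + 8 * L / (d * rho) + 6 / rho ^+ 2.
Proof.
move=> hs he ha /andP[p0 p1] hp2; have /andP[u0 u1] := num_sea hs he ha.
case/andP: hs => s0 s1; case/andP: he => e0 e1; case/andP: ha => a0 a1.
have L20 : 0 <= L ^+ 2 by exact: sqr_ge0.
have di0 : 0 <= d^-1 by rewrite invr_ge0 ltW.
have e20 : 0 <= e ^+ 2 by exact: sqr_ge0.
have dE : 2 * L ^+ 2 / d ^+ 2 = 2 * L ^+ 2 * (d^-1 ^+ 2) by rewrite exprVn.
have t1 : `|2 * e ^+ 2 * L ^+ 2 * a| <= 2 * L ^+ 2 / d ^+ 2.
  have -> : 2 * e ^+ 2 * L ^+ 2 * a = 2 * L ^+ 2 * (e ^+ 2 * a) by ring.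
  rewrite ger0_norm; last by rewrite !mulr_ge0.
  rewrite dE ler_wpM2l ?mulr_ge0 // -[leRHS]mulr1 ler_pM //.
  by rewrite lerXn2r ?nnegrE.
have t2 : `|2 * s * (e * (1 - 2 * s) / d) * L ^+ 2 * a| <= 2 * L ^+ 2 / d ^+ 2.
  have -> : 2 * s * (e * (1 - 2 * s) / d) * L ^+ 2 * a =
     2 * L ^+ 2 * ((s * e * a) * d^-1 * (1 - 2 * s)) by ring.
  have L2 : 0 <= 2 * L ^+ 2 by rewrite mulr_ge0.
  rewrite normrM (ger0_norm L2) dE ler_wpM2l // normrM.
  have ud : 0 <= s * e * a * d^-1 by rewrite mulr_ge0.
  rewrite (ger0_norm ud) expr2 -[leRHS]mulr1; apply: ler_pM => //.
    by rewrite ler_wpM2r.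
  by rewrite ler_norml; apply/andP; split; lra.
have t3 : `|4 * s * e * L * p| <= 8 * L / (d * rho).
  have h : 0 <= s * e by rewrite mulr_ge0 // ltW.
  have h' : s * e <= 1 * d^-1 by rewrite ler_pM // ltW.
  have -> : 4 * s * e * L * p = 4 * L * ((s * e) * p) by ring.
  have L4 : 0 <= 4 * L by rewrite mulr_ge0.
  rewrite ger0_norm; last by rewrite mulr_ge0 // mulr_ge0.
  have -> : 8 * L / (d * rho) = 4 * L * (1 * d^-1 * (2 / rho)).
    by field; rewrite !gt_eqF.
  by rewrite ler_wpM2l // ler_pM.
have t4 : `|s ^+ 2 * p2| <= 6 / rho ^+ 2.
  rewrite normrM -[leRHS]mul1r; apply: ler_pM => //.
  by rewrite ger0_norm ?sqr_ge0 // expr_le1 // ltW.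
have -> : 4 * L ^+ 2 / d ^+ 2 = 2 * L ^+ 2 / d ^+ 2 + 2 * L ^+ 2 / d ^+ 2 by ring.
apply: le_trans (ler_normD _ _) _; apply: lerD => //.
apply: le_trans (ler_normD _ _) _; apply: lerD => //.
by apply: le_trans (ler_normD _ _) _; apply: lerD.
Qed.

Let dslope2E x t : exists2 g, 0 <= g <= G & dslope2 (q x) t = L ^+ 2 * sg (offset (q x) t) * g.
Proof.
exists (2 * ds (offset (q x) t) * L * A (q x) + sg (offset (q x) t) * dA (q x)) => //.
exact: num_dslope (sg_bounds _) (ds_bounds _) (A_bounds x) (dA_bounds x).
Qed.

Let q1_sum x : \sum_(i < n) q1 i x ^+ 2 = A (q x).
Proof. exact: cone1_sqr_sum. Qed.

Let q2_sum x : 0 <= \sum_(i < n) q2 i x <= n%:R / rho.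
Proof.
apply/andP; split; first by apply: sumr_ge0 => i _; case/andP: (cone2_bounds x0 rho0 x i).
apply: (@le_trans _ _ (\sum_(i < n) rho^-1)).
  by apply: ler_sum => i _; case/andP: (cone2_bounds x0 rho0 x i).
by rewrite sumr_const card_ord -[leLHS]mulr_natl.
Qed.

(** Sum of the bounds of [barrier_bounds]. *)
Definition barrier_const := L ^+ 2 * G ^+ 2
  + (L ^+ 2 * (4 * L ^+ 2 / d ^+ 2 + 8 * L / (d * rho) + 6 / rho ^+ 2)
     + L ^+ 2 * G * (n%:R / rho))
  + 2 * L ^+ 2 * eta / d + (L ^+ 2 / d + L * (n%:R / rho)).

Let c1 : 0 <= L ^+ 2 * G ^+ 2. Proof. by rewrite mulr_ge0 ?sqr_ge0. Qed.
Let c2 : 0 <= L ^+ 2 * (4 * L ^+ 2 / d ^+ 2 + 8 * L / (d * rho) + 6 / rho ^+ 2)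
     + L ^+ 2 * G * (n%:R / rho).
Proof.
have h1 : 0 <= 4 * L ^+ 2 / d ^+ 2.
  by apply: divr_ge0; [rewrite mulr_ge0 ?sqr_ge0|exact: sqr_ge0].
have h2 : 0 <= 8 * L / (d * rho) by apply: divr_ge0; rewrite mulr_ge0 // ltW.
have h3 : 0 <= 6 / rho ^+ 2 by rewrite divr_ge0 ?sqr_ge0.
have h4 : 0 <= n%:R / rho by rewrite divr_ge0 // ltW.
have L20 : 0 <= L ^+ 2 by exact: sqr_ge0.
apply: addr_ge0; first exact: mulr_ge0 L20 (addr_ge0 (addr_ge0 h1 h2) h3).
exact: mulr_ge0 (mulr_ge0 L20 G0) h4.
Qed.
Let c3 : 0 <= 2 * L ^+ 2 * eta / d.
Proof. by apply: divr_ge0; [rewrite !mulr_ge0 ?sqr_ge0|exact: ltW]. Qed.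
Let c4 : 0 <= L ^+ 2 / d + L * (n%:R / rho).
Proof.
have h1 : 0 <= L ^+ 2 / d by rewrite divr_ge0 ?sqr_ge0 // ltW.
by rewrite addr_ge0 // mulr_ge0 // divr_ge0 // ltW.
Qed.

Lemma barrier_const_ge0 : 0 <= barrier_const.
Proof. by rewrite /barrier_const; have := c1; have := c2; have := c3; have := c4; lra. Qed.

Lemma barrier_bounds x t :
  [/\ \sum_(i < n) slope21 i x t ^+ 2 <= barrier_const * slope2 x t,
     `|\sum_(i < n) slope22 i x t| <= barrier_const,
     `|slope2_t x t| <= barrier_const & `|\sum_(i < n) barrier2 i x t| <= barrier_const].
Proof.
have /andP[a0 a1] := A_bounds x; set r := offset (q x) t.
have /andP[s0 s1] := sg_bounds r.
have /andP[e0 e1] := ds_bounds r; have /andP[b0 b1] := dA_bounds x.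
have [g /andP[g0 gG] gE] := dslope2E x t; rewrite -/r in gE.
have /andP[Q0 Q1] := q2_sum x.
have L20 : 0 <= L ^+ 2 by exact: sqr_ge0.
have di0 : 0 <= d^-1 by rewrite invr_ge0 ltW.
split.
- under eq_bigr do rewrite exprMn.
  rewrite -mulr_sumr q1_sum gE.
  have -> : (L ^+ 2 * sg r * g) ^+ 2 * A (q x) = (L ^+ 2 * g ^+ 2) * slope2 x t.
    by rewrite /slope2 -/r; ring.
  rewrite ler_wpM2r ?slope2_ge0 //; apply: (@le_trans _ _ (L ^+ 2 * G ^+ 2)).
    by rewrite ler_wpM2l // lerXn2r ?nnegrE.
  by rewrite /barrier_const; have := c2; have := c3; have := c4; lra.
- rewrite big_split /= -!mulr_sumr q1_sum.
  apply: (@le_trans _ _ (L ^+ 2 * (4 * L ^+ 2 / d ^+ 2 + 8 * L / (d * rho) + 6 / rho ^+ 2)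
     + L ^+ 2 * G * (n%:R / rho))); last first.
    by rewrite /barrier_const; have := c1; have := c3; have := c4; lra.
  apply: le_trans (ler_normD _ _) _; apply: lerD.
    rewrite normrM [`|A (q x)|]ger0_norm // -[leRHS]mulr1; apply: ler_pM => //.
    rewrite /ddslope2 -/r normrM (ger0_norm L20); apply: ler_wpM2l => //.
    exact: num_ddslope (sg_bounds r) (ds_bounds r) (A_bounds x) (dA_bounds x) (ddA_bound x).
  rewrite gE normrM (ger0_norm Q0).
  have h0 : 0 <= L ^+ 2 * g by rewrite mulr_ge0.
  have -> : L ^+ 2 * sg r * g = sg r * (L ^+ 2 * g) by ring.
  rewrite normrM (gtr0_norm s0) (ger0_norm h0).
  apply: ler_pM => //; first by rewrite mulr_ge0 // ltW.
  by rewrite -[leRHS]mul1r ler_pM ?(ltW s0) ?(ltW s1) // ler_wpM2l.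
- have /andP[u0 u1] := num_sea (sg_bounds r) (ds_bounds r) (A_bounds x).
  rewrite /slope2_t -/r normrN.
  have -> : 2 * L ^+ 2 * eta * sg r * ds r * A (q x) =
    2 * L ^+ 2 * eta * (sg r * ds r * A (q x)) by ring.
  have h0 : 0 <= 2 * L ^+ 2 * eta by rewrite !mulr_ge0.
  rewrite normrM (ger0_norm h0) (ger0_norm u0).
  apply: (@le_trans _ _ (2 * L ^+ 2 * eta / d)); first exact: ler_wpM2l.
  by rewrite /barrier_const; have := c1; have := c2; have := c4; lra.
- rewrite big_split /= -!mulr_sumr q1_sum.
  apply: (@le_trans _ _ (L ^+ 2 / d + L * (n%:R / rho))); last first.
    by rewrite /barrier_const; have := c1; have := c2; have := c3; lra.
  apply: le_trans (ler_normD _ _) _; rewrite !mulNr !normrN; apply: lerD.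
    rewrite -mulrA normrM (ger0_norm L20); apply: ler_wpM2l => //.
    rewrite normrM (ger0_norm e0) (ger0_norm a0) -[leRHS]mulr1.
    exact: ler_pM.
  rewrite -mulrA normrM (ger0_norm L0); apply: ler_wpM2l => //.
  rewrite normrM (gtr0_norm s0) (ger0_norm Q0) -[leRHS]mul1r.
  by apply: ler_pM => //; exact: ltW.
Qed.

Let offset_continuous (z t : R) : {for (z, t), continuous (fun p => offset p.1 p.2)}.
Proof.
have f1 : {for (z, t), continuous (fun p : R * R => p.1)} by exact: cvg_fst.
have f2 : {for (z, t), continuous (fun p : R * R => p.2)} by exact: cvg_snd.
apply: continuousB; last exact: cst_continuous.
by apply: continuousB; (apply: continuousM; first exact: cst_continuous).
Qed.

Lemma barrier_continuous : {within @strip R n, continuous (fun p : V * R => barrier p.1 p.2)}.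
Proof.
apply: (@strip_continuous_cone R n x0 rho
  (fun z t => k0 + b * t - softplus d (offset z t)) rho0) => z t _.
have f2 : {for (z, t), continuous (fun p : R * R => p.2)} by exact: cvg_snd.
apply: continuousB.
  apply: continuousD; first exact: cst_continuous.
  by apply: continuousM; [exact: cst_continuous|exact: f2].
have h := dv_continuous (dv_softplus d0 (offset z t)).
exact: (cvg_comp (fun p : R * R => offset p.1 p.2) (softplus d) (offset_continuous (z := z) (t := t)) h).
Qed.

Lemma slope2_continuous : {within @strip R n, continuous (fun p : V * R => slope2 p.1 p.2)}.
Proof.
apply: (@strip_continuous_cone R n x0 rho
  (fun z t => L ^+ 2 * sg (offset z t) ^+ 2 * A z) rho0) => z t z0.
have f1 : {for (z, t), continuous (fun p : R * R => p.1)} by exact: cvg_fst.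
apply: continuousM.
  apply: continuousM; first exact: cst_continuous.
  have d1 := dv_sqr (dv_logistic d0 (offset z t)).
  exact: (cvg_comp (fun p : R * R => offset p.1 p.2) (fun r => sg r ^+ 2) (offset_continuous (z := z) (t := t)) (dv_continuous d1)).
exact: (cvg_comp _ _ f1 (dv_continuous (dv_A z0).1)).
Qed.

End Barrier.

End LowerBound.

(** * Spreading of a plateau *)

Section Plateau.
Variables (R : realType) (n : nat) (g : reaction R).
Notation V := 'rV[R]_n.
Hypothesis gap : hmean g < amean g.

(** The barrier lies below the solution; at distances from [x0] that the cone has
    covered at the speed gained by steep slopes, it is the plateau. *)
Theorem solution_ge_plateau alpha (u0 : V -> R) (L0 : R) (x0 : V) (cc dl : R) :
  0 < alpha < 1 -> 0 <= L0 -> (forall x y, `|u0 x - u0 y| <= L0 * `|x - y|) ->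
  0 < cc -> 0 < dl <= 1 ->
  exists C e1, 0 < e1 /\ forall e v, 0 < e -> e <= e1 ->
    is_solution g alpha u0 e v -> forall x t, 0 <= t ->
    (L0 + 1) * (1 + n%:R * `|x - x0|) <= (amean g - hmean g) / 2 * t ->
    u0 x0 - cc - dl + hmean g * (1 - 2 * dl) * t - C * e <= v x t.
Proof.
move=> a01 L00 uL cc0 /andP[dl0 dl1].
set c0 := hmean g; set c1 := amean g.
have c00 : 0 < c0 by exact: hmean_gt0.
pose L := L0 + 1; pose eta := (c1 - c0) / 2.
have L1 : 0 < L by rewrite ltr_wpDl.
have eta0 : 0 < eta by rewrite divr_gt0 // subr_gt0.
pose rho := Num.min 1 (cc / (4 * L)).
have rho0 : 0 < rho by rewrite lt_min ltr01 divr_gt0 // mulr_gt0.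
have rho1 : rho <= 1 by rewrite ge_min lexx.
have rhoc : 4 * (L * rho) <= cc.
  have h : rho <= cc / (4 * L) by rewrite ge_min lexx orbT.
  by move: h; rewrite ler_pdivlMr ?mulr_gt0 //; lra.
pose d := Num.min dl (dl * c0 * cc / (2 * eta)).
have d0 : 0 < d.
  by rewrite lt_min dl0 /=; apply: divr_gt0; [exact: mulr_gt0 (mulr_gt0 dl0 c00) cc0|rewrite mulr_gt0].
have ddl : d <= dl by rewrite ge_min lexx.
have dsmall : eta * (d / (cc / 2)) <= dl * c0.
  have h : d <= dl * c0 * cc / (2 * eta) by rewrite ge_min lexx orbT.
  have -> : eta * (d / (cc / 2)) = d * (2 * eta / cc) by field; rewrite gt_eqF.
  apply: (@le_trans _ _ (dl * c0 * cc / (2 * eta) * (2 * eta / cc))).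
    by apply: ler_wpM2r => //; apply: divr_ge0; [rewrite mulr_ge0 // ltW|exact: ltW].
  rewrite le_eqVlt; apply/orP; left; apply/eqP; field.
  by rewrite !gt_eqF.
have dl2 : 0 < dl / 2 <= 1 by apply/andP; split; lra.
have [W [C [K [l [sW tW [K0 l0] low high]]]]] := modulated_corrector gap dl2.
pose CE := barrier_const n rho d L eta.
have CE0 : 0 <= CE by apply: barrier_const_ge0 => //; exact: ltW.
pose Kc := contact_const C l CE.
pose y0 := Num.min 1 (dl * c0 / (4 * (`|Kc| + 1))).
have Kc1 : 0 < `|Kc| + 1 by rewrite ltr_wpDl.
have y00 : 0 < y0.
  by rewrite lt_min ltr01 /=; apply: divr_gt0; rewrite mulr_gt0.
(* the squared slope of the barrier where the cone still feels its speed eta *)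
pose sstar := dl * c0 / eta.
have sstar0 : 0 < sstar by rewrite divr_gt0 // mulr_gt0.
pose Estar := L ^+ 2 * sstar ^+ 2 * (3 / 4).
have Estar0 : 0 < Estar.
  by apply: mulr_gt0; [rewrite mulr_gt0 // exprn_gt0|rewrite divr_gt0].
have [e1 e10 He] := diffusive_scales a01 y00 (divr_gt0 K0 Estar0).
exists (2 * C), e1; split=> // e v e0 ee1 sol x t t0 far.
have [kapy hK] := He e e0 ee1.
set kap := e `^ alpha in kapy hK.
have kap0 : 0 < kap by exact: powR_gt0.
have kap1 : kap <= 1 by apply: le_trans kapy _; rewrite ge_min lexx.
have kapK : kap * Kc <= dl * c0 / 4.
  apply: (@le_trans _ _ (kap * (`|Kc| + 1))).
    by rewrite ler_wpM2l ?(ltW kap0) // (le_trans (ler_norm Kc)) // lerDl.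
  have h : kap <= dl * c0 / (4 * (`|Kc| + 1)).
    by apply: le_trans kapy _; rewrite ge_min lexx orbT.
  apply: (@le_trans _ _ (dl * c0 / (4 * (`|Kc| + 1)) * (`|Kc| + 1))).
    by rewrite ler_wpM2r // ltW.
  rewrite le_eqVlt; apply/orP; left; apply/eqP; field.
  by rewrite gt_eqF.
pose b := c0 * (1 - 2 * dl).
pose k0 := u0 x0 - cc - C * e.
have L0' := ltW L1; have eta0' := ltW eta0.
pose phi := barrier x0 rho d L eta cc k0 b.
have dc0 : 0 < dl * c0 by rewrite mulr_gt0.
have cone_low y : u0 x0 - L0 * cone x0 rho y <= u0 y.
  have h1 := uL x0 y; have h2 := dist_le_cone x0 rho0 y.
  have h3 := ler_wpM2l L00 h2; have h4 := ler_norm (u0 x0 - u0 y).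
  by rewrite distrC in h3; lra.
suff main : phi x t <= v x t + C * e.
  move: main; rewrite /phi /barrier.
  have h : softplus d (offset L eta cc (cone x0 rho x) t) <= d.
    apply: softplus_le_neg => //; rewrite /offset.
    have h1 := cone_le_norm x0 rho0 x.
    have h2 : L * cone x0 rho x <= L * (1 + n%:R * `|x - x0|).
      by rewrite ler_wpM2l //; lra.
    by rewrite /L in h2; rewrite /eta /L; lra.
  rewrite /k0 -/b; lra.
pose E := slope2 x0 rho d L eta cc.
pose Et := barrier_t x0 rho d L eta cc b.
have E0 y s : 0 <= E y s by exact: (slope2_ge0 x0 d L eta cc rho0 y s).
have speed y s z : 0 < s -> exists2 sp,
    sp * my W z (kap / e * E y s) ^+ 2 + kap / e * E y s * myy W z (kap / e * E y s)
      <= g z * my W z (kap / e * E y s) ^+ 3 & Et y s < sp - kap * Kc.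
  move=> s0; set q := cone x0 rho y.
  have h0 : 0 <= kap / e by rewrite divr_ge0 // ltW.
  have hE0 : 0 <= kap / e * E y s by rewrite mulr_ge0.
  rewrite /Et /barrier_t -/q.
  have /andP[sg0 sg1] := logistic_bounds d (offset L eta cc q s).
  set sg := logistic d (offset L eta cc q s) in sg0 sg1 *.
  have [small|large] := leP (eta * sg) (dl * c0).
    exists (c0 * (1 - dl / 2)); first by case: (low z _ hE0).
    by rewrite /b; lra.
  exists ((c0 + c1) / 2).
    apply: high; have [h1 h2] : sstar <= sg /\ 3 / 4 <= 1 - rho ^+ 2 / q ^+ 2.
      split; first by rewrite /sstar ler_pdivrMr // [leRHS]mulrC ltW.
      have Lq : cc / 2 < L * q.
        rewrite ltNge; apply/negP => Lq; move: large; apply/negP; rewrite -leNgt.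
        apply: le_trans dsmall; rewrite ler_wpM2l //.
        apply: logistic_le => //; first by rewrite divr_gt0.
        by rewrite /offset; have := mulr_ge0 eta0' (ltW s0); lra.
      have q2 : 2 * rho <= q.
        rewrite -(ler_pM2l L1); lra.
      have q0 : 0 < q by exact: cone_gt0.
      have : rho ^+ 2 / q ^+ 2 <= 4^-1.
        rewrite ler_pdivrMr ?exprn_gt0 //.
        have : (2 * rho) ^+ 2 <= q ^+ 2 by rewrite lerXn2r ?nnegrE ?mulr_ge0 // ltW.
        have -> : (2 * rho) ^+ 2 = 4 * rho ^+ 2 by ring.
        lra.
      lra.
    have EE : Estar <= E y s.
      rewrite /E /slope2 /Estar -/q -/sg; apply: ler_pM => //.
        by rewrite mulr_ge0 ?sqr_ge0.
      by rewrite ler_wpM2l ?sqr_ge0 // lerXn2r ?nnegrE // ltW.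
    move: hK; rewrite ler_pdivrMr // => hK.
    by apply: le_trans hK _; rewrite ler_wpM2l.
  have : eta * sg <= eta * 1 by rewrite ler_wpM2l // ltW.
  by rewrite mulr1 /b /eta; lra.
have init y : phi y 0 + C * e <= u0 y.
  rewrite /phi /barrier /k0 mulr0 addr0.
  have h1 := softplus_ge d0 (offset L eta cc (cone x0 rho y) 0).
  have h2 := cone_low y; have h3 := cone_gt0 x0 rho0 y.
  move: h1; rewrite /offset mulr0 subr0 /L => h1; lra.
have grow T : exists B, forall y s, 0 <= s <= T -> `|y| - B <= v y s - phi y s.
  pose B0 := kap * L0 * n%:R / rho.
  have B00 : 0 <= B0 by apply: divr_ge0; rewrite ?mulr_ge0 // ltW.
  exists (`|x0| + `|k0| + `|u0 x0| + (c0 + eta + B0) * `|T| + cc) => y s /andP[s0 sT].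
  have h1 := solution_ge_cone e0 sol rho0 L00 cone_low y s0; rewrite -/kap -/B0 in h1.
  have h2 := softplus_ge d0 (offset L eta cc (cone x0 rho y) s).
  have h3 := dist_le_cone x0 rho0 y.
  have h4 : `|y| <= `|y - x0| + `|x0| by rewrite -{1}(subrK x0 y) ler_normD.
  have h5 := ler_norm k0; have h6 := lerNnormlW (lexx `|u0 x0|).
  have h7 : s <= `|T| by apply: le_trans sT (ler_norm T).
  have h8 : (c0 + eta + B0) * s <= (c0 + eta + B0) * `|T|.
    by rewrite ler_wpM2l // !addr_ge0 // ltW.
  have h9 : b * s <= c0 * s.
    by rewrite ler_wpM2r // /b -[leRHS]mulr1 ler_wpM2l ?(ltW c00) //; lra.
  move: h2; rewrite /phi /barrier /offset /L => h2; lra.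
have bnd y s (_ : 0 < s) := barrier_bounds x0 cc rho0 d0 L0' eta0' y s.
have sum y s (_ : 0 < s) := slope2_sum x0 d L eta cc rho0 y s.
have E0' y s (_ : 0 <= s) := E0 y s.
have low' y M (M0 : 0 <= M) := (low y M M0).1.
have jphi := barrier_jet x0 L eta cc k0 b rho0 d0.
have jE := slope2_jet x0 L eta cc rho0 d0.
have cphi : {within @strip R n, continuous (fun p : V * R => phi p.1 p.2)}.
  exact: barrier_continuous.
have cE : {within @strip R n, continuous (fun p : V * R => E p.1 p.2)}.
  exact: slope2_continuous.
exact: (barrier_comparison e0 kap1 sol sW tW l0 CE0 jphi jE cphi cE E0' sum bnd low' speed
  init grow).
Qed.

End Plateau.

(** * Passage to the limit *)

Section Limit.
Variables (R : realType) (n : nat).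
Notation V := 'rV[R]_n.
Implicit Types (x : V) (t S : R).

Lemma limit_pointwise (ue : R -> V -> R -> R) u : is_limit ue u ->
  exists2 eps_ : nat -> R, (forall k, 0 < eps_ k) /\ eps_ @ \oo --> (0 : R) &
    forall x t, 0 <= t -> ue (eps_ k) x t @[k --> \oo] --> u x t.
Proof.
move=> [eps_ [e0 ec cv]]; exists eps_; first by [].
move=> x t t0; have := cv _ (@compact_set1 _ (x, t)).
rewrite uniform_set1; apply.
by move=> z ->.
Qed.

Variables (g : reaction R) (alpha : R) (u0 : V -> R).
Variables (ue : R -> V -> R -> R) (u : V -> R -> R).
Hypothesis ue_sol : forall e, 0 < e -> is_solution g alpha u0 e (ue e).
Hypothesis u_lim : is_limit ue u.

Lemma limit_le_flat S x t : (forall y, u0 y <= S) -> 0 <= t ->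
  u x t <= S + hmean g * t.
Proof.
move=> uS t0; have [eps_ [e0 ec] cv] := limit_pointwise u_lim.
have H d : 0 < d -> u x t <= S + (hmean g + d) * t.
  move=> d0; have c2 : S + 2 * eps_ k + (hmean g + d) * t @[k --> \oo] -->
      S + 2 * 0 + (hmean g + d) * t.
    apply: cvgD; last exact: cvg_cst.
    by apply: cvgD; [exact: cvg_cst|apply: cvgM; [exact: cvg_cst|exact: ec]].
  rewrite mulr0 addr0 in c2; apply: ler_cvg_to (cv x t t0) c2 _.
  by near=> k; apply: (solution_le_flat (e0 k) (ue_sol (e0 k))).
apply/ler_addgt0Pr => d d0.
have t1 : 0 < t + 1 by lra.
have := H (d / (t + 1)) (divr_gt0 d0 t1).
have : d / (t + 1) * t <= d.
  by rewrite mulrAC ler_pdivrMr // ler_wpM2l ?(ltW d0) // lerDl.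
lra.
Unshelve. all: by end_near. Qed.

Hypothesis alpha01 : 0 < alpha < 1.
Hypothesis gap : hmean g < amean g.

(** The scale tends to 0 before the loss [d] of speed does, at a fixed time. *)
Lemma limit_ge_plateau L x0 cc x t : 0 <= L ->
  (forall y z, `|u0 y - u0 z| <= L * `|y - z|) -> 0 < cc -> 0 <= t ->
  (L + 1) * (1 + n%:R * `|x - x0|) <= (amean g - hmean g) / 2 * t ->
  u0 x0 - cc + hmean g * t <= u x t.
Proof.
move=> L0 uL c0 t0 far; have [eps_ [e0 ec] cv] := limit_pointwise u_lim.
have H d : 0 < d <= 1 -> u0 x0 - cc - d + hmean g * (1 - 2 * d) * t <= u x t.
  move=> d01; have [C [e1 [e10 Hv]]] := solution_ge_plateau gap x0 alpha01 L0 uL c0 d01.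
  set a := _ + _.
  have c2 : a - C * eps_ k @[k --> \oo] --> a - C * 0.
    by apply: cvgB; [exact: cvg_cst|apply: cvgM; [exact: cvg_cst|exact: ec]].
  rewrite mulr0 subr0 in c2; apply: ler_cvg_to c2 (cv x t t0) _.
  near=> k; apply: Hv => //; [|exact: ue_sol].
  near: k; move/cvgrPdist_le : ec => /(_ e1 e10); apply: filterS => k.
  by rewrite sub0r normrN gtr0_norm.
have h0 := hmean_gt0 g.
apply/ler_addgt0Pr => d d0; pose d' := Num.min 1 (d / (1 + 2 * hmean g * t)).
have D0 : 0 < 1 + 2 * hmean g * t by have := mulr_ge0 (ltW h0) t0; lra.
have d'0 : 0 < d' <= 1 by rewrite lt_min ltr01 divr_gt0 //= ge_min lexx.
have := H d' d'0.
have : d' * (1 + 2 * hmean g * t) <= d.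
  by rewrite -ler_pdivlMr // ge_min lexx orbT.
lra.
Unshelve. all: by end_near. Qed.

End Limit.

Lemma lipschitz_const (R : realType) (V : normedModType R) (f : V -> R) :
  [lipschitz f x | x in setT] ->
  exists2 L, 0 < L & forall x y, `|f x - f y| <= L * `|x - y|.
Proof.
by move=> /pinfty_ex_gt0[L L0 H]; exists L => // x y; exact: (H (x, y)).
Qed.

Lemma reaction_of (R : realType) (g : R -> R) : [lipschitz g y | y in setT] ->
  periodic1 g -> (forall y, 0 < g y) -> exists gr : reaction R, rate gr = g.
Proof.
move=> /lipschitz_const[L L0 gL] gp g0.
have gc := lipschitz_continuous gL.
have [a ga] := periodic1_min gc gp; have [b gb] := periodic1_max gc gp.
by exists (Reaction (ltW L0) gL gp (g0 a) ga gb).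
Qed.

(* Non-constancy of g is implicit in the source: for g = 1 one has
   u x t = u0 x + t and the conclusion fails for every non-constant u0. *)
Theorem corollary5p9 (R : realType) (n : nat) (g : R -> R) (alpha : R)
    (u0 : 'rV[R]_n -> R) (ue : R -> 'rV[R]_n -> R -> R)
    (u : 'rV[R]_n -> R -> R)
    (g_lip : [lipschitz g y | y in setT])
    (g_per : forall (y : R) (m : int), g (y + m%:~R) = g y)
    (g_gt0 : forall y : R, 0 < g y)
    (g_nonconst : exists y z : R, g y <> g z)
    (alpha01 : 0 < alpha < 1)
    (u0_lip : [lipschitz u0 x | x in setT])
    (u0_bnd : has_ubound (range u0))
    (ue_sol : forall e : R, 0 < e -> is_solution g alpha u0 e (ue e))
    (u_lim : is_limit ue u) :
  {family compact,
    (fun (t : R) (x : 'rV[R]_n) =>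
       u x t - sup (range u0)
       - t * (\int[lebesgue_measure]_(s in `[0, 1]) (g s)^-1)^-1) @ +oo
    --> (fun _ : 'rV[R]_n => 0 : R)}.
Proof.
have gp : periodic1 g by move=> y; have := g_per y 1; rewrite mulr1z.
have [gr gE] := reaction_of g_lip gp g_gt0; subst g.
rewrite hmean_integral; have gap := hmean_lt_amean g_nonconst.
have [L L0 uL] := lipschitz_const u0_lip.
set S := sup (range u0).
have uS y : u0 y <= S by apply: ub_le_sup => //; exists y.
have u0n0 : range u0 !=set0 by exists (u0 0), 0.
apply/fam_cvgP => K cK.
have [M [_ HM]] := compact_bounded cK.
have {}HM x : K x -> `|x| <= M + 1 by apply: HM; rewrite ltrDl.
move=> P /uniform_nbhs[E [+ EP]]; rewrite -entourage_ballE => -[d /= d0 dE].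
have [_ [x0 _ <-] x0S] : exists2 s, range u0 s & S - d / 2 < s.
  by apply: sup_adherent; [rewrite divr_gt0|split].
pose D := (amean gr - hmean gr) / 2.
have D0 : 0 < D by rewrite divr_gt0 // subr_gt0.
near=> t; apply: EP => x Kx; apply: dE; rewrite /ball /= sub0r normrN.
have t0 : 0 <= t by [].
have up := limit_le_flat ue_sol u_lim x uS t0.
have d4 : 0 < d / 4 by rewrite divr_gt0.
have far : (L + 1) * (1 + n%:R * `|x - x0|) <= D * t.
  rewrite -ler_pdivrMl //; apply: (@le_trans _ _
    (D^-1 * ((L + 1) * (1 + n%:R * (M + 1 + `|x0|))))); last by [].
  rewrite ler_wpM2l ?invr_ge0 ?(ltW D0) // ler_wpM2l ?addr_ge0 ?(ltW L0) //.
  by rewrite lerD2l ler_wpM2l // (le_trans (ler_normB _ _)) // lerD2r HM.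
have low := limit_ge_plateau ue_sol u_lim alpha01 gap (ltW L0) uL d4 t0 far.
rewrite ltr_norml; lra.
Unshelve. all: by end_near. Qed.
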